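(* For every dimension $n\ge 1$ there exists a constant $C$, depending only on $n$, such that the following holds. Let $u\in C^\infty(\overline{B_1})$ be superharmonic in $B_1\subset\mathbb{R}^n$, i.e. $-\Delta u\ge 0$ in $B_1$. Then $$\Big\| u-\frac{1}{|B_1\setminus B_{1/2}|}\int_{B_1\setminus B_{1/2}}u\,dx\Big\|_{L^1(B_1\setminus B_{1/2})}\le C\,\|u_r\|_{L^1(B_1\setminus B_{1/2})}$$ and $$\Big\| u-\frac{1}{|B_1|}\int_{B_1}u\,dx\Big\|_{L^1(B_1)}\le C\,\|u_r\|_{L^1(B_1)}.$$
   Context: $B_\rho\subset\mathbb{R}^n$ is the open ball of radius $\rho$ centered at the origin. The radial derivative of $u$ is $u_r(x)=\frac{x}{|x|}\cdot\nabla u(x)$ for $x\ne0$. *)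

(* Defs.v *)
From HB Require Import structures.
From mathcomp Require Import all_boot all_order all_algebra.
From mathcomp Require Import all_classical all_reals all_analysis.

Set Implicit Arguments.
Unset Strict Implicit.
Unset Printing Implicit Defensive.
Import Order.TTheory GRing.Theory Num.Theory.
Import numFieldNormedType.Exports.

Local Open Scope classical_set_scope.
Local Open Scope ring_scope.

Definition measure_rV_display : measure_display -> measure_display.
Proof. exact. Qed.

(* The product sigma-algebra on R^n, i.e. the one generated by the coordinate
   maps; for the Euclidean topology it is the Borel sigma-algebra. *)
Section measurable_rV.
Context {R : realType}.
Variable n : nat.

Let coord (i : 'I_n) (x : 'rV[R]_n) : measurableTypeR R := x ord0 i.

Let rV_set0 : g_sigma_preimage coord set0.
Proof. exact: sigma_algebra0. Qed.

Let rV_setC A : g_sigma_preimage coord A -> g_sigma_preimage coord (~` A).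
Proof. exact: sigma_algebraC. Qed.

Let rV_bigcup (F : _^nat) : (forall i, g_sigma_preimage coord (F i)) ->
  g_sigma_preimage coord (\bigcup_i (F i)).
Proof. exact: sigma_algebra_bigcup. Qed.

HB.instance Definition _ :=
  @isMeasurable.Build (measure_rV_display R.-ocitv.-measurable.-sigma)
  'rV[R]_n (g_sigma_preimage coord) rV_set0 rV_setC rV_bigcup.

End measurable_rV.

Lemma measurable_fun_rVP (R : realType) n d (T : measurableType d)
    (f : T -> 'rV[R]_n) :
  (forall i, measurable_fun setT (fun t => f t ord0 i : measurableTypeR R)) ->
  measurable_fun setT f.
Proof.
move=> mf; have : g_sigma_preimage
    (fun i t => f t ord0 i : measurableTypeR R) `<=` measurable.
  apply: smallest_sub; first exact: sigma_algebra_measurable.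
  case: n => [|n] in f mf *; first by rewrite big_ord0.
  rewrite -bigcup_mkord_ord; apply: bigcup_sub => i Ii.
  by move=> A [B mB <-]; exact: mf.
rewrite (g_sigma_preimage_comp
  (fun i (x : 'rV[R]_n) => x ord0 i : measurableTypeR R) f) => H _ A mA.
by apply: H; exists A.
Qed.

Section lebesgue_rV.
Context {R : realType}.
Local Open Scope ereal_scope.

Definition cons_rV n (p : measurableTypeR R * 'rV[R]_n) : 'rV[R]_n.+1 :=
  row_mx (const_mx p.1 : 'rV[R]_1) p.2.

Lemma cons_rV0 n (p : measurableTypeR R * 'rV[R]_n) : cons_rV p ord0 ord0 = p.1.
Proof.
have -> : ord0 = lshift n (ord0 : 'I_1) by exact/val_inj.
by rewrite (row_mxEl (const_mx p.1 : 'rV[R]_1) p.2) mxE.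
Qed.

Lemma cons_rVS n (p : measurableTypeR R * 'rV[R]_n) (i : 'I_n) :
  cons_rV p ord0 (lift ord0 i) = p.2 ord0 i.
Proof.
have -> : lift ord0 i = rshift 1 i by exact/val_inj.
by rewrite (row_mxEr (const_mx p.1 : 'rV[R]_1) p.2).
Qed.

Lemma measurable_coord_rV n (i : 'I_n) :
  measurable_fun setT (fun x : 'rV[R]_n => x ord0 i : measurableTypeR R).
Proof.
move=> _ Y mY; rewrite setTI; apply: sub_sigma_algebra => /=.
rewrite -bigcup_seq/=; exists i => /=; first by rewrite mem_index_enum.
by exists Y => //; rewrite setTI.
Qed.

Lemma measurable_cons_rV n : measurable_fun setT (@cons_rV n).
Proof.
apply: measurable_fun_rVP => i; have [j ->|->] := unliftP ord0 i.
  under eq_fun do rewrite cons_rVS.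
  exact: (measurableT_comp (measurable_coord_rV j) measurable_snd).
by under eq_fun do rewrite cons_rV0; exact: measurable_fst.
Qed.

Lemma measurable_box_rV n (A : 'I_n -> set (measurableTypeR R)) :
  (forall i, measurable (A i)) ->
  measurable [set x : 'rV[R]_n | forall i, A i (x ord0 i)].
Proof.
move=> mA.
rewrite (_ : mkset _ =
  \big[setI/setT]_(i < n) ((fun x : 'rV[R]_n => x ord0 i) @^-1` A i)).
  apply: bigsetI_measurable => i _; rewrite -[X in measurable X]setTI.
  exact: measurable_coord_rV.
rewrite -bigcap_seq; apply/seteqP; split=> x /= Hx; first by move=> i _; exact: Hx.
by move=> i; apply: Hx => /=; rewrite mem_index_enum.
Qed.

Section step.
Variables (n : nat) (m : {sigma_finite_measure set 'rV[R]_n -> \bar R}).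

Definition cons_lebesgue : set 'rV[R]_n.+1 -> \bar R :=
  pushforward (@lebesgue_measure R \x m) (@cons_rV n).

Let cons0 : cons_lebesgue set0 = 0.
Proof. by rewrite /cons_lebesgue /pushforward preimage_set0 measure0. Qed.

Let cons_ge0 A : 0 <= cons_lebesgue A.
Proof. exact: (measure_ge0 (@lebesgue_measure R \x m)). Qed.

Let cons_additive : semi_sigma_additive cons_lebesgue.
Proof.
move=> F mF tF mUF; rewrite /cons_lebesgue /pushforward preimage_bigcup.
have mc B : measurable B -> measurable (@cons_rV n @^-1` B).
  by move=> mB; rewrite -[X in measurable X]setTI; exact: measurable_cons_rV.
apply: measure_semi_sigma_additive.
- by move=> k; exact: mc.
- apply/trivIsetP => /= i j _ _ ij; rewrite -preimage_setI.
  by move/trivIsetP : tF => /(_ _ _ _ _ ij) ->//; rewrite preimage_set0.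
- by rewrite -preimage_bigcup; exact: mc.
Qed.

HB.instance Definition _ := isMeasure.Build _ _ _ cons_lebesgue
  cons0 cons_ge0 cons_additive.

Let uncons (x : 'rV[R]_n.+1) : measurableTypeR R * 'rV[R]_n :=
  (x ord0 ord0, \row_i x ord0 (lift ord0 i)).

Let cons_rVK : cancel (@cons_rV n) uncons.
Proof.
move=> [a x]; rewrite /uncons cons_rV0; congr pair.
by apply/rowP => i; rewrite mxE cons_rVS.
Qed.

Let measurable_uncons : measurable_fun setT uncons.
Proof.
apply/measurable_fun_pairP; split; first exact: measurable_coord_rV.
apply: measurable_fun_rVP => i.
rewrite (_ : (fun _ => _) = fun x : 'rV[R]_n.+1 => x ord0 (lift ord0 i)).
  exact: measurable_coord_rV.
by apply/funext => x; rewrite /= mxE.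
Qed.

Let cons_sigma_finite : sigma_finite setT cons_lebesgue.
Proof.
(* Reproved: the library's sigma-finiteness instance on [\x] is shadowed by the
   one for subprobabilities. *)
have [F TF Foo] : sigma_finite setT (@lebesgue_measure R \x m).
  have /sigma_finiteP[F [TF ndF Foo]] := sigma_finiteT (@lebesgue_measure R).
  have /sigma_finiteP[G [TG ndG Goo]] := sigma_finiteT m.
  exists (fun k => F k `*` G k).
    rewrite -setXTT TF TG predeqE => -[x y]; split.
      move=> [/= [k _ Fkx] [l _ Gly]]; exists (maxn k l) => //; split.
      - by move: x Fkx; exact/subsetPset/ndF/leq_maxl.
      - by move: y Gly; exact/subsetPset/ndG/leq_maxr.
    by move=> [k _ []/= ? ?]; split; exists k.
  move=> k; have [? ?] := Foo k; have [? ?] := Goo k.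
  split; first exact: measurableX.
  by rewrite product_measure1E// lte_mul_pinfty// ge0_fin_numE.
exists (fun k => uncons @^-1` F k).
  by rewrite -preimage_bigcup -TF preimage_setT.
move=> k; have [mF Fk] := Foo k; split.
  by rewrite -[X in measurable X]setTI; exact: measurable_uncons.
rewrite /cons_lebesgue /pushforward -comp_preimage.
by rewrite (_ : uncons \o _ = id)//; apply/funext => p; exact: cons_rVK.
Qed.

HB.instance Definition _ := Measure_isSigmaFinite.Build _ _ _ cons_lebesgue
  cons_sigma_finite.

End step.

(* n-dimensional Lebesgue measure, as the iterated product of the Lebesgue
   measure on the line; see [lebesgue_rV_box]. *)
Fixpoint lebesgue_rV n : {sigma_finite_measure set 'rV[R]_n -> \bar R} :=
  match n with
  | 0 => dirac (0%R : 'rV[R]_0)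
  | n'.+1 => cons_lebesgue (lebesgue_rV n')
  end.

Lemma lebesgue_rV_box n (A : 'I_n -> set (measurableTypeR R)) :
  (forall i, measurable (A i)) ->
  lebesgue_rV n [set x : 'rV[R]_n | forall i, A i (x ord0 i)] =
  \prod_(i < n) lebesgue_measure (A i).
Proof.
elim: n A => [|n IH] A mA.
  by rewrite big_ord0 /= diracE mem_set// => -[].
rewrite big_ord_recl -IH => [|i]; last exact: mA.
rewrite -[RHS]product_measure1E//; last first.
  exact: (@measurable_box_rV n (fun i => A (lift ord0 i))).
rewrite /= /cons_lebesgue /pushforward; congr (_ _).
apply/seteqP; split=> [p /= Ap|p [/= A0 AS] i].
  split=> /=; first by have := Ap ord0; rewrite cons_rV0.
  by move=> i; have := Ap (lift ord0 i); rewrite cons_rVS.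
have [j ->|->] := unliftP ord0 i; first by rewrite cons_rVS; exact: AS.
by rewrite cons_rV0.
Qed.

End lebesgue_rV.

Section euclidean_calculus.
Context {R : realType} {n : nat}.
Implicit Types (f u : 'rV[R]_n -> R) (x : 'rV[R]_n) (U D : set 'rV[R]_n).

(* [`|x|] on matrices is the sup norm, hence this separate definition. *)
Definition enorm x : R := Num.sqrt (\sum_(i < n) x ord0 i ^+ 2).

Definition eball (r : R) : set 'rV[R]_n := [set x | enorm x < r].

Definition partial (i : 'I_n) f : 'rV[R]_n -> R :=
  fun x => 'D_(delta_mx ord0 i) f x.

Definition iter_partial (s : seq 'I_n) f : 'rV[R]_n -> R := foldr partial f s.

Definition smooth_on U f : Prop := forall (s : seq 'I_n) x, U x ->
  {for x, continuous (iter_partial s f)} /\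
  forall i : 'I_n, derivable (iter_partial s f) x (delta_mx ord0 i).

(* f is in C^oo(closure U), for U open: f is smooth in U, and f and all its
   partial derivatives extend continuously from U to its closure (f itself
   being its own extension). *)
Definition smooth_on_closure U f : Prop :=
  [/\ smooth_on U f,
      {within closure U, continuous f} &
      forall s : seq 'I_n, exists2 g : 'rV[R]_n -> R,
        {within closure U, continuous g} &
        forall x, U x -> g x = iter_partial s f x].

Definition laplacian f : 'rV[R]_n -> R :=
  fun x => \sum_(i < n) partial i (partial i f) x.

Definition superharmonic_on U f : Prop :=
  forall x, U x -> 0 <= - laplacian f x.

(* The value at the origin, irrelevant below, is 0. *)
Definition radial_derive f : 'rV[R]_n -> R :=
  fun x => \sum_(i < n) (x ord0 i / enorm x) * partial i f x.

Definition mean D f : R :=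
  (\int[lebesgue_rV n]_(x in D) f x) / fine (lebesgue_rV n D).

Definition L1norm D f : \bar R :=
  (\int[lebesgue_rV n]_(x in D) `|f x|%:E)%E.

End euclidean_calculus.

(* Main.v *)
(* Let X be the integral of |u_r| over the annulus 1/4 <= |x|^2 < 1 and let f = - Laplacian u.
   Replacing a constant by the mean value costs a factor 2, so it suffices to find c with
   N := (integral of |u - c| over B_1) <= C X.

   Mass. Testing f against a radial cutoff which is constant on |x|^2 < 1/4 bounds the integral m
   of f over |x|^2 < 9/10 by C X.
   Increments. Put v = u - u(l .) with l = 9/10. Integrating u_r along rays bounds the integral of
   |v| over 31/100 <= |x|^2 < 1 by C X; Kato's inequality for |v| tested against a radial
   barrier which is strictly superharmonic on |x|^2 < 31/100 then bounds the integral over the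
   remaining ball by that on the shell plus C m. Iterating and scaling, u - u(l^k .) is
   bounded in L^1(B_1) by C_k X.
   Absorption. Near 0 let M be the mean of u against translates of a fixed tent kernel of radius
   1/2. By superharmonicity u - M is a positive average of f, so its L^1 norm is at most C m,
   whereas |M - M(0)| <= C e N on |x| < e. Choosing c = M(0) and e = l^k,
     N <= |u - u(e .)|_1 + e^-n (integral of |u - c| over |x| < e) <= C_k X + C e N,
   and e is chosen so small that the last term can be absorbed. *)
Require Import Defs.
From HB Require Import structures.
From mathcomp Require Import all_boot all_order all_algebra.
From mathcomp Require Import all_classical all_reals all_analysis.
From mathcomp Require Import measurable_realfun ring lra.
Set Implicit Arguments.
Unset Strict Implicit.
Unset Printing Implicit Defensive.
Import Order.TTheory GRing.Theory Num.Theory.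
Import numFieldNormedType.Exports.
Local Open Scope classical_set_scope.
Local Open Scope ring_scope.

(** * Integration of bounded functions of finite support *)

(** The obstacle is that the right-hand side controls neither tangential derivatives nor anything on
    |x| < 1/2, so no Poincaré inequality applies directly. Superharmonicity makes up for both: the
    mass of f carries information from the annulus inwards, and near the origin it keeps u close to
    its averages M. Dilations take the place of rotations: u is never compared with itself along a
    sphere, only along rays, down to a ball so small that M is almost constant on it. Both
    inequalities come out with the annulus norm X on the right.

    No fundamental solution appears, so the argument is the same in every dimension. Since u is
    known to be smooth only in the open ball, the tests are carried out on the product w of u with a
    cutoff; w equals u on |x|^2 < 19/20, which is the origin of that number. Mass is needed only on
    |x|^2 < 9/10, which contains the support of the barrier up to its boundary. Finally 31/100 is
    chosen so that (9/10)^2 (31/100) > 1/4: the segment from l x to x then stays in the annulus. *)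

Section bounded_finite_support.
Context d (T : measurableType d) (R : realType).
Variable m : {measure set T -> \bar R}.
Implicit Types (f g : T -> R) (A : set T).

(* Bounded, measurable and zero off a set of finite measure: a class stable under all
   operations below on which every integral is finite and Fubini applies. *)
Definition bfs f : Prop := measurable_fun setT f /\
  exists A, exists K : R, [/\ measurable A, (m A < +oo)%E &
    forall x, `|f x| <= K * \1_A x].

Lemma bfsP f : bfs f -> measurable_fun setT f /\
  exists A, exists K : R, [/\ measurable A, (m A < +oo)%E, 0 <= K &
    forall x, `|f x| <= K * \1_A x].
Proof.
move=> [mf [A [K [mA fA Kf]]]]; split => //; exists A, `|K|; split => // x.
by apply: le_trans (Kf x) _; rewrite ler_wpM2r// ler_norm.
Qed.

Lemma bfs_measurable f : bfs f -> measurable_fun setT f.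
Proof. by case. Qed.

Lemma bfs_indic A : measurable A -> (m A < +oo)%E -> bfs \1_A.
Proof.
move=> mA fA; split; first exact: measurable_indic.
by exists A, 1; split => // x; rewrite mul1r ger0_norm.
Qed.

Lemma bfs_le f g : measurable_fun setT f -> bfs g ->
  (forall x, `|f x| <= `|g x|) -> bfs f.
Proof.
move=> mf [_ [A [K [mA fA Kg]]]] fg; split => //; exists A, K; split => // x.
exact: le_trans (fg x) (Kg x).
Qed.

Lemma bfs_integrable f : bfs f -> m.-integrable setT (EFin \o f).
Proof.
move=> /bfsP[mf [A [K [mA fA K0 Kf]]]].
have -> : f = f \_ A.
  apply/funext => x; rewrite patchE; case: ifPn => // xA.
  apply/eqP; rewrite -normr_le0; apply: le_trans (Kf x) _.
  by rewrite indicE (negbTE xA) mulr0.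
rewrite -restrict_EFin; apply/(integrable_mkcond _ mA).
apply: measurable_bounded_integrable => //; first exact: measurable_funTS.
exists K; split; first exact: num_real.
move=> M KM x Ax /=; apply: le_trans (Kf x) _.
by rewrite indicE mem_set// mulr1 ltW.
Qed.

Lemma bfsD f g : bfs f -> bfs g -> bfs (fun x => f x + g x).
Proof.
move=> /bfsP[mf [A [K [mA fA K0 Kf]]]] /bfsP[mg [B [L [mB fB L0 Lg]]]].
split; first exact: measurable_funD.
exists (A `|` B), (K + L); split; first exact: measurableU.
  by rewrite (le_lt_trans (measureU2 _ mA mB))// lte_add_pinfty.
move=> x; apply: le_trans (ler_normD _ _) _; rewrite mulrDl lerD//.
  apply: le_trans (Kf x) _; rewrite ler_wpM2l// !indicE ler_nat.
  by case: (boolP (x \in A)) => //= xA; rewrite mem_set//; left; exact: set_mem.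
apply: le_trans (Lg x) _; rewrite ler_wpM2l// !indicE ler_nat.
by case: (boolP (x \in B)) => //= xA; rewrite mem_set//; right; exact: set_mem.
Qed.

Lemma bfsMb f g (K : R) : measurable_fun setT g -> (forall x, `|g x| <= K) ->
  bfs f -> bfs (fun x => g x * f x).
Proof.
move=> mg Kg [mf [A [L [mA fA Lf]]]]; split; first exact: measurable_funM.
exists A, (K * L); split => // x; rewrite normrM -mulrA ler_pM//.
Qed.

Lemma bfsZ f (k : R) : bfs f -> bfs (fun x => k * f x).
Proof. by apply: (@bfsMb f (cst k) `|k|); [exact: measurable_cst|move=> x]. Qed.

Lemma bfsN f : bfs f -> bfs (fun x => - f x).
Proof.
move=> bf; apply: (bfs_le _ bf) => [|x]; last by rewrite normrN.
by apply: measurableT_comp => //; exact: bfs_measurable.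
Qed.

Lemma bfsB f g : bfs f -> bfs g -> bfs (fun x => f x - g x).
Proof. by move=> bf bg; apply: bfsD => //; exact: bfsN. Qed.

Lemma bfs_norm f : bfs f -> bfs (fun x => `|f x|).
Proof.
move=> bf; apply: (bfs_le _ bf) => [|x]; last by rewrite normr_id.
by apply: measurableT_comp => //; exact: bfs_measurable.
Qed.

Lemma bfs0 : bfs (fun=> 0).
Proof.
split => //; exists set0, 0; split => //; first by rewrite measure0.
by move=> x; rewrite normr0 mul0r.
Qed.

Lemma bfs_sum (I : Type) (r : seq I) (F : I -> T -> R) :
  (forall i, bfs (F i)) -> bfs (fun x => \sum_(i <- r) F i x).
Proof.
move=> bF; elim: r => [|i r IH].
  by under eq_fun do rewrite big_nil; exact: bfs0.
by under eq_fun do rewrite big_cons; exact: bfsD.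
Qed.

Definition rint (f : T -> R) : R := \int[m]_x f x.

Lemma rintE f : bfs f -> (rint f)%:E = (\int[m]_x (f x)%:E)%E.
Proof.
by move=> bf; rewrite fineK//; apply: integrable_fin_num => //; exact: bfs_integrable.
Qed.

Lemma rintD f g : bfs f -> bfs g -> rint (fun x => f x + g x) = rint f + rint g.
Proof. by move=> bf bg; rewrite /rint RintegralD//; exact: bfs_integrable. Qed.

Lemma rintB f g : bfs f -> bfs g -> rint (fun x => f x - g x) = rint f - rint g.
Proof. by move=> bf bg; rewrite /rint RintegralB//; exact: bfs_integrable. Qed.

Lemma rintZ f (k : R) : bfs f -> rint (fun x => k * f x) = k * rint f.
Proof. by move=> bf; rewrite /rint RintegralZl//; exact: bfs_integrable. Qed.

Lemma rint_le f g : bfs f -> bfs g -> (forall x, f x <= g x) -> rint f <= rint g.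
Proof. by move=> bf bg fg; rewrite /rint le_Rintegral//; exact: bfs_integrable. Qed.

Lemma rint_ge0 f : (forall x, 0 <= f x) -> 0 <= rint f.
Proof. by move=> f0; rewrite /rint Rintegral_ge0. Qed.

Lemma rint_norm f : bfs f -> `|rint f| <= rint (fun x => `|f x|).
Proof. by move=> bf; rewrite /rint le_normr_Rintegral//; exact: bfs_integrable. Qed.

Lemma rint0 : rint (fun=> 0) = 0.
Proof. by rewrite /rint /Rintegral integral0. Qed.

Lemma rint_sum (I : Type) (r : seq I) (F : I -> T -> R) :
  (forall i, bfs (F i)) ->
  rint (fun x => \sum_(i <- r) F i x) = \sum_(i <- r) rint (F i).
Proof.
move=> bF; elim: r => [|i r IH].
  by under eq_fun do rewrite big_nil; rewrite big_nil rint0.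
under eq_fun do rewrite big_cons.
by rewrite big_cons rintD ?IH//; exact: bfs_sum.
Qed.

Lemma rint_indic A : measurable A -> rint \1_A = fine (m A).
Proof. by move=> mA; rewrite /rint /Rintegral integral_indic// setIT. Qed.

Lemma eq_rint f g : f =1 g -> rint f = rint g.
Proof. by move=> fg; congr rint; exact/funext. Qed.

End bounded_finite_support.

(** * Fubini's theorem for bounded functions supported in a rectangle *)

Section fubini_bfs.
Context d1 d2 (T1 : measurableType d1) (T2 : measurableType d2) (R : realType).
Variables (m1 : {sigma_finite_measure set T1 -> \bar R})
  (m2 : {sigma_finite_measure set T2 -> \bar R}).
Variable F : T1 * T2 -> R.

(** The support is asked to lie in a rectangle with sides of finite measure: a general set of finite
    product measure may have sections of infinite measure, whereas here every section is [bfs]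
    again. *)
Definition bfs2 := measurable_fun setT F /\
  exists A, exists B, exists K : R,
    [/\ measurable A /\ (m1 A < +oo)%E, measurable B /\ (m2 B < +oo)%E, 0 <= K &
    forall x y, `|F (x, y)| <= K * \1_A x * \1_B y].

Hypothesis bF : bfs2.

Lemma bfs2_xsection x : bfs m2 (fun y => F (x, y)).
Proof.
have [mF [A [B [K [[mA fA] [mB fB] K0 KF]]]]] := bF.
split; first exact: measurableT_comp.
by exists B, (K * \1_A x).
Qed.

Lemma bfs2_ysection y : bfs m1 (fun x => F (x, y)).
Proof.
have [mF [A [B [K [[mA fA] [mB fB] K0 KF]]]]] := bF.
split; first exact: measurableT_comp.
exists A, (K * \1_B y); split => // x.
by apply: le_trans (KF x y) _; rewrite -!mulrA (mulrC (\1_A x)).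
Qed.

Lemma bfs_prod : bfs (m1 \x m2)%E F.
Proof.
have [mF [A [B [K [[mA fA] [mB fB] K0 KF]]]]] := bF.
split => //; exists (A `*` B), K; split; first exact: measurableX.
  by rewrite [X in (X < _)%E]product_measure1E// lte_mul_pinfty// ge0_fin_numE.
move=> [x y]; apply: le_trans (KF x y) _.
rewrite -mulrA ler_wpM2l// !indicE -natrM ler_nat.
by case: (boolP (x \in A)) => //= xA; case: (boolP (y \in B)) => //= yB;
  rewrite mem_set//=; split; exact: set_mem.
Qed.

Lemma bfs_rint_xsection : bfs m1 (fun x => rint m2 (fun y => F (x, y))).
Proof.
have [mF [A [B [K [[mA fA] [mB fB] K0 KF]]]]] := bF.
split.
  apply: measurableT_comp; first exact: fine_measurable.
  exact: (@measurable_fubini_F _ _ _ _ _ m1 m2 (EFin \o F) (bfs_integrable bfs_prod)).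
exists A, (K * fine (m2 B)); split => // x.
apply: le_trans (rint_norm (bfs2_xsection x)) _.
apply: (@le_trans _ _ (rint m2 (fun y => (K * \1_A x) * \1_B y))).
  by apply: rint_le => //; [apply: bfs_norm; exact: bfs2_xsection|apply: bfsZ; exact: bfs_indic].
by rewrite rintZ ?rint_indic//; [rewrite mulrAC|exact: bfs_indic].
Qed.

Lemma bfs_rint_ysection : bfs m2 (fun y => rint m1 (fun x => F (x, y))).
Proof.
have [mF [A [B [K [[mA fA] [mB fB] K0 KF]]]]] := bF.
split.
  apply: measurableT_comp; first exact: fine_measurable.
  exact: (@measurable_fubini_G _ _ _ _ _ m1 m2 (EFin \o F) (bfs_integrable bfs_prod)).
exists B, (K * fine (m1 A)); split => // y.
apply: le_trans (rint_norm (bfs2_ysection y)) _.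
apply: (@le_trans _ _ (rint m1 (fun x => (K * \1_B y) * \1_A x))).
  apply: rint_le => //; [apply: bfs_norm; exact: bfs2_ysection|apply: bfsZ; exact: bfs_indic|].
  by move=> x; apply: le_trans (KF x y) _; rewrite mulrAC.
by rewrite rintZ ?rint_indic//; [rewrite mulrAC|exact: bfs_indic].
Qed.

Lemma rint_xsection :
  rint m1 (fun x => rint m2 (fun y => F (x, y))) = rint (m1 \x m2)%E F.
Proof.
rewrite /rint /Rintegral -integral12_prod_meas1 ?(bfs_integrable bfs_prod)//.
congr fine; apply: eq_integral => x _; exact: (rintE (bfs2_xsection x)).
Qed.

Lemma rint_fubini :
  rint m1 (fun x => rint m2 (fun y => F (x, y))) =
  rint m2 (fun y => rint m1 (fun x => F (x, y))).
Proof.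
rewrite rint_xsection /rint /Rintegral -integral21_prod_meas1 ?(bfs_integrable bfs_prod)//.
congr fine; apply: eq_integral => y _; exact: (esym (rintE (bfs2_ysection y))).
Qed.

End fubini_bfs.

(** * Lebesgue measure on R^n: open sets, affine changes of variables *)

Section measurability_rV.
Context {R : realType} {n : nat}.
Implicit Types (O : set 'rV[R]_n) (f : 'rV[R]_n -> R).

(** The sigma-algebra is generated by the coordinates, so an open set is exhibited as the union of
    the cubes with rational centre and half-side 1/(k+1) that it contains; there are countably many
    of them. *)
Lemma open_measurable_rV O : open O -> measurable O.
Proof.
move=> oO.
pose B (p : 'rV[rat]_n * nat) := [set y : 'rV[R]_n | forall i,
  [set t : measurableTypeR R | `|t - ratr (p.1 ord0 i)| < p.2.+1%:R^-1]
    (y ord0 i)].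
have mB p : measurable (B p).
  apply: (@measurable_box_rV R n (fun i => [set t : measurableTypeR R |
    `|t - ratr (p.1 ord0 i)| < p.2.+1%:R^-1])) => i.
  rewrite (_ : [set _ | _] = ball (ratr (p.1 ord0 i) : R) p.2.+1%:R^-1).
    exact: measurable_ball.
  by apply/seteqP; split => t; rewrite /ball/= distrC.
have -> : O = \bigcup_(p in [set p | B p `<=` O]) B p.
  apply/seteqP; split => [x Ox|x [p /= + Bx]]; last exact.
  have /nbhs_ballP[e /= e0 eO] : nbhs x O by exact: open_nbhs_nbhs.
  (* With half-side below e/2, a cube containing x lies within sup-distance e of x. *)
  have [k ke] : exists k : nat, k.+1%:R^-1 < e / 2.
    have [k _ /(_ k (leqnn _))] := near_infty_natSinv_lt (PosNum (divr_gt0 e0 (ltr0Sn R 1))).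
    by exists k.
  have k0 : 0 < k.+1%:R^-1 :> R by rewrite invr_gt0.
  have /choice[c Hc] i : exists r : rat, `|x ord0 i - ratr r| < k.+1%:R^-1.
    have /rat_in_itvoo[r] : x ord0 i - k.+1%:R^-1 < x ord0 i + k.+1%:R^-1.
      by rewrite ltrBlDr -addrA ltrDl addr_gt0.
    rewrite in_itv/=; move: (k.+1%:R^-1) => d /andP[? ?]; exists r.
    by rewrite ltr_norml; lra.
  have xB : B (\row_i c i, k) x by move=> i /=; rewrite mxE.
  exists (\row_i c i, k) => //= y By; apply: eO; split => // i j.
  rewrite ord1 /ball/=; have := xB j; have := By j; rewrite /= !mxE.
  move: (k.+1%:R^-1) ke => d de; rewrite !ltr_norml; lra.
rewrite bigcup_mkcond; apply: countable_bigcupT_measurable => // p.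
by case: ifP.
Qed.

End measurability_rV.

Section affine_change.
Context {R : realType}.
Local Open Scope ereal_scope.

Lemma measurable_affine (a b : R) :
  measurable_fun setT (fun t : measurableTypeR R => a * t + b : measurableTypeR R)%R.
Proof. by apply: measurable_funD => //; apply: measurable_funM. Qed.

(** Uniqueness of Lebesgue measure: the right-hand side is a measure in A that gives half-open
    intervals their length. *)
Lemma lebesgue_measure_affine (a b : R) : (0 < a)%R ->
  forall A, measurable A ->
  @lebesgue_measure R A = a%:E * @lebesgue_measure R
    ((fun t => a * t + b)%R @^-1` A).
Proof.
move=> a0 A mA.
pose phi (t : measurableTypeR R) : measurableTypeR R := (a * t + b)%R.
have mphi : measurable_fun setT phi := measurable_affine a b.
pose nu : {measure set (measurableTypeR R) -> \bar R} :=
  mscale (NngNum (ltW a0)) (pushforward (@lebesgue_measure R) phi).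
transitivity (nu mphi A); last by [].
apply: lebesgue_measure_unique mA.
move=> _ [[x y] _ <-].
change (lebesgue_measure `]x, y] =
  a%:E * lebesgue_measure (phi @^-1` `]x, y]%classic)).
rewrite [_ @^-1` _](_ : _ = `](a^-1 * (x - b))%R, (a^-1 * (y - b))%R]%classic); last first.
  apply/seteqP; split => t /=; rewrite !in_itv/= /phi;
    by rewrite ltr_pdivrMl// ler_pdivlMl// ltrBlDr lerBrDr.
rewrite !lebesgue_measure_itv/= !lte_fin ltr_pM2l ?invr_gt0// ltrD2r.
case: ifP => _; last by rewrite mule0.
by rewrite -!EFinD -EFinM -mulrBr mulrA divff ?gt_eqF// mul1r opprB addrA subrK.
Qed.

Lemma ge0_integral_affine1 (a b : R) (g : measurableTypeR R -> \bar R) :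
  (0 < a)%R -> measurable_fun setT g -> (forall t, 0 <= g t) ->
  \int[@lebesgue_measure R]_t g (a * t + b)%R =
  (a^-1)%:E * \int[@lebesgue_measure R]_t g t.
Proof.
move=> a0 mg g0.
pose phi (t : measurableTypeR R) : measurableTypeR R := (a * t + b)%R.
have mphi : measurable_fun setT phi := measurable_affine a b.
rewrite (_ : \int[@lebesgue_measure R]_t g t =
    a%:E * \int[@lebesgue_measure R]_t g (phi t)).
  by rewrite muleA -EFinM mulVf ?gt_eqF// mul1e.
pose nu : {measure set (measurableTypeR R) -> \bar R} :=
  mscale (NngNum (ltW a0)) (pushforward (@lebesgue_measure R) phi).
rewrite (eq_measure_integral (nu mphi)); last first.
  by move=> A mA _; exact: lebesgue_measure_affine.
by rewrite ge0_integral_mscale//= ge0_integral_pushforward.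
Qed.

Lemma cons_rV_affine n (a : R) (b : 'rV[R]_n.+1) (p : measurableTypeR R * 'rV[R]_n) :
  (a *: cons_rV p + b)%R =
  cons_rV (a * p.1 + b ord0 ord0, a *: p.2 + \row_i b ord0 (lift ord0 i))%R.
Proof.
apply/rowP => i; have [j ->|->] := unliftP ord0 i.
  by rewrite mxE [X in (X + _)%R]mxE !cons_rVS !mxE.
by rewrite mxE [X in (X + _)%R]mxE !cons_rV0.
Qed.

Lemma ge0_integral_cons n (g : 'rV[R]_n.+1 -> \bar R) :
  measurable_fun setT g -> (forall x, 0 <= g x) ->
  \int[lebesgue_rV n.+1]_x g x =
  \int[@lebesgue_measure R]_t \int[lebesgue_rV n]_y g (cons_rV (t, y)).
Proof.
move=> mg g0.
have -> : \int[@lebesgue_measure R]_t \int[lebesgue_rV n]_y g (cons_rV (t, y)) =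
    \int[@lebesgue_measure R \x lebesgue_rV n]_p g (cons_rV p).
  rewrite (fubini_tonelli1 (g \o @cons_rV R n))//.
    exact: (measurableT_comp mg (@measurable_cons_rV R n)).
  by move=> x; exact: g0.
have := @ge0_integral_pushforward _ _ _ _ R (@cons_rV R n) (@measurable_cons_rV R n)
  (@lebesgue_measure R \x lebesgue_rV n) setT g measurableT.
by rewrite preimage_setT => H; exact: (H mg (fun x _ => g0 x)).
Qed.

(** Induction on the dimension: Tonelli splits off the first coordinate, to which the
    one-dimensional rule applies, and the induction hypothesis treats the others. *)
Lemma ge0_integral_affine n (a : R) (b : 'rV[R]_n) (g : 'rV[R]_n -> \bar R) :
  (0 < a)%R -> measurable_fun setT g -> (forall x, 0 <= g x) ->
  \int[lebesgue_rV n]_x g (a *: x + b)%R =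
  (a^-1 ^+ n)%:E * \int[lebesgue_rV n]_x g x.
Proof.
move=> a0; elim: n b g => [|n IH] b g mg g0.
  rewrite expr0 mul1e; apply: eq_integral => x _; congr g.
  by apply/rowP => -[].
have mgb : measurable_fun setT (fun x : 'rV[R]_n.+1 => g (a *: x + b)%R).
  apply: (measurableT_comp mg); apply: measurable_fun_rVP => i.
  under eq_fun do rewrite !mxE.
  by apply: (measurableT_comp (measurable_affine a (b ord0 i))); exact: measurable_coord_rV.
rewrite ge0_integral_cons//.
under eq_integral => t _.
  under eq_integral => y _ do rewrite cons_rV_affine/=.
  rewrite (IH _ (fun y => g (cons_rV (a * t + b ord0 ord0, y))%R))//; last first.
    apply: (measurableT_comp mg).
    by apply: (measurableT_comp (@measurable_cons_rV R n)).
  over.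
have mgc : measurable_fun setT (g \o @cons_rV R n).
  exact: (measurableT_comp mg (@measurable_cons_rV R n)).
have mF : measurable_fun setT
    (fun t : measurableTypeR R => \int[lebesgue_rV n]_x g (cons_rV (t, x))).
  apply: (measurable_fun_fubini_tonelli_F (g \o @cons_rV R n)) => // p.
  exact: g0.
have F0 t : 0 <= \int[lebesgue_rV n]_x g (cons_rV (t, x)).
  by apply: integral_ge0.
rewrite (@ge0_integral_affine1 a (b ord0 ord0) (fun t => (a^-1 ^+ n)%:E *
  \int[lebesgue_rV n]_x g (cons_rV (t, x))) a0); last 2 first.
  exact: measurable_funeM.
  by move=> t; apply: mule_ge0 => //; rewrite lee_fin exprn_ge0// invr_ge0 ltW.
rewrite ge0_integralZl//; last by rewrite lee_fin exprn_ge0// invr_ge0 ltW.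
by rewrite muleA -EFinM -exprS ge0_integral_cons.
Qed.

Lemma measurable_affine_rV n (a : R) (b : 'rV[R]_n) :
  measurable_fun setT (fun x : 'rV[R]_n => a *: x + b)%R.
Proof.
apply: measurable_fun_rVP => i; under eq_fun do rewrite !mxE.
exact: (measurableT_comp (measurable_affine a (b ord0 i))
  (measurable_coord_rV i)).
Qed.

Lemma bfs_affine n (a : R) (b : 'rV[R]_n) (f : 'rV[R]_n -> R) :
  (0 < a)%R -> bfs (lebesgue_rV n) f ->
  bfs (lebesgue_rV n) (fun x => f (a *: x + b)%R).
Proof.
move=> a0 [mf [A [K [mA fA Kf]]]].
have mab := measurable_affine_rV a b.
split; first exact: measurableT_comp.
have mB : measurable ((fun x : 'rV[R]_n => a *: x + b)%R @^-1` A).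
  by rewrite -[X in measurable X]setTI; exact: mab.
exists ((fun x : 'rV[R]_n => a *: x + b)%R @^-1` A), K; split => //.
have := @ge0_integral_affine n a b (EFin \o \1_A) a0.
rewrite (integral_indic _ _ mA)// setIT.
have -> : \int[lebesgue_rV n]_x (EFin \o \1_A) (a *: x + b)%R =
    lebesgue_rV n ((fun x : 'rV[R]_n => a *: x + b)%R @^-1` A).
  by rewrite -(setIT (_ @^-1` _)) -integral_indic.
move=> H; rewrite [X in X < _]H//; last by move=> x; rewrite lee_fin.
  by rewrite lte_mul_pinfty// lee_fin exprn_ge0// invr_ge0 ltW.
by apply/measurable_EFinP; exact: measurable_indic.
Qed.

(** The rule for nonnegative functions is applied to |f| and to |f| - f, both [bfs] and nonnegative,
    whose difference is f. *)
Lemma rint_affine n (a : R) (b : 'rV[R]_n) (f : 'rV[R]_n -> R) :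
  (0 < a)%R -> bfs (lebesgue_rV n) f ->
  rint (lebesgue_rV n) (fun x => f (a *: x + b)%R) =
  (a^-1 ^+ n * rint (lebesgue_rV n) f)%R.
Proof.
move=> a0.
have pos (g : 'rV[R]_n -> R) : bfs (lebesgue_rV n) g -> (forall x, 0 <= g x)%R ->
    rint (lebesgue_rV n) (fun x => g (a *: x + b)%R) =
    (a^-1 ^+ n * rint (lebesgue_rV n) g)%R.
  move=> bg g0; apply: EFin_inj; rewrite EFinM !rintE//; last exact: bfs_affine.
  apply: (@ge0_integral_affine n a b (EFin \o g) a0); last by move=> x; rewrite lee_fin.
  by apply/measurable_EFinP; case: bg.
move=> bf; have bn := bfs_norm bf; have bd := bfsB bn bf.
have fE x : f x = (`|f x| - (`|f x| - f x))%R by rewrite opprB addrC subrK.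
rewrite (eq_rint _ fE) (eq_rint _ (fun x : 'rV[R]_n => fE (a *: x + b)%R)).
rewrite rintB//; [|exact: (@bfs_affine n a b _ a0 bn)|exact: (@bfs_affine n a b _ a0 bd)].
rewrite (rintB bn bd) mulrBr -!pos// => x.
by rewrite subr_ge0 ler_norm.
Qed.

End affine_change.

(** * Derivatives along lines *)

Section pointwise_derivation.
Context {R : realType} {V : normedModType R}.
Implicit Types (f g : V -> R) (x v : V).

Lemma isd_cst (c : R) x v : is_derive x v (fun=> c) 0.
Proof. exact: is_derive_cst. Qed.

Lemma isdD f g x v (df dg : R) : is_derive x v f df -> is_derive x v g dg ->
  is_derive x v (fun y => f y + g y) (df + dg).
Proof. exact: is_deriveD. Qed.

Lemma isdN f x v (df : R) : is_derive x v f df ->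
  is_derive x v (fun y => - f y) (- df).
Proof. exact: is_deriveN. Qed.

Lemma isdB f g x v (df dg : R) : is_derive x v f df -> is_derive x v g dg ->
  is_derive x v (fun y => f y - g y) (df - dg).
Proof. exact: is_deriveB. Qed.

Lemma isdM f g x v (df dg : R) : is_derive x v f df -> is_derive x v g dg ->
  is_derive x v (fun y => f y * g y) (f x * dg + g x * df).
Proof. exact: is_deriveM. Qed.

Lemma isdZ (k : R) f x v (df : R) : is_derive x v f df ->
  is_derive x v (fun y => k * f y) (k * df).
Proof. exact: is_deriveZ. Qed.

Lemma isd_sum n (h : 'I_n -> V -> R) x v (dh : 'I_n -> R) :
  (forall i, is_derive x v (h i) (dh i)) ->
  is_derive x v (fun y => \sum_(i < n) h i y) (\sum_(i < n) dh i).
Proof.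
move=> dhi; rewrite (_ : (fun y => _) = \sum_(i < n) h i).
  exact: is_derive_sum.
by apply/funext => y; rewrite fct_sumE.
Qed.

(** Decouples two halves of a computation: the rules determine some value of the derivative by
    unification, and its identification with the wanted one is left to [ring] or [field]. *)
Lemma isd_eq f x v (df f' : R) : is_derive x v f f' -> f' = df ->
  is_derive x v f df.
Proof. by move=> ? <-. Qed.

End pointwise_derivation.

Lemma isd_id {R : realType} (t : R) :
  is_derive (t : R) 1 (fun s : R => s) (1 : R).
Proof. exact: is_derive_id. Qed.

Section line_derivation.
Context {R : realType} {V : normedModType R}.
Implicit Types (f g : V -> R) (x v : V).

(** Both sides are limits of one and the same difference quotient. *)
Lemma is_derive_line f x v (t df : R) :
  is_derive (x + t *: v) v f df <->
  is_derive (t : R) 1 (fun s : R => f (x + s *: v)) df.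
Proof.
have E : (fun h : R => h^-1 *: ((f \o shift (x + t *: v)) (h *: v) - f (x + t *: v))) =
         (fun h : R => h^-1 *: (((fun s : R => f (x + s *: v)) \o shift t) (h *: 1) -
           (fun s : R => f (x + s *: v)) t)).
  apply/funext => h /=; congr (_ *: (f _ - _)).
  by rewrite [h *: 1]mulr1 scalerDl addrC -addrA (addrC (t *: v)).
by split => -[H1 H2]; apply: DeriveDef;
  rewrite /derivable /derive ?E -?E in H1 H2 *.
Qed.

Lemma is_derive_line0 f x v (df : R) :
  is_derive x v f df <-> is_derive (0 : R) 1 (fun s : R => f (x + s *: v)) df.
Proof. by rewrite -is_derive_line scale0r addr0. Qed.

Lemma isd_comp (h : R -> R) f x v (dh df : R) :
  is_derive (f x) 1 h dh -> is_derive x v f df ->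
  is_derive x v (fun y => h (f y)) (dh * df).
Proof.
move=> Hh /is_derive_line0 Hf; apply/is_derive_line0.
have Hh0 : is_derive (f (x + 0 *: v)) 1 h dh by rewrite scale0r addr0.
exact: (is_derive1_comp Hh0 Hf).
Qed.

Lemma isd_affine f (a : R) (b : V) x v (df : R) :
  is_derive (a *: x + b) v f df ->
  is_derive x v (fun y => f (a *: y + b)) (a * df).
Proof.
move=> Hf; apply/is_derive_line0.
have Ha : is_derive (0 : R) 1 (fun s : R => a * s) a.
  by have := isdZ a (isd_id 0); rewrite mulr1.
have Hf0 : is_derive (a * 0 : R) 1 (fun s : R => f (a *: x + b + s *: v)) df.
  by apply/is_derive_line; rewrite mulr0 scale0r addr0.
have := is_derive1_comp Hf0 Ha.
rewrite mulrC; congr (is_derive _ _ _ _).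
by apply/funext => s /=; rewrite scalerDr scalerA addrAC.
Qed.

End line_derivation.

Section one_variable.
Context {R : realType}.

(** The difference quotient at 0 is g itself. This serves at the kink of the truncated powers. *)
Lemma is_derive_mul0 (g : R -> R) : {for 0, continuous g} ->
  is_derive (0 : R) 1 (fun t => t * g t) (g 0).
Proof.
move=> cg.
have H : h^-1 *: (((fun t => t * g t) \o shift 0) (h *: 1) - 0 * g 0) @[h --> 0^'] --> g 0.
  have cg' : g h @[h --> 0^'] --> g 0 by apply/continuous_withinNx.
  apply: cvg_trans cg'.
  apply: near_eq_cvg; near=> h.
  have h0 : h != 0 by near: h; exact: nbhs_dnbhs_neq.
  by rewrite /= [h *: 1]mulr1 addr0 mul0r subr0 scalerA mulVf// scale1r.
by apply: DeriveDef; [apply/cvg_ex; exists (g 0)|exact: cvg_lim].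
Unshelve. all: by end_near. Qed.

(** Truncated powers, of class C^1 and C^2. The cutoffs and the barrier are assembled from them, so
    that signs and sizes become questions about polynomials. *)
Definition pos2 (t : R) : R := Num.max t 0 ^+ 2.
Definition pos3 (t : R) : R := Num.max t 0 ^+ 3.

Lemma is_derive_pos2 (t : R) : is_derive t 1 pos2 (2 * Num.max t 0).
Proof.
have [t0|t0|->] := ltgtP t 0.
- rewrite mulr0; apply: near_eq_is_derive (isd_cst 0 t 1).
  near=> s; rewrite /pos2 max_r ?expr0n//=.
  by apply: ltW; near: s; exact: lt_nbhsl.
- have H : is_derive t 1 (fun s : R => s * s) (2 * t).
    by apply: (isd_eq (isdM (isd_id t) (isd_id t))); ring.
  apply: near_eq_is_derive H.
  near=> s; rewrite /pos2 max_l ?expr2//.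
  by apply: ltW; near: s; exact: lt_nbhsr.
rewrite mulr0 (_ : pos2 = fun t => t * Num.max t 0).
  have := @is_derive_mul0 (fun t => Num.max t 0); rewrite maxxx; apply.
  by apply: continuous_max; [exact: cvg_id|exact: cvg_cst].
apply/funext => s; rewrite /pos2 expr2.
by case: (leP s 0) => s0; rewrite ?mulr0.
Unshelve. all: by end_near. Qed.

Lemma is_derive_pos3 (t : R) : is_derive t 1 pos3 (3 * Num.max t 0 ^+ 2).
Proof.
have -> : pos3 = fun t => t * pos2 t.
  apply/funext => s; rewrite /pos3 /pos2 exprS.
  by case: (leP s 0) => s0 //; rewrite expr0n/= !mulr0.
apply: (isd_eq (isdM (isd_id t) (is_derive_pos2 t))).
rewrite /pos2 mulr1; case: (leP t 0) => t0; first by rewrite !mulr0 expr0n/= mulr0 addr0.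
by ring.
Qed.

End one_variable.

Section open_measurable.
Context {R : realType} {n : nat}.
Implicit Types (O : set 'rV[R]_n) (f : 'rV[R]_n -> R).

Lemma open_continuous_measurable_rV O f : open O ->
  (forall x, O x -> {for x, continuous f}) -> measurable_fun O f.
Proof.
move=> oO cf; apply: (measurability _ (RGenOpens.measurableE R)).
move=> _ [_ [a [b ->] <-]]; apply: open_measurable_rV.
rewrite openE => x [Ox fx]; apply: filterI; first exact: open_nbhs_nbhs.
by apply: (cf x Ox); apply: open_nbhs_nbhs; split => //; exact: interval_open.
Qed.

Lemma continuous_measurable_rV f : continuous f -> measurable_fun setT f.
Proof. by move=> cf; apply: open_continuous_measurable_rV; [exact: openT|move=> x _; exact: cf]. Qed.

Lemma patch_measurable_rV O f : measurable O -> measurable_fun O f ->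
  measurable_fun setT (fun x => \1_O x * f x).
Proof.
move=> mO mf; rewrite (_ : (fun _ => _) = f \_ O).
  exact/(measurable_restrictT _ _).1.
by apply/funext => x; rewrite patchE indicE; case: ifPn; rewrite (mul1r, mul0r).
Qed.

End open_measurable.

(** * Euclidean balls and integration by parts *)

Section squared_norm.
Context {R : realType}.

(** Radial functions are written as profiles in |x|^2 rather than |x|: a polynomial with gradient 2x
    and no singularity at the origin. *)
Definition sqn n (x : 'rV[R]_n) : R := \sum_(i < n) x ord0 i ^+ 2.

(* [sball r] has radius sqrt r. *)
Definition sball n (r : R) : set 'rV[R]_n := [set x | sqn x < r].

Context {n : nat}.
Implicit Types (x y : 'rV[R]_n) (f : 'rV[R]_n -> R).

Lemma sqn_ge0 x : 0 <= sqn x.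
Proof. by apply: sumr_ge0 => i _; rewrite sqr_ge0. Qed.

Lemma sqnZ a x : sqn (a *: x) = a ^+ 2 * sqn x.
Proof.
by rewrite /sqn mulr_sumr; apply: eq_bigr => i _; rewrite mxE exprMn.
Qed.

Lemma sqnD_le x y : sqn (x + y) <= 2 * sqn x + 2 * sqn y.
Proof.
rewrite /sqn !mulr_sumr -big_split ler_sum//= => i _.
by rewrite mxE; have := sqr_ge0 (x ord0 i - y ord0 i); nra.
Qed.

Lemma coord_sqn x i : x ord0 i ^+ 2 <= sqn x.
Proof. by rewrite /sqn (bigD1 i)//= lerDl sumr_ge0// => j _; rewrite sqr_ge0. Qed.

Lemma continuous_coord i : continuous (fun x : 'rV[R]_n => x ord0 i).
Proof. exact: coord_continuous. Qed.

Lemma continuous_sqn : continuous (@sqn n).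
Proof.
apply: continuous_big; first exact: add_continuous.
move=> i _ x; under eq_fun do rewrite expr2.
have c : {for x, continuous (fun x : 'rV[R]_n => x ord0 i)} by exact: continuous_coord.
exact: (continuousM c c).
Qed.

Lemma is_derive_coord x (v : 'rV[R]_n) i :
  is_derive x v (fun y : 'rV[R]_n => y ord0 i) (v ord0 i).
Proof.
apply/is_derive_line0.
have -> : (fun s : R => (x + s *: v) ord0 i) = fun s => x ord0 i + v ord0 i * s.
  by apply/funext => s; rewrite !mxE mulrC.
apply: (isd_eq (isdD (isd_cst _ _ _) (isdZ _ (isd_id 0)))).
by rewrite mulr1 add0r.
Qed.

Lemma is_derive_sqn x j : is_derive x (delta_mx ord0 j) (@sqn n) (2 * x ord0 j).
Proof.
rewrite /sqn; apply: (isd_eq (isd_sum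
  (h := fun i (y : 'rV[R]_n) => y ord0 i ^+ 2)
  (dh := fun i => 2 * x ord0 i * (i == j)%:R) _)) => [i|].
  have Hc := is_derive_coord x (delta_mx ord0 j) i.
  apply: (isd_eq (isdM Hc Hc)).
  by rewrite mxE eqxx/=; ring.
by rewrite (bigD1 j)//= eqxx mulr1 big1 ?addr0// => i /negbTE ->; rewrite mulr0.
Qed.

Lemma open_sball r : open (@sball n r).
Proof.
apply: (@open_comp _ _ (@sqn n) [set y | y < r]) => [x _|]; last exact: open_lt.
exact: continuous_sqn.
Qed.

Lemma measurable_sball r : measurable (@sball n r).
Proof. by apply: open_measurable_rV; exact: open_sball. Qed.

Lemma eballE r : 0 <= r -> eball r = @sball n (r ^+ 2).
Proof.
move=> r0; apply/seteqP; split => x; rewrite /eball /sball/= /enorm -/(sqn x) => h.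
  by rewrite -(sqr_sqrtr (sqn_ge0 x)) ltr_pXn2r// nnegrE sqrtr_ge0.
by rewrite -(ger0_norm r0) -sqrtr_sqr ltr_sqrt// (le_lt_trans (sqn_ge0 x)).
Qed.

Lemma sball_finite r : (lebesgue_rV n (@sball n r) < +oo)%E.
Proof.
have [r0|r0] := leP r 0.
  rewrite (_ : sball r = set0) ?measure0//; apply/seteqP; split => x //=.
  by rewrite /sball/= ltNge (le_trans r0)// sqn_ge0.
(* t^2 < r implies |t| <= 1 + r, which avoids a square root. *)
pose A (i : 'I_n) : set (measurableTypeR R) := `[- (1 + r), 1 + r]%classic.
apply: (@le_lt_trans _ _ (lebesgue_rV n [set x | forall i, A i (x ord0 i)])).
  apply: le_measure; rewrite ?inE; [exact: measurable_sball| |].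
    by apply: measurable_box_rV => i; exact: measurable_itv.
  move=> x xr i; rewrite /A/= in_itv/=.
  have := coord_sqn x i; move: xr; rewrite /sball/=; nra.
rewrite lebesgue_rV_box => [|i]; last exact: measurable_itv.
have : (\prod_(i < n) @lebesgue_measure R (A i) \is a fin_num)%E.
  elim/big_ind: _ => // [x y|i _]; first exact: fin_numM.
  by rewrite /A lebesgue_measure_itv/=; case: ifP.
by rewrite fin_numE => /andP[_ ?]; rewrite ltey.
Qed.

End squared_norm.

Section directional.
Context {R : realType}.

Lemma MVT_abs (phi dphi : R -> R) (t : R) :
  (forall s : R, `|s| <= `|t| -> is_derive s 1 phi (dphi s)) ->
  exists2 th, `|th| <= `|t| & phi t - phi 0 = dphi th * t.
Proof.
move=> H.
have cont a b : (forall s, s \in `[a, b] -> `|s| <= `|t|) -> {within `[a, b], continuous phi}.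
  move=> ab; apply: derivable_within_continuous => s /ab /H [] //.
have [t0|t0] := leP 0 t.
  have sub s : s \in `[0, t] -> `|s| <= `|t|.
    by rewrite in_itv/= => /andP[s0 st]; rewrite !ger0_norm.
  have [|c /sub ct ->] := @MVT_segment R phi dphi 0 t t0 _ (cont 0 t sub).
    by move=> s st; apply: H; apply: sub; exact: subset_itv_oo_cc st.
  by exists c; rewrite ?subr0.
have sub s : s \in `[t, 0] -> `|s| <= `|t|.
  by rewrite in_itv/= => /andP[s0 st]; rewrite !ler0_norm ?lerN2// ltW.
have [|c /sub ct E] := @MVT_segment R phi dphi t 0 (ltW t0) _ (cont t 0 sub).
  by move=> s st; apply: H; apply: sub; exact: subset_itv_oo_cc st.
exists c => //; rewrite -opprB E; ring.
Qed.

(** The coordinates of v are switched on one at a time: [w k] keeps the first k of them, and by the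
    mean value theorem the difference quotients for [w k.+1] and [w k] differ by a coordinate of v
    times the corresponding partial derivative at a point near x. *)
Lemma C1_directional n (u : 'rV[R]_n -> R) (g : 'I_n -> 'rV[R]_n -> R)
    (O : set 'rV[R]_n) : open O ->
  (forall x i, O x -> is_derive x (delta_mx ord0 i) u (g i x)) ->
  (forall x i, O x -> {for x, continuous (g i)}) ->
  forall x v, O x -> is_derive x v u (\sum_(i < n) v ord0 i * g i x).
Proof.
move=> oO du cg x v Ox.
pose w (k : nat) : 'rV[R]_n := \row_i (if (i < k)%N then v ord0 i else 0).
have Hw k : (k <= n)%N ->
    is_derive x (w k) u (\sum_(i < n | (i < k)%N) v ord0 i * g i x).
  elim: k => [_|k IH kn].
    rewrite big_pred0// (_ : w 0%N = 0); last by apply/rowP => i; rewrite !mxE.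
    exact: is_derive0.
  pose ik := Ordinal kn.
  have -> : \sum_(i < n | (i < k.+1)%N) v ord0 i * g i x =
      (\sum_(i < n | (i < k)%N) v ord0 i * g i x) + v ord0 ik * g ik x.
    rewrite (bigD1 ik)//= addrC; congr (_ + _); apply: eq_bigl => i.
    by rewrite ltnS [RHS]ltn_neqAle -val_eqE/= andbC.
  have [dk ek] := IH (ltnW kn).
  pose D (k : nat) (h : R) := h^-1 *: ((u \o shift x) (h *: w k) - u x).
  have Dk : D k h @[h --> 0^'] --> (\sum_(i < n | (i < k)%N) v ord0 i * g i x).
    by rewrite -ek; exact: dk.
  have Dd : D k.+1 h - D k h @[h --> 0^'] --> v ord0 ik * g ik x.
    apply/cvgrPdist_le => e e0.
    (* M exceeds every |v_i|: for |h| < d / M all intermediate points stay in the d-ball around x,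
       and an error e / M in the partial derivative costs at most e. *)
    pose M := \sum_i `|v ord0 i| + 1.
    have M0 : 0 < M by rewrite ltr_pwDr// sumr_ge0.
    have vM i : `|v ord0 i| < M.
      by rewrite /M (bigD1 i)//= -addrA ltrDl ltr_wpDl// sumr_ge0.
    have /cvgrPdist_le/(_ (e / M) (divr_gt0 e0 M0)) := cg x ik Ox.
    have : nbhs x O by exact: open_nbhs_nbhs.
    move=> /filterI/[apply] /nbhs_ballP[d /= d0 Hd].
    near=> h.
    have h0 : h != 0 by near: h; exact: nbhs_dnbhs_neq.
    have hd : `|h| < d / M.
      by near: h; apply: dnbhs0_lt; rewrite divr_gt0.
    have Hpt (s : R) : `|s| <= `|h * v ord0 ik| ->
        ball x d (x + h *: w k + s *: delta_mx ord0 ik).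
      move=> sh; split => // a b; rewrite ord1 /ball/= !mxE/=.
      have -> (p q r : R) : p - (p + q + r) = - (q + r) by ring.
      rewrite normrN (le_lt_trans (ler_normD _ _))//.
      have hM c : `|h * v ord0 c| < d.
        rewrite normrM (le_lt_trans (ler_wpM2l _ (ltW (vM c))))//.
        by rewrite -ltr_pdivlMr.
      case: (ltnP b k) => bk.
        rewrite (_ : (b == ik) = false) ?mulr0 ?normr0 ?addr0//.
        by apply/negbTE; rewrite -val_eqE/= ltn_eqF.
      rewrite mulr0 normr0 add0r normrM; apply: le_lt_trans (hM ik).
      by case: (_ == _); rewrite ?normr1 ?normr0 ?mulr1 ?mulr0.
    have [|th Hth E] := @MVT_abs (fun s => u (x + h *: w k + s *: delta_mx ord0 ik))
      (fun s => g ik (x + h *: w k + s *: delta_mx ord0 ik)) (h * v ord0 ik).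
      move=> s sh.
      have Os : O (x + h *: w k + s *: delta_mx ord0 ik).
        by have [] := Hd _ (Hpt s sh).
      exact: ((is_derive_line u (x + h *: w k) (delta_mx ord0 ik) s _).1 (du _ ik Os)).
    have -> : D k.+1 h - D k h = v ord0 ik * g ik (x + h *: w k + th *: delta_mx ord0 ik).
      rewrite /D/= -scalerBr.
      have -> : h *: w k.+1 + x = x + h *: w k + (h * v ord0 ik) *: delta_mx ord0 ik.
        apply/rowP => i; rewrite !mxE/= addrC -addrA; congr (_ + _).
        rewrite -[in RHS]val_eqE/= ltnS leq_eqVlt.
        case: ltngtP => // ik'; rewrite ?mulr0 ?addr0 ?mulr1 ?add0r//.
        by congr (_ * v _ _); exact/val_inj.
      rewrite scale0r addr0 in E.
      have -> (p q r : R) : p - q - (r - q) = p - r by ring.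
      rewrite (addrC (h *: w k)) E.
      have scE (p q : R) : p *: q = p * q by [].
      by rewrite scE; field.
    rewrite -mulrBr normrM.
    have [_ /= He] := Hd _ (Hpt th Hth).
    rewrite (le_trans (ler_pM _ _ (ltW (vM ik)) He))//.
    by rewrite mulrC divfK// gt_eqF.
  have Dk1 : D k.+1 h @[h --> 0^'] -->
      (\sum_(i < n | (i < k)%N) v ord0 i * g i x) + v ord0 ik * g ik x.
    rewrite (_ : D k.+1 = fun h => D k h + (D k.+1 h - D k h)).
      exact: cvgD.
    by apply/funext => h; rewrite addrC subrK.
  by apply: DeriveDef; [apply/cvg_ex; eexists; exact: Dk1|exact: cvg_lim].
have := Hw n (leqnn n).
have -> : w n = v by apply/rowP => i; rewrite mxE ltn_ord.
by under eq_bigl do rewrite ltn_ord.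
Unshelve. all: by end_near. Qed.

End directional.

Section compact_bounds.
Context {R : realType} {n : nat}.
Implicit Types (f : 'rV[R]_n -> R).

Lemma closed_le_sqn r : closed [set x : 'rV[R]_n | sqn x <= r].
Proof.
apply: (@preimage_closed _ _ (@sqn R n) [set y | y <= r]) => [x _|]; last exact: closed_le.
exact: continuous_sqn.
Qed.

Lemma compact_le_sqn r : compact [set x : 'rV[R]_n | sqn x <= r].
Proof.
pose A (i : 'I_n) : set R := `[- (1 + r), 1 + r]%classic.
apply: (@subclosed_compact _ _ [set x : 'rV[R]_n | forall i, A i (x ord0 i)]).
- exact: closed_le_sqn.
- by apply: rV_compact => i; exact: segment_compact.
move=> x xr i; rewrite /A/= in_itv/=.
by have := coord_sqn x i; move: xr => /=; nra.
Qed.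

Lemma compact_fun_bounded (A : set 'rV[R]_n) f : compact A ->
  {within A, continuous f} -> exists K : R, forall x, A x -> `|f x| <= K.
Proof.
move=> cA cf; have /compact_bounded[K [_ HK]] := continuous_compact cf cA.
exists (K + 1) => x Ax; apply: (HK (K + 1)); first by rewrite ltrDl.
by exists x.
Qed.

Lemma bfs_patch (O : set 'rV[R]_n) f (r K : R) : measurable O -> O `<=` @sball R n r ->
  measurable_fun O f -> (forall x, O x -> `|f x| <= K) ->
  bfs (lebesgue_rV n) (fun x => \1_O x * f x).
Proof.
move=> mO Or mf fK; split; first exact: patch_measurable_rV.
exists O, K; split => // [|x].
  apply: le_lt_trans (sball_finite r).
  by apply: le_measure; rewrite ?inE//; exact: measurable_sball.
rewrite indicE normrM; have [xO|xO] := boolP (x \in O).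
  by rewrite normr1 mul1r mulr1 fK//; exact: set_mem.
by rewrite normr0 mul0r mulr0.
Qed.

Lemma bfs_continuous f r : continuous f -> (forall x, r <= sqn x -> f x = 0) ->
  bfs (lebesgue_rV n) f.
Proof.
move=> cf f0.
have [K HK] := compact_fun_bounded (@compact_le_sqn r) (continuous_subspaceT cf).
have -> : f = fun x => \1_(@sball R n r) x * f x.
  apply/funext => x; rewrite indicE; have [xO|xO] := boolP (x \in _).
    by rewrite mul1r.
  rewrite mul0r f0// leNgt; apply/negP => xr; move/negP: xO; apply.
  exact: mem_set.
apply: (@bfs_patch _ _ r K) => //.
- exact: measurable_sball.
- by apply: measurable_funTS; exact: continuous_measurable_rV.
- by move=> x xr; apply: HK; exact: ltW.
Qed.

Lemma bfs_sball r : bfs (lebesgue_rV n) \1_(@sball R n r).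
Proof. by apply: bfs_indic; [exact: measurable_sball|exact: sball_finite]. Qed.

End compact_bounds.

Section FTC_rint.
Context {R : realType}.
Notation leb := (@lebesgue_measure R).

Lemma bfs_itv (a b : R) (f : measurableTypeR R -> R) :
  {within `[a, b], continuous f} ->
  bfs leb (fun t => \1_(`[a, b]%classic) t * f t).
Proof.
move=> cf.
have mI : measurable (`[a, b]%classic : set (measurableTypeR R)) by exact: measurable_itv.
have mf : measurable_fun (`[a, b]%classic : set (measurableTypeR R)) f.
  by apply: subspace_continuous_measurable_fun.
have /compact_bounded[K [_ HK]] := continuous_compact cf (@segment_compact _ a b).
split.
  rewrite (_ : (fun _ => _) = f \_ `[a, b]).
    exact/(measurable_restrictT _ _).1.
  by apply/funext => x; rewrite patchE indicE; case: ifPn; rewrite (mul1r, mul0r).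
exists `[a, b]%classic, (K + 1); split => // [|x].
  by have := lebesgue_measure_itv `[a, b]; move=> /= ->; case: ifP => _; rewrite ltry.
rewrite indicE normrM; have [xO|xO] := boolP (x \in _).
  rewrite normr1 mul1r mulr1; apply: (HK (K + 1)); first by rewrite ltrDl.
  by exists x => //; exact: set_mem.
by rewrite normr0 mul0r mulr0.
Qed.

Lemma rint_FTC (a b : R) (phi dphi : R -> R) : a < b ->
  (forall s : R, s \in `[a, b] -> is_derive s 1 phi (dphi s)) ->
  {within `[a, b], continuous dphi} ->
  rint leb (fun t => \1_(`[a, b]%classic) t * dphi t) = phi b - phi a.
Proof.
move=> ab dp cd.
have cp s : s \in `[a, b] -> {for s, continuous phi}.
  by move=> /dp[+ _] => /derivable1_diffP; exact: differentiable_continuous.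
apply: EFin_inj; rewrite EFinB rintE; last exact: bfs_itv.
rewrite -(continuous_FTC2 ab cd); last 2 first.
- split.
  + by move=> s /subset_itv_oo_cc/dp[].
  + by apply: cvg_at_right_filter; apply: cp; rewrite bound_itvE ltW.
  + by apply: cvg_at_left_filter; apply: cp; rewrite bound_itvE ltW.
- by move=> s /subset_itv_oo_cc/dp ds; rewrite derive1E derive_val.
rewrite [RHS]integral_mkcond; apply: eq_integral => t _.
by rewrite restrict_EFin/= patchE indicE; case: ifPn; rewrite (mul1r, mul0r).
Qed.

End FTC_rint.

Section fubini_cons.
Context {R : realType}.
Notation leb := (@lebesgue_measure R).

(** As in the change of variables, f is split as |f| - (|f| - f), so that only pushforwards of
    nonnegative functions are integrated. *)
Lemma rint_cons n (f : 'rV[R]_n.+1 -> R) : bfs (lebesgue_rV n.+1) f ->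
  rint (lebesgue_rV n.+1) f =
  rint (leb \x lebesgue_rV n)%E (f \o @cons_rV R n).
Proof.
move=> bf.
have pos (g : 'rV[R]_n.+1 -> R) : bfs (lebesgue_rV n.+1) g -> (forall x, 0 <= g x) ->
    (\int[lebesgue_rV n.+1]_x (g x)%:E =
     \int[leb \x lebesgue_rV n]_x ((g \o @cons_rV R n) x)%:E)%E.
  move=> bg g0; apply: (@ge0_integral_pushforward _ _ _ _ R (@cons_rV R n)
    (@measurable_cons_rV R n) (leb \x lebesgue_rV n)%E setT (EFin \o g)) => //.
    by apply/measurable_EFinP; case: bg.
  by move=> x _; rewrite lee_fin.
have bc (g : 'rV[R]_n.+1 -> R) : bfs (lebesgue_rV n.+1) g ->
    bfs (leb \x lebesgue_rV n)%E (g \o @cons_rV R n).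
  move=> [mg [A [K [mA fA KA]]]].
  split; first exact: (measurableT_comp mg (@measurable_cons_rV R n)).
  exists (@cons_rV R n @^-1` A), K; split => //.
    by rewrite -[X in measurable X]setTI; exact: measurable_cons_rV.
  by move=> p; exact: KA.
have bn := bfs_norm bf; have bd := bfsB bn bf.
suff : rint (lebesgue_rV n.+1) (fun x => `|f x| - (`|f x| - f x)) =
    rint (leb \x lebesgue_rV n)%E ((fun x => `|f x| - (`|f x| - f x)) \o @cons_rV R n).
  have -> // : (fun x => `|f x| - (`|f x| - f x)) = f.
  by apply/funext => x; rewrite opprB addrC subrK.
rewrite (rintB bn bd) (rintB (bc _ bn) (bc _ bd)); rewrite /rint /Rintegral.
congr (fine _ - fine _); apply: pos => // x.
by rewrite subr_ge0 ler_norm.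
Qed.

Lemma rint_line0 (phi dphi : R -> R) (r : R) :
  (forall s : R, is_derive s 1 phi (dphi s)) -> continuous dphi ->
  (forall s, r <= `|s| -> phi s = 0 /\ dphi s = 0) ->
  rint leb dphi = 0.
Proof.
move=> dp cd p0.
(* The sign of r is not known; |r| + 1 is positive and at least r, so [phi] vanishes at both ends of
   a nondegenerate interval. *)
have r1 : `|r| + 1 > 0 by rewrite ltr_wpDl.
have rr : r <= `|r| + 1 by rewrite (le_trans (ler_norm _))// lerDl.
have H := @rint_FTC R (- (`|r| + 1)) (`|r| + 1) phi dphi _
  (fun s _ => dp s) (continuous_subspaceT cd).
have {H} : rint leb dphi = phi (`|r| + 1) - phi (- (`|r| + 1)).
  rewrite -H; last by rewrite (lt_trans _ r1)// oppr_lt0.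
  apply: eq_rint => t; rewrite indicE; have [tI|tI] := boolP (t \in _); first by rewrite mul1r.
  rewrite mul0r; apply: (p0 t _).2; rewrite leNgt; apply/negP => tr.
  move/negP: tI; apply; apply: mem_set; rewrite /= in_itv/= -ler_norml.
  by rewrite (le_trans (ltW tr)).
move=> ->; have rn : r <= `| `|r| + 1 | by rewrite ger0_norm// ltW.
by rewrite (p0 _ rn).1 (p0 (- _) _).1 ?normrN// subrr.
Qed.

Lemma line_coord n (x : 'rV[R]_n) (s : R) (i j : 'I_n) :
  (x + s *: delta_mx ord0 j) ord0 i = x ord0 i + s * (i == j)%:R.
Proof. by rewrite !mxE eqxx. Qed.

Lemma cons_rV_line n (t : R) (y : 'rV[R]_n) (j : 'I_n) (s : R) :
  cons_rV (t, y + s *: delta_mx ord0 j) =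
  cons_rV (t, y) + s *: delta_mx ord0 (lift ord0 j).
Proof.
apply/rowP => i; rewrite line_coord; have [k ->|->] := unliftP ord0 i.
  by rewrite !cons_rVS/= line_coord (inj_eq lift_inj).
by rewrite !cons_rV0 (negbTE (neq_lift _ _)) mulr0 addr0.
Qed.

Lemma cons_rV_line0 n (t : R) (y : 'rV[R]_n) (s : R) :
  cons_rV (t + s, y) = cons_rV (t, y) + s *: delta_mx ord0 ord0.
Proof.
apply/rowP => i; rewrite line_coord; have [k ->|->] := unliftP ord0 i.
  by rewrite !cons_rVS/= mulr0 addr0.
by rewrite !cons_rV0 eqxx mulr1.
Qed.

(** Induction on n, splitting off the first coordinate by Fubini. If i is a later coordinate, every
    slice integrates to 0 by induction; if it is the first, the order of integration is exchanged
    and the fundamental theorem applies on lines. Continuity is asked only along direction i,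
    besides measurability and a bound, so that the hypotheses pass directly to slices. *)
Lemma rint_partial n (i : 'I_n) (F dF : 'rV[R]_n -> R) (r K : R) :
  (forall x, is_derive x (delta_mx ord0 i) F (dF x)) ->
  (forall x, continuous (fun s : R => dF (x + s *: delta_mx ord0 i))) ->
  measurable_fun setT dF ->
  (forall x, `|dF x| <= K) ->
  (forall (x : 'rV[R]_n) j, r <= `|x ord0 j| -> F x = 0 /\ dF x = 0) ->
  rint (lebesgue_rV n) dF = 0.
Proof.
elim: n i F dF => [[]//|n IH] i F dF dd cd md Kd r0.
have bfsdF m (f : 'rV[R]_m -> R) : measurable_fun setT f -> (forall x, `|f x| <= K) ->
    (forall (x : 'rV[R]_m) j, r <= `|x ord0 j| -> f x = 0) -> bfs (lebesgue_rV m) f.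
  move=> mf Kf f0.
  have -> : f = fun x => \1_(@sball R m (m%:R * r ^+ 2 + 1)) x * f x.
    apply/funext => x; rewrite indicE; have [xB|xB] := boolP (x \in _); first by rewrite mul1r.
    rewrite mul0r; apply/eqP/negPn/negP => fx.
    move/negP: xB; apply; apply: mem_set; rewrite /sball/= /sqn.
    apply: (@le_lt_trans _ _ (\sum_(j < m) r ^+ 2)); last first.
      by rewrite sumr_const card_ord mulr_natl ltrDl.
    apply: ler_sum => j _; have xj : `|x ord0 j| < r.
      by rewrite ltNge; apply/negP => /f0/eqP; apply/negP.
    by move: xj; rewrite ltr_norml; nra.
  by apply: (@bfs_patch R m _ _ (m%:R * r ^+ 2 + 1) K) => //; [exact: measurable_sball|exact: measurable_funTS].
have bdF : bfs (lebesgue_rV n.+1) dF.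
  by apply: bfsdF => // x j /r0[].
rewrite rint_cons//.
pose I : set (measurableTypeR R) := `[- r, r]%classic.
have mdc : measurable_fun setT (dF \o @cons_rV R n).
  exact: (measurableT_comp md (@measurable_cons_rV R n)).
have b2 : bfs2 leb (lebesgue_rV n) (dF \o @cons_rV R n).
  split => //; exists I, (@sball R n (n%:R * r ^+ 2 + 1)), `|K|; split => //.
  - split; first exact: measurable_itv.
    by have := @lebesgue_measure_itv R `[- r, r]; rewrite -/I /= => ->; case: ifP => _; rewrite ltry.
  - by split; [exact: measurable_sball|exact: sball_finite].
  move=> t y; rewrite -mulrA -natrM.
  have [->|/eqP fn0] := eqVneq ((dF \o @cons_rV R n) (t, y)) 0.
    by rewrite normr0 mulr_ge0.
  have cr (j : 'I_n.+1) : `|cons_rV (t, y) ord0 j| < r.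
    by rewrite ltNge; apply/negP => /r0[_ /fn0].
  have -> : t \in I.
    by apply: mem_set; have := cr ord0; rewrite cons_rV0/= /I/= in_itv/= -ler_norml => /ltW.
  have -> : y \in @sball R n (n%:R * r ^+ 2 + 1).
    apply: mem_set; rewrite /sball/= /sqn.
    apply: (@le_lt_trans _ _ (\sum_(j < n) r ^+ 2)); last first.
      by rewrite sumr_const card_ord mulr_natl ltrDl.
    apply: ler_sum => j _; have := cr (lift ord0 j); rewrite cons_rVS/=.
    by rewrite ltr_norml; nra.
  by rewrite mulr1 (le_trans (Kd _))// ler_norm.
rewrite -(rint_xsection b2)/=.
have [j ij|i0] := unliftP ord0 i; subst i.
  have E t : rint (lebesgue_rV n) (fun y => dF (cons_rV (t, y))) = 0.
    refine (IH j (fun y => F (cons_rV (t, y))) _ _ _ _ _ _) => //.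
    - move=> y; apply: (is_derive_line0 _ _ _ _).2; under eq_fun do rewrite cons_rV_line.
      exact: ((is_derive_line0 F (cons_rV (t, y)) _ _).1 (dd _)).
    - by move=> y; under eq_fun do rewrite cons_rV_line; exact: cd.
    - by apply: (measurableT_comp mdc).
    - by move=> y k ky; apply: (r0 _ (lift ord0 k)); rewrite cons_rVS.
  by under eq_rint do rewrite E; rewrite rint0.
rewrite (rint_fubini b2)/=.
have E (y : 'rV[R]_n) : rint leb (fun t => dF (cons_rV (t, y))) = 0.
  have lineE (f : 'rV[R]_n.+1 -> R) :
      (fun t => f (cons_rV (t, y))) = fun t => f (cons_rV (0, y) + t *: delta_mx ord0 ord0).
    by apply/funext => t; rewrite -cons_rV_line0 add0r.
  apply: (@rint_line0 (fun t => F (cons_rV (t, y))) _ r).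
  - move=> t; rewrite lineE -(add0r t) cons_rV_line0.
    by rewrite add0r; exact: ((is_derive_line F (cons_rV (0, y)) _ t _).1 (dd _)).
  - by rewrite lineE; exact: cd.
  - by move=> t tr; apply: (r0 _ ord0); rewrite cons_rV0.
by under eq_rint do rewrite E; rewrite rint0.
Qed.

End fubini_cons.

Section ball_volume.
Context {R : realType} {n : nat}.

Lemma bfs_scale (f : 'rV[R]_n -> R) (a : R) : 0 < a -> bfs (lebesgue_rV n) f ->
  bfs (lebesgue_rV n) (fun x => f (a *: x)).
Proof. by move=> a0 /(@bfs_affine R n a 0 f a0); under eq_fun do rewrite addr0. Qed.

Lemma rint_scale (f : 'rV[R]_n -> R) (a : R) : 0 < a -> bfs (lebesgue_rV n) f ->
  rint (lebesgue_rV n) (fun x => f (a *: x)) = a^-1 ^+ n * rint (lebesgue_rV n) f.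
Proof.
move=> a0 /(@rint_affine R n a 0 f a0) <-; apply: eq_rint => x.
by rewrite addr0.
Qed.

Lemma bfs_shift (f : 'rV[R]_n -> R) (b : 'rV[R]_n) : bfs (lebesgue_rV n) f ->
  bfs (lebesgue_rV n) (fun x => f (x + b)).
Proof. by move=> /(@bfs_affine R n 1 b f ltr01); under eq_fun do rewrite scale1r. Qed.

Lemma rint_shift (f : 'rV[R]_n -> R) (b : 'rV[R]_n) : bfs (lebesgue_rV n) f ->
  rint (lebesgue_rV n) (fun x => f (x + b)) = rint (lebesgue_rV n) f.
Proof.
move=> /(@rint_affine R n 1 b f ltr01); rewrite invr1 expr1n mul1r => <-.
by apply: eq_rint => x; rewrite scale1r.
Qed.

Lemma indic_sball_scale (a r : R) (x : 'rV[R]_n) : 0 < a ->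
  \1_(@sball R n r) (a *: x) = \1_(@sball R n (a^-1 ^+ 2 * r)) x :> R.
Proof.
move=> a0; have E : (sqn (a *: x) < r) = (sqn x < a^-1 ^+ 2 * r).
  by rewrite sqnZ exprVn ltr_pdivlMl ?exprn_gt0.
rewrite !indicE; congr (nat_of_bool _)%:R.
by apply/idP/idP => /set_mem; rewrite /sball/= => H; apply: mem_set;
  rewrite /= -?E// E.
Qed.

Lemma rint_sball_scale (a r : R) : 0 < a ->
  rint (lebesgue_rV n) \1_(@sball R n (a ^+ 2 * r)) =
  a ^+ n * rint (lebesgue_rV n) \1_(@sball R n r).
Proof.
move=> a0; have a'0 : 0 < a^-1 by rewrite invr_gt0.
have := @rint_scale _ a^-1 a'0 (bfs_sball r); rewrite invrK => <-.
by apply: eq_rint => x; rewrite indic_sball_scale// invrK.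
Qed.

Lemma rint_sball_gt0 (r : R) : 0 < r -> 0 < rint (lebesgue_rV n) \1_(@sball R n r).
Proof.
move=> r0; rewrite rint_indic; last exact: measurable_sball.
(* d <= 1 gives d^2 <= d <= r / (n + 1), so the cube [0, d]^n lies in the ball. *)
pose d := Num.min 1 (r / n.+1%:R).
have d0 : 0 < d by rewrite lt_min ltr01 divr_gt0.
pose A (i : 'I_n) : set (measurableTypeR R) := `[0, d]%classic.
have mA i : measurable (A i) by exact: measurable_itv.
have AE i : @lebesgue_measure R (A i) = d%:E.
  by rewrite /A lebesgue_measure_itv/= lte_fin d0 sube0.
rewrite fine_gt0// sball_finite andbT.
apply: (@lt_le_trans _ _ (lebesgue_rV n [set x | forall i, A i (x ord0 i)])).
  rewrite lebesgue_rV_box// (eq_bigr (fun=> d%:E))//.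
  by elim/big_ind: _ => // x y; exact: mule_gt0.
apply: le_measure; rewrite ?inE; [exact: measurable_box_rV|exact: measurable_sball|].
move=> x Ax; rewrite /sball/= /sqn.
apply: (@le_lt_trans _ _ (\sum_(i < n) r / n.+1%:R)).
  apply: ler_sum => i _; have := Ax i; rewrite /A/= in_itv/= => /andP[x0].
  rewrite /d le_min => /andP[x1 xr].
  by apply: le_trans xr; rewrite expr2 ler_piMr.
rewrite sumr_const card_ord -[X in X < _]mulr_natr -mulrA gtr_pMr//.
by rewrite mulrC ltr_pdivrMr// mul1r ltr_nat.
Qed.

End ball_volume.

(** * C^2 functions and Green's formula *)

Section C2_calculus.
Context {R : realType} {n : nat}.
Implicit Types (O : set 'rV[R]_n) (f w : 'rV[R]_n -> R) (g h : 'I_n -> 'rV[R]_n -> R).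

(** The partial derivatives are an explicit argument instead of [partial i w]: the rules below then
    compute them by unification. *)
Definition C1on O w g := forall x, O x -> {for x, continuous w} /\
  forall i, {for x, continuous (g i)} /\ is_derive x (delta_mx ord0 i) w (g i x).

(* Only the pure second derivatives [h i] of [w] are recorded: they suffice for the
   Laplacian. *)
Definition C2on O w g h := C1on O w g /\ forall x, O x -> forall i,
  {for x, continuous (h i)} /\ is_derive x (delta_mx ord0 i) (g i) (h i x).

Definition C2R (f0 f1 f2 : R -> R) := [/\ continuous f2,
  (forall t : R, is_derive t 1 f0 (f1 t)) & (forall t : R, is_derive t 1 f1 (f2 t))].

Lemma is_derive_continuous (f0 f1 : R -> R) :
  (forall t : R, is_derive t 1 f0 (f1 t)) -> continuous f0.
Proof.
by move=> d t; have [/derivable1_diffP H _] := d t; exact: differentiable_continuous.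
Qed.

Lemma C1on_sqn O : C1on O (@sqn R n) (fun i x => 2 * x ord0 i).
Proof.
move=> x _; split; first exact: continuous_sqn.
move=> i; split; last exact: is_derive_sqn.
apply: continuousM; first exact: cst_continuous.
exact: continuous_coord.
Qed.

Lemma C1on_comp O w g (f0 f1 : R -> R) : continuous f1 ->
  (forall t : R, is_derive t 1 f0 (f1 t)) -> C1on O w g ->
  C1on O (fun x => f0 (w x)) (fun i x => f1 (w x) * g i x).
Proof.
move=> cf1 d Hw x Ox; have [cw Hg] := Hw x Ox; split.
  by apply: continuous_comp cw _; exact: (is_derive_continuous d).
move=> i; have [cg dw] := Hg i; split; last exact: isd_comp.
by apply: continuousM => //; apply: continuous_comp cw _; exact: cf1.
Qed.

Lemma C1onM O w g w' g' : C1on O w g -> C1on O w' g' ->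
  C1on O (fun x => w x * w' x) (fun i x => w x * g' i x + w' x * g i x).
Proof.
move=> Hw Hw' x Ox; have [cw Hg] := Hw x Ox; have [cw' Hg'] := Hw' x Ox.
split; first exact: continuousM.
move=> i; have [cg dw] := Hg i; have [cg' dw'] := Hg' i.
split; last exact: isdM.
by apply: continuousD; exact: continuousM.
Qed.

Lemma C1onD O w g w' g' : C1on O w g -> C1on O w' g' ->
  C1on O (fun x => w x + w' x) (fun i x => g i x + g' i x).
Proof.
move=> Hw Hw' x Ox; have [cw Hg] := Hw x Ox; have [cw' Hg'] := Hw' x Ox.
split; first exact: continuousD.
move=> i; have [cg dw] := Hg i; have [cg' dw'] := Hg' i.
by split; [exact: continuousD|exact: isdD].
Qed.

Lemma C1onN O w g : C1on O w g -> C1on O (fun x => - w x) (fun i x => - g i x).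
Proof.
move=> Hw x Ox; have [cw Hg] := Hw x Ox; split; first exact: continuousN.
by move=> i; have [cg dw] := Hg i; split; [exact: continuousN|exact: isdN].
Qed.

Lemma continuous_affine (a : R) (b : 'rV[R]_n) : continuous (fun x : 'rV[R]_n => a *: x + b).
Proof.
move=> x; apply: continuousD; last exact: cst_continuous.
by apply: continuousZr; exact: cvg_id.
Qed.

Lemma C1on_affine (a : R) (b : 'rV[R]_n) w g : C1on setT w g ->
  C1on setT (fun x => w (a *: x + b)) (fun i x => a * g i (a *: x + b)).
Proof.
move=> Hw x _; have [cw Hg] := Hw (a *: x + b) I; split.
  by apply: continuous_comp; [exact: continuous_affine|exact: cw].
move=> i; have [cg dw] := Hg i; split; last exact: isd_affine.
apply: continuousM; first exact: cst_continuous.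
by apply: continuous_comp; [exact: continuous_affine|exact: cg].
Qed.

Lemma C2on_comp O w g h (f0 f1 f2 : R -> R) : C2R f0 f1 f2 -> C2on O w g h ->
  C2on O (fun x => f0 (w x)) (fun i x => f1 (w x) * g i x)
    (fun i x => f2 (w x) * g i x ^+ 2 + f1 (w x) * h i x).
Proof.
move=> [cf2 d1 d2] [Hw Hg]; split.
  by apply: C1on_comp => //; exact: (is_derive_continuous d2).
move=> x Ox i; have [cw /(_ i)[cg dw]] := Hw x Ox; have [ch dg] := Hg x Ox i.
have cf1 := is_derive_continuous d2.
split; last first.
  by apply: (isd_eq (isdM (isd_comp (d2 (w x)) dw) dg)); ring.
apply: continuousD; apply: continuousM => //.
- by apply: continuous_comp cw _; exact: cf2.
- exact: (continuousM cg cg).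
- by apply: continuous_comp cw _; exact: cf1.
Qed.

Lemma C2onM O w g h w' g' h' : C2on O w g h -> C2on O w' g' h' ->
  C2on O (fun x => w x * w' x) (fun i x => w x * g' i x + w' x * g i x)
    (fun i x => w x * h' i x + 2 * (g i x * g' i x) + w' x * h i x).
Proof.
move=> [Hw Hg] [Hw' Hg']; split; first exact: C1onM.
move=> x Ox i; have [cw /(_ i)[cg dw]] := Hw x Ox; have [ch dg] := Hg x Ox i.
have [cw' /(_ i)[cg' dw']] := Hw' x Ox; have [ch' dg'] := Hg' x Ox i.
split; last by apply: (isd_eq (isdD (isdM dw dg') (isdM dw' dg))); ring.
apply: continuousD; last exact: continuousM.
apply: continuousD; first exact: continuousM.
apply: continuousM; [exact: cst_continuous|exact: continuousM].
Qed.

Lemma C2onB O w g h w' g' h' : C2on O w g h -> C2on O w' g' h' ->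
  C2on O (fun x => w x - w' x) (fun i x => g i x - g' i x) (fun i x => h i x - h' i x).
Proof.
move=> [Hw Hg] [Hw' Hg']; split; first exact: (C1onD Hw (C1onN Hw')).
move=> x Ox i; have [ch dg] := Hg x Ox i; have [ch' dg'] := Hg' x Ox i.
by split; [exact: continuousB|exact: isdB].
Qed.

Lemma C2on_affine (a : R) (b : 'rV[R]_n) w g h : C2on setT w g h ->
  C2on setT (fun x => w (a *: x + b)) (fun i x => a * g i (a *: x + b))
    (fun i x => a ^+ 2 * h i (a *: x + b)).
Proof.
move=> [Hw Hg]; split; first exact: C1on_affine.
move=> x _ i; have [ch dg] := Hg (a *: x + b) I i; split; last first.
  by apply: (isd_eq (isdZ a (isd_affine dg))); ring.
apply: continuousM; first exact: cst_continuous.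
by apply: continuous_comp; [exact: continuous_affine|exact: ch].
Qed.

Lemma C2on_sqn O : C2on O (@sqn R n) (fun i x => 2 * x ord0 i) (fun i x => 2).
Proof.
split; first exact: C1on_sqn.
move=> x _ i; split; first exact: cst_continuous.
apply: (isd_eq (isdZ 2 (is_derive_coord x (delta_mx ord0 i) i))).
by rewrite mxE !eqxx mulr1.
Qed.

End C2_calculus.

Section global_calculus.
Context {R : realType} {n : nat}.
Notation mu := (lebesgue_rV n).
Implicit Types (w : 'rV[R]_n -> R) (g h : 'I_n -> 'rV[R]_n -> R).

Lemma C1on_continuous w g : C1on setT w g -> continuous w.
Proof. by move=> H x; have [] := H x I. Qed.

Lemma C1on_continuous_partial w g i : C1on setT w g -> continuous (g i).
Proof. by move=> H x; have [_ /(_ i)[]] := H x I. Qed.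

Lemma C2on_continuous_partial2 w g h i : C2on setT w g h -> continuous (h i).
Proof. by move=> [_ H] x; have [] := H x I i. Qed.

Lemma near_zero_outside (b : R) (f : 'rV[R]_n -> R) x : b < sqn x ->
  (forall y, b <= sqn y -> f y = 0) -> \forall y \near x, 0 = f y.
Proof.
move=> bx f0.
have : \forall y \near x, b < sqn y.
  have := @continuous_sqn R n x; move/cvgrPdist_lt/(_ (sqn x - b)).
  rewrite subr_gt0 => /(_ bx); apply: filterS => y.
  by rewrite ltr_norml => /andP[_]; lra.
by apply: filterS => y /ltW/f0 ->.
Qed.

(** Where |x|^2 >= 1 > b, all the functions vanish in a neighbourhood of x; elsewhere the hypothesis
    on the open ball applies. *)
Lemma C2on_glue (b : R) w g h : b < 1 -> C2on (@sball R n 1) w g h ->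
  (forall x, b <= sqn x -> w x = 0) -> (forall i x, b <= sqn x -> g i x = 0) ->
  (forall i x, b <= sqn x -> h i x = 0) -> C2on setT w g h.
Proof.
move=> b1 [Hw Hg] w0 g0 h0.
have zc (f : 'rV[R]_n -> R) x : b < sqn x -> (forall y, b <= sqn y -> f y = 0) ->
    {for x, continuous f}.
  move=> bx f0; rewrite /prop_for /continuous_at (f0 x (ltW bx)).
  apply: (cvg_trans (near_eq_cvg (near_zero_outside bx f0))).
  exact: cvg_cst.
have zd (f df : 'rV[R]_n -> R) i x : b < sqn x -> (forall y, b <= sqn y -> f y = 0) ->
    (forall y, b <= sqn y -> df y = 0) -> is_derive x (delta_mx ord0 i) f (df x).
  move=> bx f0 df0; rewrite (df0 x (ltW bx)).
  exact: near_eq_is_derive (near_zero_outside bx f0) (isd_cst _ _ _).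
split=> x _ => [|i]; have [x1|x1] := ltP (sqn x) 1.
- exact: Hw.
- have bx := lt_le_trans b1 x1; split; first exact: zc bx w0.
  by move=> i; split; [exact: zc bx (g0 i)|exact: zd bx w0 (g0 i)].
- exact: Hg.
- have bx := lt_le_trans b1 x1.
  by split; [exact: zc bx (h0 i)|exact: zd bx (g0 i) (h0 i)].
Qed.

Lemma rint_divergence (F dF : 'I_n -> 'rV[R]_n -> R) :
  (forall i x, is_derive x (delta_mx ord0 i) (F i) (dF i x)) ->
  (forall i, continuous (dF i)) ->
  (forall i x, 1 <= sqn x -> F i x = 0 /\ dF i x = 0) ->
  bfs mu (fun x => \sum_(i < n) dF i x) /\ rint mu (fun x => \sum_(i < n) dF i x) = 0.
Proof.
move=> d c F0.
have bd i : bfs mu (dF i) by apply: (@bfs_continuous _ _ _ 1) => // x /(F0 i)[].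
split; first exact: bfs_sum.
rewrite rint_sum// big1// => i _.
have [K HK] := compact_fun_bounded (@compact_le_sqn R n 1) (continuous_subspaceT (c i)).
apply: (@rint_partial R n i (F i) (dF i) 1 `|K|) => //.
- move=> x s; apply: continuous_comp; last exact: c.
  apply: continuousD; first exact: cst_continuous.
  by apply: continuousZl; exact: cvg_id.
- exact: continuous_measurable_rV.
- move=> x; have [x1|x1] := leP (sqn x) 1; first by rewrite (le_trans (HK x x1))// ler_norm.
  by rewrite (F0 i x (ltW x1)).2 normr0.
- move=> x j xj; apply: F0; apply: le_trans (coord_sqn x j).
  by rewrite -real_normK ?num_real// exprn_ege1.
Qed.

(** The integrand is the divergence of z grad w. Only one derivative falls on z, so a C^1 cutoff can
    be used. *)
Lemma rint_div z zg w g h : C1on setT z zg -> C2on setT w g h ->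
  (forall x, 1 <= sqn x -> z x = 0) -> (forall i x, 1 <= sqn x -> zg i x = 0) ->
  bfs mu (fun x => \sum_(i < n) (z x * h i x + g i x * zg i x)) /\
  rint mu (fun x => \sum_(i < n) (z x * h i x + g i x * zg i x)) = 0.
Proof.
move=> Hz [Hw Hg] z0 zg0; apply: (rint_divergence (F := fun i x => z x * g i x)).
- move=> i x; have [_ /(_ i)[_ dz]] := Hz x I; have [_ dg] := Hg x I i.
  exact: (isdM dz dg).
- move=> i x; have [cz /(_ i)[cdz _]] := Hz x I; have [ch _] := Hg x I i.
  have [_ /(_ i)[cg _]] := Hw x I.
  exact: (continuousD (continuousM cz ch) (continuousM cg cdz)).
- by move=> i x x1; rewrite z0// zg0// !mul0r mulr0 addr0.
Qed.

(** The integrand is the divergence of z grad w - w grad z, in which the products of first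
    derivatives cancel. *)
Lemma rint_green z zg zh w g h : C2on setT z zg zh -> C2on setT w g h ->
  (forall x, 1 <= sqn x -> z x = 0) -> (forall i x, 1 <= sqn x -> zg i x = 0) ->
  (forall i x, 1 <= sqn x -> zh i x = 0) ->
  bfs mu (fun x => \sum_(i < n) (z x * h i x - w x * zh i x)) /\
  rint mu (fun x => \sum_(i < n) (z x * h i x - w x * zh i x)) = 0.
Proof.
move=> [Hz Hzg] [Hw Hg] z0 zg0 zh0.
apply: (rint_divergence (F := fun i x => z x * g i x - w x * zg i x)).
- move=> i x; have [_ /(_ i)[_ dz]] := Hz x I; have [_ dg] := Hg x I i.
  have [_ /(_ i)[_ dw]] := Hw x I; have [_ dzg] := Hzg x I i.
  by apply: (isd_eq (isdB (isdM dz dg) (isdM dw dzg))); ring.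
- move=> i x; have [cz _] := Hz x I; have [ch _] := Hg x I i.
  have [cw _] := Hw x I; have [czh _] := Hzg x I i.
  exact: (continuousB (continuousM cz ch) (continuousM cw czh)).
- by move=> i x x1; rewrite z0// zg0// zh0// !mul0r !mulr0 subrr.
Qed.

End global_calculus.

(** * Radial profiles *)

Section cutoff_functions.
Context {R : realType}.

Lemma continuous_mull (k : R) (f : R -> R) (t : R) : {for t, continuous f} ->
  {for t, continuous (fun s => k * f s)}.
Proof. by move=> cf; apply: continuousM => //; exact: cst_continuous. Qed.

Definition pos1 (t : R) : R := Num.max t 0.

Lemma continuous_pos1 : continuous pos1.
Proof. by move=> t; apply: continuous_max; [exact: cvg_id|exact: cvg_cst]. Qed.

Lemma C2R_pos3 : C2R pos3 (fun t : R => 3 * pos2 t) (fun t => 6 * pos1 t).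
Proof.
split; first by move=> t; exact: (@continuous_mull 6 pos1 t (@continuous_pos1 t)).
  exact: is_derive_pos3.
by move=> t; apply: (isd_eq (isdZ 3 (is_derive_pos2 t))); rewrite /pos1; ring.
Qed.

Lemma C2R_id : C2R (fun t : R => t) (fun=> 1) (fun=> 0).
Proof. by split; [exact: cst_continuous|exact: isd_id|move=> t; exact: isd_cst]. Qed.

Lemma C2R_affine (f0 f1 f2 : R -> R) (a b : R) : C2R f0 f1 f2 ->
  C2R (fun t => f0 (a * t + b)) (fun t => a * f1 (a * t + b))
      (fun t => a ^+ 2 * f2 (a * t + b)).
Proof.
move=> [c2 d1 d2].
have da (t : R) : is_derive t 1 (fun t : R => a * t + b) a.
  by apply: (isd_eq (isdD (isdZ a (isd_id t)) (isd_cst b t 1))); rewrite mulr1 addr0.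
split.
- move=> t; apply: (@continuous_mull (a ^+ 2) (fun t => f2 (a * t + b))).
  apply: continuous_comp; last exact: c2.
  exact: (is_derive_continuous da).
- by move=> t; apply: (isd_eq (isd_comp (d1 _) (da t))); rewrite mulrC.
- by move=> t; apply: (isd_eq (isdZ a (isd_comp (d2 _) (da t)))); ring.
Qed.

Lemma C2R_comp (f0 f1 f2 k0 k1 k2 : R -> R) : C2R f0 f1 f2 -> C2R k0 k1 k2 ->
  C2R (fun t => f0 (k0 t)) (fun t => f1 (k0 t) * k1 t)
      (fun t => f2 (k0 t) * k1 t ^+ 2 + f1 (k0 t) * k2 t).
Proof.
move=> [c2 d1 d2] [ck2 dk1 dk2].
have ck0 := is_derive_continuous dk1; have ck1 := is_derive_continuous dk2.
have c1 := is_derive_continuous d2.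
split.
- have cc (f : R -> R) (t : R) : continuous f -> {for t, continuous (fun t => f (k0 t))}.
    by move=> cf; apply: continuous_comp; [exact: ck0|exact: cf].
  move=> t; exact: (continuousD (continuousM (cc _ t c2) (continuousM (ck1 t) (ck1 t)))
    (continuousM (cc _ t c1) (ck2 t))).
- by move=> t; exact: isd_comp.
- by move=> t; apply: (isd_eq (isdM (isd_comp (d2 _) (dk1 t)) (dk2 t))); ring.
Qed.

Lemma C2RM (f0 f1 f2 k0 k1 k2 : R -> R) : C2R f0 f1 f2 -> C2R k0 k1 k2 ->
  C2R (fun t => f0 t * k0 t) (fun t => f0 t * k1 t + k0 t * f1 t)
      (fun t => f0 t * k2 t + 2 * (f1 t * k1 t) + k0 t * f2 t).
Proof.
move=> [c2 d1 d2] [ck2 dk1 dk2].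
have ck0 := is_derive_continuous dk1; have ck1 := is_derive_continuous dk2.
have c0 := is_derive_continuous d1; have c1 := is_derive_continuous d2.
split.
- move=> t; exact: (continuousD (continuousD (continuousM (c0 t) (ck2 t))
    (@continuous_mull 2 _ t (continuousM (c1 t) (ck1 t)))) (continuousM (ck0 t) (c2 t))).
- by move=> t; exact: isdM.
- by move=> t; apply: (isd_eq (isdD (isdM (d1 t) (dk2 t)) (isdM (dk1 t) (d2 t)))); ring.
Qed.

End cutoff_functions.

Section profiles.
Context {R : realType}.

Lemma pos1_ge0 (t : R) : 0 <= pos1 t.
Proof. by rewrite /pos1 le_max lexx orbT. Qed.

Lemma pos1E (t : R) : 0 <= t -> pos1 t = t.
Proof. by move=> t0; rewrite /pos1 max_l. Qed.

Lemma pos1_eq0 (t : R) : t <= 0 -> pos1 t = 0.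
Proof. by move=> t0; rewrite /pos1 max_r. Qed.

Lemma pos2E (t : R) : pos2 t = pos1 t ^+ 2. Proof. by []. Qed.
Lemma pos3E (t : R) : pos3 t = pos1 t ^+ 3. Proof. by []. Qed.

(* [t] stands for |x|^2: the gradient of [th (sqn x)] vanishes off 1/4 < |x|^2 < 19/20. *)
Lemma radial_plateau : exists th dth : R -> R,
  [/\ continuous dth, (forall t : R, is_derive t 1 th (dth t)),
    (forall t, 0 <= th t /\ (t < 9 / 10 -> 256^-1 <= th t)),
    (forall t, (t <= 4^-1 -> dth t = 0) /\ (19 / 20 <= t -> th t = 0 /\ dth t = 0)) &
    forall t, t < 19 / 20 -> `|2 * dth t| <= 4].
Proof.
(* 49/100 = (7/10)^2 and 1/4 + 7/10 = 19/20, so [a] reaches 0 exactly at 19/20. At 9/10 it equals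
   27/400 > 1/16, whence the lower bound 1/256 for its square. *)
pose a (t : R) := 49 / 100 - pos2 (t - 4^-1).
pose da (t : R) := - (2 * pos1 (t - 4^-1)).
have dsub (t : R) : is_derive t 1 (fun t : R => t - 4^-1) 1.
  by apply: (isd_eq (isdB (isd_id t) (isd_cst 4^-1 t 1))); rewrite subr0.
have dd (t : R) : is_derive t 1 a (da t).
  apply: (isd_eq (isdB (isd_cst (49 / 100) t 1) (isd_comp (is_derive_pos2 _) (dsub t)))).
  by rewrite /da/= mulr1 sub0r.
exists (fun t => pos2 (a t)), (fun t => 2 * pos1 (a t) * da t); split.
- move=> t; have cs : {for t, continuous (fun t : R => t - 4^-1)}.
    exact: (is_derive_continuous dsub).
  have c1 : {for t, continuous (fun t => pos1 (a t))}.
    by apply: continuous_comp; [exact: (is_derive_continuous dd)|exact: continuous_pos1].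
  have c2 : {for t, continuous (fun t : R => pos1 (t - 4^-1))}.
    by apply: continuous_comp; [exact: cs|exact: continuous_pos1].
  exact: (continuousM (@continuous_mull _ 2 _ t c1) (continuousN (@continuous_mull _ 2 _ t c2))).
- by move=> t; exact: (isd_comp (is_derive_pos2 _) (dd t)).
- move=> t; split; first by rewrite pos2E sqr_ge0.
  move=> t9; rewrite pos2E /a pos2E.
  have [t4|t4] := leP (t - 4^-1) 0.
    rewrite (pos1_eq0 t4) pos1E; lra.
  rewrite (pos1E (ltW t4)).
  have : 27 / 400 <= 49 / 100 - (t - 4^-1) ^+ 2 by nra.
  by move=> H; rewrite pos1E; nra.
- move=> t; split => t4.
    by rewrite /da (@pos1_eq0 (t - 4^-1)) ?subr_le0// mulr0 oppr0 mulr0.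
  have -> : pos1 (a t) = 0.
    by apply: pos1_eq0; rewrite /a pos2E pos1E; nra.
  have -> : pos2 (a t) = 0.
    by rewrite pos2E pos1_eq0 ?expr0n// /a pos2E pos1E; nra.
  by rewrite mulr0 mul0r.
move=> t t19.
have a0 : 0 <= pos1 (t - 4^-1) <= 7 / 10.
  by rewrite pos1_ge0/= /pos1 ge_max; apply/andP; split; lra.
have a1 : 0 <= pos1 (a t) <= 49 / 100.
  rewrite pos1_ge0/= /pos1 ge_max; apply/andP; split; last lra.
  by rewrite /a pos2E; have := sqr_ge0 (pos1 (t - 4^-1)); lra.
rewrite /da; move: (pos1 (a t)) (pos1 (t - 4^-1)) a0 a1 => x y /andP[y0 y1] /andP[x0 x1].
by rewrite ler_norml; apply/andP; split; nra.
Qed.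

(* The Laplacian of [e0 (sqn x)] is [4 t e2 t + 2 n e1 t] at [t = sqn x]. The profile is
   (1 - s)_+^3 (15 s + 7) with s = 10 t / 9; its derivative is -6 (1 - s)_+^2 (10 s + 1) in s,
   whence strict superharmonicity near the origin in every dimension. *)
Lemma radial_barrier : exists e0 e1 e2 : R -> R,
  [/\ C2R e0 e1 e2,
    (forall t, 9 / 10 <= t -> [/\ e0 t = 0, e1 t = 0 & e2 t = 0]),
    (forall t, 0 <= t < 9 / 10 -> [/\ 0 <= e0 t <= 22, e1 t <= 0 & 4 * t * e2 t <= 600]) &
    (forall t, 0 <= t < 31 / 100 -> 4 * t * e2 t + 2 * e1 t <= - 7)].
Proof.
have H := C2R_affine (10 / 9 : R) 0 (C2RM (C2R_affine (-1) 1 C2R_pos3) (C2R_affine 15 7 C2R_id)).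
eexists _, _, _; split; first exact: H.
- move=> t t9 /=.
  have -> : pos3 (-1 * (10 / 9 * t + 0) + 1) = 0.
    by rewrite pos3E pos1_eq0 ?expr0n//; lra.
  have -> : pos2 (-1 * (10 / 9 * t + 0) + 1) = 0.
    by rewrite pos2E pos1_eq0 ?expr0n//; lra.
  by rewrite (@pos1_eq0 (-1 * (10 / 9 * t + 0) + 1)); [split; ring|lra].
- move=> t /andP[t0 t9]; rewrite /= pos3E pos2E.
  (* In y = 1 - 10 t / 9 the three quantities are polynomials on (0, 1]; the second factor of the
     profile is 22 - 15 y, which explains the bound 22. *)
  set y := -1 * (10 / 9 * t + 0) + 1.
  have [y0 y1] : 0 < y /\ y <= 1 by rewrite /y; split; lra.
  have -> : t = 9 / 10 * (1 - y) by rewrite /y; field.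
  rewrite (pos1E (ltW y0)).
  have -> : 15 * (10 / 9 * (9 / 10 * (1 - y)) + 0) + 7 = 22 - 15 * y by field.
  move: y y0 y1 => y y0 y1; split.
  + have y3 : 0 <= y ^+ 3 <= 1 by apply/andP; split; [exact: exprn_ge0 (ltW y0)|exact: exprn_ile1 (ltW y0) y1].
    by apply/andP; move: (y ^+ 3) y3 => z /andP[z0 z1]; split; nra.
  + have -> : 10 / 9 * (y ^+ 3 * (15 * 1) + (22 - 15 * y) * (-1 * (3 * y ^+ 2))) =
      - (y ^+ 2 * (220 / 3 - 200 / 3 * y)) by field.
    by rewrite oppr_le0 mulr_ge0 ?sqr_ge0//; lra.
  + have -> : 4 * (9 / 10 * (1 - y)) * ((10 / 9) ^+ 2 *
      (y ^+ 3 * (15 ^+ 2 * 0) + 2 * (-1 * (3 * y ^+ 2) * (15 * 1)) +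
      (22 - 15 * y) * ((-1) ^+ 2 * (6 * y)))) =
      40 / 9 * ((1 - y) * y * (132 - 180 * y)) by field.
    have : 0 <= (1 - y) * y <= 1 by apply/andP; split; nra.
    by move: ((1 - y) * y) => z /andP[z0 z1]; nra.
- move=> t /andP[t0 t9]; rewrite /= pos3E pos2E.
  set y := -1 * (10 / 9 * t + 0) + 1.
  have [y0 y1] : 59 / 90 < y /\ y <= 1 by rewrite /y; split; lra.
  have -> : t = 9 / 10 * (1 - y) by rewrite /y; field.
  rewrite (@pos1E y); last lra.
  move: y y0 y1 => y y0 y1.
  have -> : 4 * (9 / 10 * (1 - y)) * ((10 / 9) ^+ 2 *
      (y ^+ 3 * (15 ^+ 2 * 0) + 2 * (-1 * (3 * y ^+ 2) * (15 * 1)) +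
      (15 * (10 / 9 * (9 / 10 * (1 - y)) + 0) + 7) * ((-1) ^+ 2 * (6 * y)))) +
      2 * (10 / 9 * (y ^+ 3 * (15 * 1) + (15 * (10 / 9 * (9 / 10 * (1 - y)) + 0) + 7) *
      (-1 * (3 * y ^+ 2)))) = 20 / 9 * (y * (420 * y ^+ 2 - 690 * y + 264)) by field.
  (* A convex quadratic, at most -6 at both ends 59/90 and 1; the factor 20 y / 9 with y > 59/90
     then brings the product below -7. The end 59/90 corresponds to t = 31/100. *)
  have : 420 * y ^+ 2 - 690 * y + 264 <= - 6 by nra.
  by move: (420 * y ^+ 2 - 690 * y + 264) => z z0; nra.
Qed.

(** The function sqrt (t^2 + d^2), a C^2 substitute for |t|. Its convexity gives a sign to the term
    b2 (v) |grad v|^2 in the Laplacian of b0 (v), which is the heart of Kato's inequality. *)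
Lemma smooth_abs (d : R) : 0 < d -> exists b0 b1 b2 : R -> R,
  [/\ C2R b0 b1 b2, (forall t, `|t| <= b0 t <= `|t| + d), (forall t, `|b1 t| <= 1) &
    forall t, 0 <= b2 t].
Proof.
move=> d0.
pose s (t : R) := t ^+ 2 + d ^+ 2.
have s0 t : 0 < s t by rewrite ltr_wpDl ?sqr_ge0// exprn_gt0.
pose b (t : R) := Num.sqrt (s t).
have b0 t : 0 < b t by rewrite sqrtr_gt0.
have bb t : b t * b t = s t by rewrite -expr2 sqr_sqrtr// ltW.
have ds (t : R) : is_derive t 1 s (2 * t).
  have H := isdD (isdM (isd_id t) (isd_id t)) (isd_cst (d ^+ 2) t 1).
  by apply: (isd_eq H); ring.
have db (t : R) : is_derive t 1 b (t / b t).
  apply: (isd_eq (isd_comp (is_derive1_sqrt (s0 t)) (ds t))).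
  by rewrite -/(b t); field; rewrite gt_eqF.
have dinv (t : R) : is_derive t 1 (fun t => (b t)^-1) (- (b t)^-2 * (t / b t)).
  exact: (is_deriveV (lt0r_neq0 (b0 t)) (db t)).
exists b, (fun t => t / b t), (fun t => d ^+ 2 / b t ^+ 3); split.
- split => //.
  + move=> t; apply: (@continuous_mull _ (d ^+ 2) (fun t => (b t ^+ 3)^-1)).
    have cb : {for t, continuous b} by exact: (is_derive_continuous db).
    apply: continuousV; first by rewrite expf_neq0// gt_eqF.
    exact: (continuousM cb (continuousM cb cb)).
  + move=> t; apply: (isd_eq (isdM (isd_id t) (dinv t))).
    have -> : d ^+ 2 = b t * b t - t ^+ 2 by rewrite bb /s addrC addKr.
    by field; rewrite gt_eqF.
- move=> t; have bt := bb t; have := b0 t; have tt : `|t| ^+ 2 = t ^+ 2 by rewrite real_normK ?num_real.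
  have := normr_ge0 t; rewrite /s -tt in bt; move: (`|t|) (b t) bt => x y xy x0 y0.
  by apply/andP; split; nra.
- move=> t; rewrite normrM normfV (gtr0_norm (b0 t)) ler_pdivrMr// mul1r.
  by rewrite -sqrtr_sqr ler_wsqrtr// /s lerDl sqr_ge0.
- by move=> t; rewrite divr_ge0 ?sqr_ge0// exprn_ge0// ltW.
Qed.

End profiles.

Section indicators.
Context {R : realType} {n : nat}.
Implicit Types (x : 'rV[R]_n).

Lemma indic_sballE r x : \1_(@sball R n r) x = (sqn x < r)%R%:R :> R.
Proof.
rewrite indicE; congr (nat_of_bool _)%:R.
by apply/idP/idP => [/set_mem//|H]; apply: mem_set.
Qed.

Lemma indic_shellE a b x :
  \1_(@sball R n b `\` @sball R n a) x = ((a <= sqn x) && (sqn x < b))%R%:R :> R.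
Proof.
rewrite indicE; congr (nat_of_bool _)%:R; apply/idP/idP.
  by move=> /set_mem[xb /negP]; rewrite -leNgt => ->.
by move=> /andP[ax xb]; apply: mem_set; split => //; apply/negP; rewrite -leNgt.
Qed.

Lemma measurable_shell a b : measurable (@sball R n b `\` @sball R n a).
Proof. by apply: measurableD; exact: measurable_sball. Qed.

Lemma bfs_shell_continuous a b (f : 'rV[R]_n -> R) : continuous f ->
  bfs (lebesgue_rV n) (fun x => \1_(@sball R n b `\` @sball R n a) x * f x).
Proof.
move=> cf; have [K HK] := compact_fun_bounded (@compact_le_sqn R n b) (continuous_subspaceT cf).
apply: (@bfs_patch _ _ _ _ b K).
- exact: measurable_shell.
- by move=> x [].
- by apply: measurable_funTS; exact: continuous_measurable_rV.
- by move=> x [/ltW xb _]; exact: HK.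
Qed.

Lemma bfs_sball_continuous b (f : 'rV[R]_n -> R) : continuous f ->
  bfs (lebesgue_rV n) (fun x => \1_(@sball R n b) x * f x).
Proof.
move=> cf; have [K HK] := compact_fun_bounded (@compact_le_sqn R n b) (continuous_subspaceT cf).
apply: (@bfs_patch _ _ _ _ b K).
- exact: measurable_sball.
- by [].
- by apply: measurable_funTS; exact: continuous_measurable_rV.
- by move=> x /ltW xb; exact: HK.
Qed.

Lemma continuous_sum_rV (F : 'I_n -> 'rV[R]_n -> R) : (forall i, continuous (F i)) ->
  continuous (fun x => \sum_(i < n) F i x).
Proof. by move=> cF; apply: continuous_big; [exact: add_continuous|]. Qed.

Lemma continuous_norm (f : 'rV[R]_n -> R) : continuous f -> continuous (fun x => `|f x|).
Proof. by move=> cf x; apply: continuous_comp; [exact: cf|exact: norm_continuous]. Qed.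

End indicators.

Section kato_arithmetic.
Context {R : realFieldType}.
Implicit Types (a b c d e A L p r P : R).

(** Pointwise form of Kato's inequality: e is the barrier, A the convexity term, b the slope of the
    smoothed modulus, L = l^2, p = f (x) and r = f (l x). The constant 22 is the upper bound of the
    barrier. *)
Lemma kato_source e A b L p r : 0 <= e -> e <= 22 -> 0 <= A -> `|b| <= 1 ->
  0 <= L <= 1 -> 0 <= p -> 0 <= r -> - (22 * (p + r)) <= e * (A + b * (L * r - p)).
Proof.
move=> e0 e22 A0 b1 /andP[L0 L1] p0 r0.
have H : `|b * (L * r - p)| <= p + r.
  rewrite normrM; apply: (@le_trans _ _ (1 * `|L * r - p|)); first exact: ler_wpM2r.
  by rewrite mul1r ler_norml; apply/andP; split; nra.
move: H; rewrite ler_norml => /andP[H _]; move: (b * _) H => B H.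
have : 0 <= e * A by apply: mulr_ge0.
have : 0 <= e * (B + (p + r)) by apply: mulr_ge0 => //; lra.
have : 0 <= (22 - e) * (p + r) by apply: mulr_ge0; lra.
by lra.
Qed.

(** Now a = |v|, b is its smoothing, L the Laplacian of the barrier, p the sum f (x) + f (l x) and P
    the source term just bounded. Inside, L <= -7 yields 7 |v|; in [kato_outer], L <= 600 is an
    error charged to the shell. *)
Lemma kato_inner a b d L p P : 0 <= a -> 0 < d -> a <= b -> b <= a + d ->
  L <= - 7 -> - (22 * p) <= P -> 7 * a <= 600 * (0 + d) + 22 * p + (P - b * L).
Proof.
move=> a0 d0 ab bd L7 Pp.
have : 0 <= b * (- 7 - L) by apply: mulr_ge0; lra.
by lra.
Qed.

Lemma kato_outer a b d L p P : 0 <= a -> 0 < d -> a <= b -> b <= a + d ->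
  L <= 600 -> - (22 * p) <= P -> 0 <= 600 * (a + d) + 22 * p + (P - b * L).
Proof.
move=> a0 d0 ab bd L7 Pp.
have : 0 <= b * (600 - L) by apply: mulr_ge0; lra.
by lra.
Qed.

End kato_arithmetic.

(** * The mass of the Laplacian and the inner increment *)

Section mass_and_kato.
Context {R : realType} {n : nat}.
Notation mu := (lebesgue_rV n).
Variables (w : 'rV[R]_n -> R) (g h : 'I_n -> 'rV[R]_n -> R).
Hypothesis HC : C2on setT w g h.
Let f x := - \sum_(i < n) h i x.
Hypothesis f_ge0 : forall x, sqn x < 19 / 20 -> 0 <= f x.
Let f1 x := \1_(@sball R n (9 / 10)) x * f x.

Let cf : continuous f.
Proof.
by move=> x; apply: continuousN; apply: continuous_sum_rV => i; exact: (C2on_continuous_partial2 HC).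
Qed.

Lemma bfs_mass : bfs mu f1.
Proof. exact: bfs_sball_continuous. Qed.

(** The cutoff being radial, its gradient 2 th' (|x|^2) x is parallel to x, so the test produces
    only x . grad w, and only on the shell where th' does not vanish. *)
Lemma mass_le : rint mu f1 <=
  1024 * rint mu (fun x => \1_(@sball R n (19 / 20) `\` @sball R n 4^-1) x *
    `|\sum_(i < n) x ord0 i * g i x|).
Proof.
have [th [dth [cdth dd th_ge th_supp dth_le]]] := @radial_plateau R.
have Hz := C1on_comp cdth dd (@C1on_sqn R n setT).
have [||bI I0] := rint_div Hz HC.
- by move=> x x1; rewrite ((th_supp _).2 _).1//; lra.
- by move=> i x x1; rewrite ((th_supp _).2 _).2 ?mul0r//; lra.
set Y := fun x => _ * _; have bY : bfs mu Y.
  apply: bfs_shell_continuous; apply: continuous_norm.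
  apply: continuous_sum_rV => i x; have [_ /(_ i)[cg _]] := HC.1 x I.
  by apply: continuousM => //; exact: continuous_coord.
(* A multiple of the vanishing integral is subtracted so that the inequality holds pointwise: th >=
   1/256 on the ball accounts for 256, and |2 th'| <= 4 for 1024. *)
have -> : 1024 * rint mu Y = rint mu (fun x => 1024 * Y x - 256 *
    \sum_(i < n) (th (sqn x) * h i x + g i x * (dth (sqn x) * (2 * x ord0 i)))).
  by rewrite (rintB (bfsZ 1024 bY) (bfsZ 256 bI)) (rintZ 1024 bY) (rintZ 256 bI) I0 mulr0 subr0.
apply: rint_le.
- exact: bfs_mass.
- by apply: bfsB; exact: bfsZ.
move=> x; set s := \sum_(i < n) x ord0 i * g i x.
have -> : \sum_(i < n) (th (sqn x) * h i x + g i x * (dth (sqn x) * (2 * x ord0 i))) =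
    - (th (sqn x) * f x) + 2 * dth (sqn x) * s.
  rewrite /f mulrN opprK /s !mulr_sumr -big_split/=.
  by apply: eq_bigr => i _; ring.
rewrite /f1 /Y indic_sballE indic_shellE -/s.
have [t0 t9] := th_ge (sqn x); have [t4 t19] := th_supp (sqn x); have d4 := dth_le (sqn x).
have [q19|q19] := leP (19 / 20) (sqn x).
  have -> : (sqn x < 9 / 10) = false by apply/negbTE; rewrite -leNgt; lra.
  have [-> ->] := t19 q19; rewrite ?andbF ?ltNge ?q19 ?andbF /= ?mulr0n; lra.
have f0 := f_ge0 q19; have {}d4 := d4 q19.
have Hs : 4^-1 <= sqn x -> `|2 * dth (sqn x) * s| <= 4 * `|s|.
  by move=> _; rewrite normrM ler_wpM2r.
have key : (sqn x < 9 / 10)%R%:R * f x <= 256 * (th (sqn x) * f x).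
  case: (ltP (sqn x) (9 / 10)) => q9; last first.
    by rewrite mul0r; apply: mulr_ge0; [exact: ler0n|exact: mulr_ge0].
  by have := t9 q9; rewrite mul1r; nra.
have [q4|q4] := leP 4^-1 (sqn x).
  have := Hs q4; rewrite ler_norml mul1r; move: key.
  move: (_%:R * f x) (th (sqn x) * f x) (2 * dth (sqn x) * s) => A B P AB /andP[_ PB].
  by lra.
rewrite (t4 (ltW q4))/= mulr0n !mulr0 !mul0r mulr0; move: key.
by move: (_%:R * f x) (th (sqn x) * f x) => A B; lra.
Qed.

(* Kato's inequality: the Laplacian of |v|, v = w - w(l .), is at least -(f + l^2 f(l .)), and
   is tested against the barrier after replacing |v| by sqrt (v^2 + d^2). *)
Lemma kato_scaling (l : R) : (0 < n)%N -> 0 < l <= 1 ->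
  rint mu (fun x => \1_(@sball R n (31 / 100)) x * `|w x - w (l *: x)|) <=
  600 * rint mu (fun x => \1_(@sball R n (9 / 10) `\` @sball R n (31 / 100)) x *
    `|w x - w (l *: x)|) + 22 * (1 + l^-1 ^+ n) * rint mu f1.
Proof.
move=> n0 /andP[l0 l1].
have Hl := C2on_affine l 0 HC; have Hv := C2onB HC Hl.
set v := fun x => w x - w (l *: x).
have vE : (fun x => w x - w (l *: x + 0)) = v by apply/funext => x; rewrite addr0.
rewrite vE in Hv; have cv : continuous v by exact: (C1on_continuous Hv.1).
have cav := continuous_norm cv.
have bfl : bfs mu (fun x => f1 (l *: x)) by exact: bfs_scale l0 bfs_mass.
set B := fun x => \1_(sball (31 / 100)) x * `|v x|.
set S := fun x => \1_(sball (9 / 10) `\` sball (31 / 100)) x * `|v x|.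
pose chi : 'rV[R]_n -> R := \1_(sball (9 / 10)).
have bB : bfs mu B by exact: bfs_sball_continuous.
have bS : bfs mu S by exact: bfs_shell_continuous.
have bchi : bfs mu chi := bfs_sball (9 / 10).
have [e0 [e1 [e2 [He e_supp e_bd e_neg]]]] := @radial_barrier R.
have Heta := C2on_comp He (@C2on_sqn R n setT).
(* Smoothing |v| costs 600 d times the volume of the ball, which is sent to 0; the factor 7 is
   dropped at the end. *)
suff key d : 0 < d -> 7 * rint mu B <=
    600 * (rint mu S + d * rint mu chi) + 22 * (rint mu f1 + rint mu (fun x => f1 (l *: x))).
  have m0 : 0 <= rint mu f1.
    apply: rint_ge0 => x; rewrite /f1 indic_sballE; case: ltP => x9; last by rewrite mul0r.
    by rewrite mul1r f_ge0//; lra.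
  rewrite rint_scale// in key; last exact: bfs_mass.
  have B0 : 0 <= rint mu B by apply: rint_ge0 => x; rewrite mulr_ge0.
  have chi0 : 0 <= rint mu chi by exact: rint_ge0.
  suff : 7 * rint mu B <= 600 * rint mu S + 22 * (1 + l^-1 ^+ n) * rint mu f1 by lra.
  apply/ler_addgt0Pr => e e0'.
  have D0 : 0 < 600 * rint mu chi + 1 by lra.
  have d0 : 0 < e / (600 * rint mu chi + 1) by apply: divr_gt0.
  apply: (le_trans (key _ d0)).
  have : 600 * (e / (600 * rint mu chi + 1) * rint mu chi) <= e.
    have -> : 600 * (e / (600 * rint mu chi + 1) * rint mu chi) =
      e * (600 * rint mu chi / (600 * rint mu chi + 1)) by ring.
    have q1 : 600 * rint mu chi / (600 * rint mu chi + 1) <= 1.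
      by rewrite (ler_pdivrMr _ _ D0) mul1r lerDl ler01.
    exact: (ler_piMr (ltW e0') q1).
  by move: (e / _ * _) => z; lra.
move=> d0; have [b0 [b1 [b2 [Hb b0_bd b1_bd b2_ge0]]]] := smooth_abs d0.
have Hbv := C2on_comp Hb Hv.
have e_out (x : 'rV[R]_n) : 9 / 10 <= sqn x -> [/\ e0 (sqn x) = 0, e1 (sqn x) = 0 & e2 (sqn x) = 0].
  exact: e_supp.
have [|||bI I0] := rint_green Heta Hbv.
- by move=> x x1; have [] := e_out x; lra.
- by move=> i x x1; have [|_ -> _] := e_out x; [lra|rewrite mul0r].
- by move=> i x x1; have [|_ -> ->] := e_out x; [lra|rewrite !mul0r addr0].
move: bI I0; set D := fun x => \sum_(i < n) _ => bD D0.
have bm := bfs_mass.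
have b1' := bfsD bS (bfsZ d bchi); have b2' := bfsD bm bfl.
have b3' := bfsD (bfsZ 600 b1') (bfsZ 22 b2').
have bD' := bfsD b3' bD.
have -> : 600 * (rint mu S + d * rint mu chi) +
    22 * (rint mu f1 + rint mu (fun x => f1 (l *: x))) =
    rint mu (fun x => 600 * (S x + d * chi x) + 22 * (f1 x + f1 (l *: x)) + D x).
  rewrite (rintD b3' bD) D0 addr0 (rintD (bfsZ 600 b1') (bfsZ 22 b2')).
  by rewrite (rintZ 600 b1') (rintZ 22 b2') (rintD bS (bfsZ d bchi)) (rintZ d bchi) (rintD bm bfl).
rewrite -rintZ//; apply: rint_le => //; first exact: bfsZ.
move=> x; rewrite /B /S /chi /f1 indic_shellE !indic_sballE.
set G := \sum_(i < n) (g i x - l * g i (l *: x + 0)) ^+ 2.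
(* The integrand of Green's formula: barrier times the Laplacian of the smoothed modulus, minus
   smoothed modulus times the Laplacian of the barrier. G is |grad v|^2. *)
have DE : D x = e0 (sqn x) * (b2 (v x) * G + b1 (v x) * (l ^+ 2 * f (l *: x) - f x)) -
    b0 (v x) * (4 * sqn x * e2 (sqn x) + 2 * e1 (sqn x) * n%:R).
  have -> : l ^+ 2 * f (l *: x) - f x =
      \sum_(i < n) (h i x - l ^+ 2 * h i (l *: x + 0)).
    by rewrite sumrB -mulr_sumr addr0 /f; ring.
  rewrite /D sumrB -!mulr_sumr; congr (_ * _ - _ * _).
    by rewrite [LHS]big_split/= -!mulr_sumr.
  rewrite big_split/= sumr_const card_ord; congr (_ + _).
    by rewrite [RHS]mulrAC /sqn mulr_sumr; apply: eq_bigr => i _; ring.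
  by rewrite -[LHS]mulr_natr (mulrC (e1 _)).
rewrite DE sqnZ.
have q0 := sqn_ge0 x.
have G0 : 0 <= G by apply: sumr_ge0 => i _; rewrite sqr_ge0.
have [q9|q9] := leP (9 / 10) (sqn x).
  have [-> -> ->] := e_out x q9.
  have -> : (sqn x < 31 / 100) = false by apply/negbTE; rewrite -leNgt; lra.
  have fl : 0 <= (l ^+ 2 * sqn x < 9 / 10)%R%:R * f (l *: x).
    case: ltP => lq; last by rewrite mul0r.
    by rewrite mul1r; apply: f_ge0; rewrite sqnZ; lra.
  rewrite andbF /= !mulr0n; move: fl; move: (_%:R * f _) => F F0.
  by lra.
have l2 : 0 <= l ^+ 2 <= 1 by apply/andP; split; [exact: sqr_ge0|apply: exprn_ile1 => //; exact: ltW].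
have lq : l ^+ 2 * sqn x < 9 / 10 by case/andP: l2 => ? ?; nra.
have fx0 : 0 <= f x by apply: f_ge0; lra.
have flx0 : 0 <= f (l *: x) by apply: f_ge0; rewrite sqnZ; lra.
have [/andP[e00 e01] e10 e2b] := e_bd (sqn x) ltac:(by rewrite q0 q9).
have /andP[b0v b0d] := b0_bd (v x).
have n1 : 1 <= n%:R :> R by rewrite ler1n.
(* Since e1 <= 0 and n >= 1, the dimension may be replaced by 1, the case covered by the bounds on
   the profile. *)
have L0 : 4 * sqn x * e2 (sqn x) + 2 * e1 (sqn x) * n%:R <=
    4 * sqn x * e2 (sqn x) + 2 * e1 (sqn x) by nra.
have P1 := kato_source e00 e01 (mulr_ge0 (b2_ge0 (v x)) G0) (b1_bd (v x)) l2 fx0 flx0.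
rewrite lq andbT.
have v0 := normr_ge0 (v x).
have [q3|q3] := ltP (sqn x) (31 / 100); rewrite !mulr1n !mul1r mulr1.
  rewrite mulr0n mul0r.
  apply: kato_inner v0 d0 b0v b0d _ P1.
  apply: le_trans L0 _; apply: e_neg; exact/andP.
rewrite mulr0n mul0r mulr0.
apply: kato_outer v0 d0 b0v b0d _ P1.
by apply: le_trans L0 _; lra.
Qed.

End mass_and_kato.

(** * Comparison with a weighted mean *)

Section mean_value.
Context {R : realType} {n : nat}.
Notation mu := (lebesgue_rV n).
Notation leb := (@lebesgue_measure R).
Notation I01 := (`[0, 1]%classic : set (measurableTypeR R)).

(** The kernel is not normalised: its integral [kap] stays as a factor. It comes with an explicit
    potential, [tent_primitive], which is nonnegative and has the same support. *)
Definition tent (y : 'rV[R]_n) : R := pos1 (4^-1 - sqn y).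
Definition tent_primitive (y : 'rV[R]_n) : R := 4^-1 * pos2 (4^-1 - sqn y).

Lemma tent_ge0 y : 0 <= tent y. Proof. exact: pos1_ge0. Qed.

Lemma tent_primitive_ge0 y : 0 <= tent_primitive y.
Proof. by rewrite mulr_ge0// pos2E sqr_ge0. Qed.

Lemma tent_out y : 4^-1 <= sqn y -> tent y = 0 /\ tent_primitive y = 0.
Proof.
move=> y4; rewrite /tent /tent_primitive pos2E pos1_eq0 ?subr_le0//.
by rewrite expr0n mulr0.
Qed.

Lemma C1on_tent_primitive : C1on setT tent_primitive (fun i y => - (tent y * y ord0 i)).
Proof.
have ds (t : R) : is_derive t 1 (fun t : R => 4^-1 - t) (- 1).
  by apply: (isd_eq (isdB (isd_cst 4^-1 t 1) (isd_id t))); rewrite sub0r.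
have d (t : R) : is_derive t 1 (fun t : R => 4^-1 * pos2 (4^-1 - t)) (- (2^-1 * pos1 (4^-1 - t))).
  apply: (isd_eq (isdZ 4^-1 (isd_comp (is_derive_pos2 _) (ds t)))).
  by rewrite /pos1; field.
have c : continuous (fun t : R => - (2^-1 * pos1 (4^-1 - t))).
  move=> t; have c1 : {for t, continuous (fun t : R => pos1 (4^-1 - t))}.
    by apply: continuous_comp; [exact: (is_derive_continuous ds)|exact: continuous_pos1].
  exact: (continuousN (@continuous_mull _ 2^-1 _ t c1)).
have := C1on_comp c d (@C1on_sqn R n setT).
rewrite (_ : (fun (i : 'I_n) (x : 'rV[R]_n) => _ * (2 * _)) =
  fun i y => - (tent y * y ord0 i)) //.
by apply/funext => i; apply/funext => y; rewrite /tent; field.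
Qed.

Lemma continuous_tent : continuous tent.
Proof.
move=> y; apply: (@continuous_comp _ _ _ (fun y => 4^-1 - sqn y) pos1);
  last exact: continuous_pos1.
by apply: continuousB; [exact: cst_continuous|exact: continuous_sqn].
Qed.

Lemma bfs_tent : bfs mu tent.
Proof. by apply: (bfs_continuous continuous_tent) => y /tent_out[]. Qed.

Lemma bfs_tent_primitive : bfs mu tent_primitive.
Proof.
by apply: (bfs_continuous (C1on_continuous C1on_tent_primitive)) => y /tent_out[].
Qed.

Lemma rint_tent_gt0 : 0 < rint mu tent.
Proof.
apply: (@lt_le_trans _ _ (rint mu (fun y => 8^-1 * \1_(@sball R n 8^-1) y))).
  by rewrite rintZ ?mulr_gt0 ?rint_sball_gt0//; exact: bfs_sball.
apply: rint_le; [by apply: bfsZ; exact: bfs_sball|exact: bfs_tent|].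
move=> y; rewrite indic_sballE; case: ltP => y8; last by rewrite mulr0 tent_ge0.
rewrite /= mulr1 /tent pos1E; lra.
Qed.

Lemma measurable_scale_add (d : measure_display) (T : measurableType d)
    (s : T -> R) (y x : T -> 'rV[R]_n) : measurable_fun setT s ->
  measurable_fun setT y -> measurable_fun setT x ->
  measurable_fun setT (fun t => s t *: y t + x t).
Proof.
move=> ms my mx; apply: measurable_fun_rVP => i; under eq_fun do rewrite !mxE.
apply: measurable_funD; last exact: (measurableT_comp (measurable_coord_rV i) mx).
by apply: measurable_funM => //; exact: (measurableT_comp (measurable_coord_rV i) my).
Qed.

Variables (w : 'rV[R]_n -> R) (g h : 'I_n -> 'rV[R]_n -> R).
Hypothesis HC : C2on setT w g h.
Let f x := - \sum_(i < n) h i x.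
Hypothesis f_ge0 : forall x, sqn x < 19 / 20 -> 0 <= f x.
Let f1 x := \1_(@sball R n (9 / 10)) x * f x.
Let kap := rint mu tent.

Definition tent_mean (x : 'rV[R]_n) : R := rint mu (fun y => tent y * w (y + x)).

Let cw : continuous w := C1on_continuous HC.1.
Let cg i : continuous (g i) := @C1on_continuous_partial R n w g i HC.1.
Let ch i : continuous (h i) := @C2on_continuous_partial2 R n w g h i HC.

Let c_aff (k : 'rV[R]_n -> R) (s : R) (x : 'rV[R]_n) : continuous k ->
  continuous (fun y : 'rV[R]_n => k (s *: y + x)).
Proof. by move=> ck y; apply: continuous_comp; [exact: continuous_affine|exact: ck]. Qed.

Let c_radial : forall s (x : 'rV[R]_n), continuous
  (fun y : 'rV[R]_n => \sum_(i < n) y ord0 i * g i (s *: y + x)).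
Proof.
move=> s x; apply: continuous_sum_rV => i z.
by apply: continuousM; [exact: continuous_coord|exact: c_aff].
Qed.

Let b_radial s (x : 'rV[R]_n) : bfs mu
  (fun y : 'rV[R]_n => tent y * \sum_(i < n) y ord0 i * g i (s *: y + x)).
Proof.
apply: (@bfs_continuous _ _ _ 4^-1); last by move=> y /tent_out[-> _]; rewrite mul0r.
by move=> y; apply: continuousM; [exact: continuous_tent|exact: c_radial].
Qed.

Let c_line (x y : 'rV[R]_n) : continuous
  (fun s : R => \sum_(i < n) y ord0 i * g i (s *: y + x)).
Proof.
have cG : continuous (fun z => \sum_(i < n) y ord0 i * g i z).
  apply: continuous_sum_rV => i z.
  by apply: continuousM; [exact: cst_continuous|exact: cg].
move=> s; apply: (@continuous_comp _ _ _ (fun s : R => s *: y + x) (fun z => \sum_(i < n) y ord0 i * g i z)).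
  by apply: continuousD; [apply: continuousZl; exact: cvg_id|exact: cst_continuous].
exact: cG.
Qed.

(* Since grad tent_primitive = - tent . y, an integration by parts turns the first-order
   average into one of the nonnegative function [f]. *)
Lemma tent_slice (s : R) (x : 'rV[R]_n) :
  rint mu (fun y : 'rV[R]_n => tent y * \sum_(i < n) y ord0 i * g i (s *: y + x)) =
  - (s * rint mu (fun y : 'rV[R]_n => tent_primitive y * f (s *: y + x))).
Proof.
have HW := C1on_tent_primitive.
have bWf : bfs mu (fun y : 'rV[R]_n => tent_primitive y * f (s *: y + x)).
  apply: (@bfs_continuous _ _ _ 4^-1); last by move=> y /tent_out[_ ->]; rewrite mul0r.
  move=> y; apply: continuousM; first exact: (C1on_continuous HW).
  apply: (@c_aff f); move=> z; apply: continuousN.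
  by apply: continuous_sum_rV.
have btg := b_radial s x.
have [|||_ H] := @rint_divergence R n (fun i (y : 'rV[R]_n) => tent_primitive y * g i (s *: y + x))
  (fun i (y : 'rV[R]_n) => tent_primitive y * (s * h i (s *: y + x)) +
    g i (s *: y + x) * (- (tent y * y ord0 i))).
- move=> i y; have [_ /(_ i)[_ dW]] := HW y I.
  by apply: (isdM dW (isd_affine _)); have [] := HC.2 (s *: y + x) I i.
- move=> i y.
  have cWy : {for y, continuous tent_primitive} by exact: (C1on_continuous HW).
  have chy := @c_aff (h i) s x (@ch i) y; have cgy := @c_aff (g i) s x (@cg i) y.
  have cty : {for y, continuous (fun y : 'rV[R]_n => - (tent y * y ord0 i))}.
    by apply: continuousN; apply: continuousM; [exact: continuous_tent|exact: continuous_coord].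
  apply: (continuousD (continuousM cWy _) (continuousM cgy cty)).
  by apply: continuousM => //; exact: cst_continuous.
- by move=> i y y1; have [|-> ->] := @tent_out y; [lra|rewrite !mul0r oppr0 mulr0 addr0].
apply/eqP; rewrite -subr_eq0 opprK -rintZ// -rintD//; last exact: bfsZ.
rewrite -oppr_eq0 -mulN1r -rintZ; last by apply: bfsD => //; exact: bfsZ.
apply/eqP; rewrite -[RHS]H; apply: eq_rint => y; rewrite big_split/=.
have -> : \sum_(i < n) tent_primitive y * (s * h i (s *: y + x)) =
    tent_primitive y * (s * \sum_(i < n) h i (s *: y + x)).
  by rewrite !mulr_sumr.
have -> : \sum_(i < n) g i (s *: y + x) * - (tent y * y ord0 i) =
    - (tent y * \sum_(i < n) y ord0 i * g i (s *: y + x)).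
  by rewrite mulr_sumr -sumrN; apply: eq_bigr => i _; ring.
by rewrite /f; ring.
Qed.

Lemma directional_FTC (x y : 'rV[R]_n) : w (y + x) - w x =
  rint leb (fun s => \1_I01 s * \sum_(i < n) y ord0 i * g i (s *: y + x)).
Proof.
have d (s : R) : is_derive s 1 (fun s : R => w (s *: y + x))
    (\sum_(i < n) y ord0 i * g i (s *: y + x)).
  rewrite (_ : (fun s => w _) = fun s => w (x + s *: y)); last first.
    by apply/funext => t; rewrite addrC.
  rewrite addrC; apply: ((is_derive_line w x y s _).1 _).
  apply: (@C1_directional R n w g setT) => //; first exact: openT.
  + by move=> z i _; have [_ /(_ i)[]] := HC.1 z I.
  + by move=> z i _; exact: cg.
have := @rint_FTC R 0 1 _ _ ltr01 (fun s _ => d s) (continuous_subspaceT (@c_line x y)).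
by rewrite scale1r scale0r add0r => ->.
Qed.

Lemma bfs_mean x : bfs mu (fun y => tent y * w (y + x)).
Proof.
apply: (@bfs_continuous _ _ _ 4^-1); last by move=> y /tent_out[-> _]; rewrite mul0r.
move=> y; apply: continuousM; first exact: continuous_tent.
have := @c_aff w 1 x cw y.
by rewrite (_ : (fun y => w (1 *: y + x)) = fun y => w (y + x))//;
  apply/funext => z; rewrite scale1r.
Qed.

(** 2/16 + 2/4 = 5/8 < 9/10: the segments from x to x + y stay where f and its truncation [f1]
    agree. *)
Let q_seg (x y : 'rV[R]_n) (s : R) : sqn x < 16^-1 -> sqn y < 4^-1 -> 0 <= s <= 1 ->
  sqn (s *: y + x) < 9 / 10.
Proof.
move=> x16 y4 /andP[s0 s1]; apply: le_lt_trans (sqnD_le _ _) _; rewrite sqnZ.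
have : s ^+ 2 * sqn y <= 1 * sqn y by rewrite ler_wpM2r ?sqn_ge0// exprn_ile1.
lra.
Qed.

Let tf (s : R) x := rint mu (fun y => tent_primitive y * f1 (s *: y + x)).

(** w (y + x) - w (x) is an integral over the segment from x to x + y. After averaging against the
    kernel, Fubini puts the y-integral inside, where [tent_slice] turns it into -s times an average
    of f. The right-hand side is nonnegative: this is the super-mean-value property. *)
Lemma tent_mean_repr x : sqn x < 16^-1 ->
  kap * w x - tent_mean x = rint leb (fun s => \1_I01 s * (s * tf s x)).
Proof.
move=> x16.
pose F (p : 'rV[R]_n * measurableTypeR R) := \1_I01 p.2 *
  (tent p.1 * \sum_(i < n) p.1 ord0 i * g i (p.2 *: p.1 + x)).
have mI : measurable I01 by exact: measurable_itv.
have fI : (leb I01 < +oo)%E.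
  by have := @lebesgue_measure_itv R `[0, 1]; rewrite /= => ->; case: ifP => _; rewrite ltry.
have bF : bfs2 mu leb F.
  split.
    apply: measurable_funM.
      by apply: measurableT_comp measurable_snd; exact: measurable_indic.
    apply: measurable_funM.
      apply: measurableT_comp measurable_fst.
      by apply: continuous_measurable_rV; exact: continuous_tent.
    apply: measurable_sum => i; apply: measurable_funM.
      exact: (measurableT_comp (measurable_coord_rV i) measurable_fst).
    apply: (@measurableT_comp _ _ _ _ _ _ (g i)).
      by apply: continuous_measurable_rV; exact: cg.
    apply: measurable_scale_add; [exact: measurable_snd|exact: measurable_fst|exact: measurable_cst].
  have /choice[K HK] i : exists K : R, forall z, sqn z <= 9 / 10 -> `|g i z| <= K.
    exact: (compact_fun_bounded (@compact_le_sqn R n (9 / 10)) (continuous_subspaceT (@cg i))).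
  exists (@sball R n 4^-1), I01, (\sum_(i < n) `|K i|); split => //.
  - by split; [exact: measurable_sball|exact: sball_finite].
  - exact: sumr_ge0.
  move=> y s; rewrite /F/= indic_sballE indicE.
  have [/set_mem/=|_] := boolP (s \in I01); last by rewrite /= mulr0n mulr0 mul0r normr0.
  rewrite in_itv/= mulr1n mul1r mulr1 => s01.
  have [y4|y4] := ltP (sqn y) 4^-1; last first.
    by have [-> _] := tent_out y4; rewrite mul0r normr0 mulr0.
  rewrite mulr1 normrM; apply: le_trans (_ : 1 * \sum_(i < n) `|y ord0 i * g i (s *: y + x)| <= _).
    apply: ler_pM => //; last exact: ler_norm_sum.
    rewrite ger0_norm ?tent_ge0// /tent /pos1 ge_max.
    by have qy := sqn_ge0 y; apply/andP; split; lra.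
  rewrite mul1r; apply: ler_sum => i _; rewrite normrM.
  apply: le_trans (_ : 1 * `|K i| <= _); last by rewrite mul1r.
  apply: ler_pM => //.
    have yi := coord_sqn y i; rewrite -(@ler_pXn2r _ 2)// ?nnegrE// expr1n.
    by rewrite real_normK ?num_real//; lra.
  apply: le_trans (ler_norm _); apply: HK; apply: ltW; exact: q_seg.
have -> : kap * w x - tent_mean x = - rint mu (fun y => rint leb (fun s => F (y, s))).
  rewrite /tent_mean /kap mulrC -rintZ; last exact: bfs_tent.
  rewrite -[LHS]opprB -rintB; [|exact: bfs_mean|by apply: bfsZ; exact: bfs_tent].
  congr (- _); apply: eq_rint => y.
  rewrite (mulrC (w x)) -mulrBr directional_FTC -rintZ; last first.
    by apply: bfs_itv; apply: continuous_subspaceT; exact: c_line.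
  by apply: eq_rint => s; rewrite /F/=; ring.
rewrite (rint_fubini bF) -mulN1r -rintZ; last exact: (bfs_rint_ysection bF).
apply: eq_rint => s; rewrite /F/=.
rewrite rintZ; last exact: b_radial.
rewrite tent_slice indicE; have [/set_mem/=|_] := boolP (s \in I01); last by rewrite /= mulr0n !mul0r mulr0.
rewrite in_itv/= => s01; rewrite /= mulr1n !mul1r mulN1r opprK; congr (_ * _).
apply: eq_rint => y; have [y4|y4] := ltP (sqn y) 4^-1; last first.
  by have [_ ->] := tent_out y4; rewrite !mul0r.
by rewrite /f1 indic_sballE q_seg// mul1r.
Qed.

Let f1_ge0 z : 0 <= f1 z.
Proof.
rewrite /f1 indic_sballE; case: ltP => z9; last by rewrite mul0r.
by rewrite mul1r f_ge0//; lra.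
Qed.

Let bf1 : bfs mu f1.
Proof. exact: (bfs_mass HC). Qed.

Let b_tf s (x : 'rV[R]_n) : bfs mu (fun y : 'rV[R]_n => tent_primitive y * f1 (s *: y + x)).
Proof.
have [mf1 _] := bf1.
have [K HK] : exists K : R, forall z, `|f1 z| <= K.
  have [_ [A [K [_ _ HK]]]] := bf1; exists `|K| => z; apply: le_trans (HK z) _.
  apply: le_trans (ler_norm _) _; rewrite normrM indicE.
  by case: (z \in A); rewrite /= ?mulr1n ?mulr0n ?normr1 ?normr0 ?mulr1 ?mulr0.
under eq_fun do rewrite mulrC.
apply: (@bfsMb _ _ _ _ _ _ K); [|by []|exact: bfs_tent_primitive].
apply: (measurableT_comp mf1).
by apply: measurable_scale_add => //; exact: measurable_cst.
Qed.

Let W_ge0 (y : 'rV[R]_n) := tent_primitive_ge0 y.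

Let tf_ge0 s x : 0 <= tf s x.
Proof. by apply: rint_ge0 => y; rewrite mulr_ge0. Qed.

Let mI01 : measurable I01. Proof. exact: measurable_itv. Qed.

Let muI01 : leb I01 = 1%E.
Proof. by have := @lebesgue_measure_itv R `[0, 1]; rewrite /= lte_fin ltr01 sube0. Qed.

Let f1_bound : exists2 K : R, 0 <= K & forall z, f1 z <= K.
Proof.
have [_ [A [K [_ _ HK]]]] := bf1; exists `|K| => // z.
apply: (le_trans (ler_norm _)); apply: (le_trans (HK z)).
rewrite (le_trans (ler_norm _))// normrM ler_piMr//.
by rewrite indicE; case: (z \in A); rewrite ?normr1 ?normr0.
Qed.

(** Joint measurability of the inner average in (x, s) comes from Tonelli's theorem on triples (x,
    s, y); it allows x and s to be exchanged below. *)
Let bfs2_tf e : bfs2 mu leb (fun p => \1_(@sball R n e) p.1 * (\1_I01 p.2 * (p.2 * tf p.2 p.1))).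
Proof.
have [mf1 _] := bf1; have [K K0 HK] := f1_bound.
have mW : measurable_fun setT tent_primitive by case: bfs_tent_primitive.
split.
  apply: measurable_funM.
    by apply: measurableT_comp measurable_fst; apply: measurable_indic; exact: measurable_sball.
  apply: measurable_funM; first by apply: measurableT_comp measurable_snd; exact: measurable_indic.
  apply: measurable_funM; first exact: measurable_snd.
  apply: measurableT_comp; first exact: fine_measurable.
  apply: (@measurable_fun_fubini_tonelli_F _ _ _ _ _ mu
    (fun p : ('rV[R]_n * measurableTypeR R) * 'rV[R]_n =>
      (tent_primitive p.2 * f1 (p.1.2 *: p.2 + p.1.1))%:E)).
    apply/measurable_EFinP; apply: measurable_funM; first exact: (measurableT_comp mW measurable_snd).
    apply: (measurableT_comp mf1); apply: measurable_scale_add.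
    - exact: (measurableT_comp measurable_snd measurable_fst).
    - exact: measurable_snd.
    - exact: (measurableT_comp measurable_fst measurable_fst).
  by move=> p; rewrite lee_fin mulr_ge0.
exists (@sball R n e), I01, (K * rint mu tent_primitive); split => //.
- by split; [exact: measurable_sball|exact: sball_finite].
- by split => //; rewrite [X in (X < _)%E]muI01 ltry.
- by rewrite mulr_ge0// rint_ge0.
move=> x s /=; rewrite normrM ger0_norm// (mulrC (K * _)) -mulrA ler_wpM2l//.
rewrite indicE; have [/set_mem/=|_] := boolP (s \in I01); last first.
  by rewrite /= mulr0n mul0r normr0 mulr0.
rewrite in_itv/= mulr1n mul1r mulr1 => /andP[s0 s1].
rewrite ger0_norm ?mulr_ge0// -[leRHS]mul1r; apply: ler_pM => //.
rewrite -rintZ; last exact: bfs_tent_primitive.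
apply: rint_le => [||y]; [exact: b_tf|by apply: bfsZ; exact: bfs_tent_primitive|].
by rewrite mulrC ler_wpM2r.
Qed.

(** Integrating in x first, translation invariance bounds the integral of f1 (s y + x) by the mass
    of f1 whatever s and y; what remains is the integral of [tent_primitive]. *)
Let tf_L1 e s : bfs mu (fun x => \1_(@sball R n e) x * tf s x) /\
  rint mu (fun x => \1_(@sball R n e) x * tf s x) <=
  rint mu tent_primitive * rint mu f1.
Proof.
have [mf1 _] := bf1; have [K K0 HK] := f1_bound.
have mW : measurable_fun setT tent_primitive by case: bfs_tent_primitive.
pose F (p : 'rV[R]_n * 'rV[R]_n) :=
  \1_(@sball R n e) p.1 * (tent_primitive p.2 * f1 (s *: p.2 + p.1)).
have b2 : bfs2 mu mu F.
  split.
    apply: measurable_funM.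
      by apply: measurableT_comp measurable_fst; apply: measurable_indic; exact: measurable_sball.
    apply: measurable_funM; first exact: (measurableT_comp mW measurable_snd).
    apply: (measurableT_comp mf1); apply: measurable_scale_add.
    - exact: measurable_cst.
    - exact: measurable_snd.
    - exact: measurable_fst.
  exists (@sball R n e), (@sball R n 4^-1), K; split => //.
  - by split; [exact: measurable_sball|exact: sball_finite].
  - by split; [exact: measurable_sball|exact: sball_finite].
  move=> x y; rewrite /F/= normrM ger0_norm// (mulrC K) -[leRHS]mulrA ler_wpM2l//.
  have Wf : 0 <= tent_primitive y * f1 (s *: y + x) by exact: mulr_ge0.
  rewrite indic_sballE ger0_norm//.
  have [y4|y4] := ltP (sqn y) 4^-1; last first.
    by have [_ ->] := tent_out y4; rewrite mul0r mulr0.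
  rewrite mulr1 -[leRHS]mul1r; apply: ler_pM => //; rewrite /tent_primitive pos2E.
  have : 0 <= pos1 (4^-1 - sqn y) <= 1.
    rewrite pos1_ge0/= /pos1 ge_max; have := sqn_ge0 y; move=> qy.
    by apply/andP; split; lra.
  by move: (pos1 _) => z /andP[z0 z1]; nra.
have -> : (fun x => \1_(@sball R n e) x * tf s x) =
    fun x => rint mu (fun y => F (x, y)).
  by apply/funext => x; rewrite -rintZ//; exact: b_tf.
split; first exact: (bfs_rint_xsection b2).
rewrite (rint_fubini b2) mulrC -rintZ; last exact: bfs_tent_primitive.
apply: rint_le; [exact: (bfs_rint_ysection b2)|by apply: bfsZ; exact: bfs_tent_primitive|].
move=> y.
have bsh : bfs mu (fun x => f1 (x + s *: y)) by exact: bfs_shift.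
have -> : rint mu f1 * tent_primitive y = rint mu (fun x => tent_primitive y * f1 (x + s *: y)).
  by rewrite rintZ// rint_shift// mulrC.
apply: rint_le; [exact: (bfs2_ysection b2)|exact: bfsZ|move=> x].
rewrite /F [(x, y).1]/= [(x, y).2]/= (addrC (s *: y)); apply: ler_piMl.
  exact: mulr_ge0.
by rewrite indicE; case: (_ \in _).
Qed.

Lemma tent_mean_L1 e : e <= 16^-1 ->
  bfs mu (fun x => \1_(@sball R n e) x * `|kap * w x - tent_mean x|) /\
  rint mu (fun x => \1_(@sball R n e) x * `|kap * w x - tent_mean x|) <=
  rint mu tent_primitive * rint mu f1.
Proof.
move=> e16; have b2 := bfs2_tf e.
have -> : (fun x => \1_(@sball R n e) x * `|kap * w x - tent_mean x|) =
    fun x => rint leb (fun s =>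
      \1_(@sball R n e) x * (\1_I01 s * (s * tf s x))).
  apply/funext => x; rewrite indic_sballE; have [xe|xe] := ltP (sqn x) e; last first.
    by rewrite /= mulr0n mul0r; under eq_rint do rewrite mul0r; rewrite rint0.
  rewrite /= mulr1n mul1r tent_mean_repr ?(lt_le_trans xe)// ger0_norm; last first.
    apply: rint_ge0 => s; rewrite indicE; have [/set_mem/=|_] := boolP (s \in I01).
      by rewrite in_itv/= => /andP[s0 _]; rewrite !mulr_ge0.
    by rewrite /= mulr0n mul0r.
  by under [in RHS]eq_rint do rewrite mul1r.
split; first exact: (bfs_rint_xsection b2).
rewrite (rint_fubini b2)/=.
set c := rint mu tent_primitive * rint mu f1.
have c0 : 0 <= c by rewrite mulr_ge0// rint_ge0.
have bI : bfs leb (\1_I01 : measurableTypeR R -> R).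
  by apply: bfs_indic => //; rewrite [X in (X < _)%E]muI01 ltry.
have -> : c = rint leb (fun s => c * \1_I01 s).
  by rewrite rintZ// rint_indic// [X in fine X]muI01 mulr1.
apply: rint_le; [exact: (bfs_rint_ysection b2)|exact: bfsZ|move=> s].
rewrite indicE; have [/set_mem/=|_] := boolP (s \in I01); last first.
  by rewrite /= mulr0n mulr0; under eq_rint do rewrite mul0r mulr0; rewrite rint0.
rewrite in_itv/= mulr1n mulr1 => /andP[s0 s1].
have E x : \1_(@sball R n e) x * (1 * (s * tf s x)) = s * (\1_(@sball R n e) x * tf s x).
  by ring.
under eq_rint do rewrite E.
have [bt tfL] := tf_L1 e s.
by rewrite rintZ// (le_trans (ler_wpM2l s0 tfL))// ler_piMl.
Qed.

End mean_value.

(** * Variation of the weighted mean near the origin *)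

Section tent_lipschitz.
Context {R : realType} {n : nat}.
Notation mu := (lebesgue_rV n).

(** Young's inequality 2 |z x| <= x^2 / e + e z^2 in each coordinate. For |x| <= e and bounded z
    both terms are of order e, the gain used in the next estimate. *)
Lemma sqnB_sqn_le (x z : 'rV[R]_n) (e : R) : 0 < e ->
  `|sqn (z - x) - sqn z| <= (1 + e^-1) * sqn x + e * sqn z.
Proof.
move=> e0; rewrite /sqn -sumrB !mulr_sumr -big_split/=.
apply: le_trans (ler_norm_sum _ _ _) _; apply: ler_sum => i _; rewrite !mxE.
have H : 2 * `|z ord0 i * x ord0 i| <= e^-1 * x ord0 i ^+ 2 + e * z ord0 i ^+ 2.
  rewrite normrM -(real_normK (num_real (x ord0 i))) -(real_normK (num_real (z ord0 i))).
  move: `|x ord0 i| `|z ord0 i| => a b; rewrite -subr_ge0.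
  have -> : e^-1 * a ^+ 2 + e * b ^+ 2 - 2 * (b * a) = e^-1 * (a - e * b) ^+ 2.
    by field; rewrite gt_eqF.
  by rewrite mulr_ge0 ?sqr_ge0// invr_ge0 ltW.
have -> : (z ord0 i - x ord0 i) ^+ 2 - z ord0 i ^+ 2 =
  x ord0 i ^+ 2 - 2 * (z ord0 i * x ord0 i) by ring.
apply: le_trans (ler_normB _ _) _.
rewrite (ger0_norm (sqr_ge0 (x ord0 i))) (normrM 2) (ger0_norm (ler0n R 2)); lra.
Qed.

Lemma pos1_lipschitz (a b : R) : `|pos1 a - pos1 b| <= `|a - b|.
Proof.
rewrite /pos1; case: (leP a 0) => a0; case: (leP b 0) => b0;
  rewrite ?subrr ?normr0// ?sub0r ?subr0 ?normrN.
- by rewrite (gtr0_norm b0) ler0_norm; lra.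
- by rewrite (gtr0_norm a0) ger0_norm; lra.
Qed.

(** The translation is moved from w to the kernel: the mean at b minus kap c is the integral of tent
    (z - b) (w (z) - c). The variation of the mean is then governed by the kernel alone, without any
    control of grad w. *)
Lemma tent_mean_close (w : 'rV[R]_n -> R) (e c : R) (x : 'rV[R]_n) : continuous w ->
  0 < e <= 4^-1 -> sqn x <= e ^+ 2 ->
  tent_mean w 0 = rint mu tent * c ->
  `|tent_mean w x - tent_mean w 0| <=
  3 * e * rint mu (fun z => \1_(@sball R n (19 / 20)) z * `|w z - c|).
Proof.
move=> cw /andP[e0 e4] xe cE.
have cwc : continuous (fun z => w z - c).
  by move=> z; apply: continuousB; [exact: cw|exact: cst_continuous].
pose P (b z : 'rV[R]_n) := tent (z - b) * (w z - c).
have bP b : bfs mu (P b).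
  apply: (@bfs_continuous _ _ _ (2^-1 + 2 * sqn b)).
    move=> z; have ct : {for z, continuous (fun z : 'rV[R]_n => tent (z - b))}.
      apply: (@continuous_comp _ _ _ (fun z : 'rV[R]_n => z - b) (@tent R n)); last exact: continuous_tent.
      by apply: continuousB; [exact: cvg_id|exact: cst_continuous].
    exact: (continuousM ct (@cwc z)).
  move=> z zb; rewrite /P; have [|-> _] := @tent_out R n (z - b); last by rewrite mul0r.
  have := sqnD_le (z - b) b; rewrite subrK; lra.
have E b : tent_mean w b - rint mu tent * c = rint mu (P b).
  rewrite -(rint_shift b (bP b)) /tent_mean mulrC -rintZ; last exact: bfs_tent.
  rewrite -rintB; last by apply: bfsZ; exact: bfs_tent.
    by apply: eq_rint => y; rewrite /P addrK; ring.
  apply: (@bfs_continuous _ _ _ 4^-1); last by move=> y /tent_out[-> _]; rewrite mul0r.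
  move=> y; apply: continuousM; first exact: continuous_tent.
  apply: (@continuous_comp _ _ _ (fun y : 'rV[R]_n => y + b) w); last exact: cw.
  by apply: continuousD; [exact: cvg_id|exact: cst_continuous].
have -> : tent_mean w x - tent_mean w 0 = rint mu (fun z => P x z - P 0 z).
  by rewrite rintB// -!E; ring.
have bN : bfs mu (fun z => \1_(@sball R n (19 / 20)) z * `|w z - c|).
  by apply: bfs_sball_continuous; exact: continuous_norm.
have bd := bfsB (bP x) (bP 0).
apply: le_trans (rint_norm bd) _; rewrite -rintZ//.
apply: rint_le; [exact: bfs_norm|exact: bfsZ|move=> z].
rewrite /P subr0 -mulrBl normrM indic_sballE.
have ee : e ^+ 2 <= 16^-1 by nra.
(* Both kernels vanish unless |z|^2 <= 2/4 + 2 e^2, which is below 19/20. *)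
have [z9|z9] := ltP (sqn z) (19 / 20); last first.
  have [|-> _] := @tent_out R n z; first lra.
  have [|-> _] := @tent_out R n (z - x); last by rewrite subrr normr0 !mul0r mulr0.
  have := sqnD_le (z - x) x; rewrite subrK; lra.
rewrite mul1r ler_wpM2r//; apply: le_trans (pos1_lipschitz _ _) _.
rewrite [X in `|X|](_ : _ = - (sqn (z - x) - sqn z)); last by ring.
rewrite normrN; apply: le_trans (sqnB_sqn_le x z e0) _.
(* The total is e^2 + e + e |z|^2 <= 3 e, by e <= 1/4 and |z|^2 < 1. *)
have : (1 + e^-1) * sqn x <= (1 + e^-1) * e ^+ 2.
  by rewrite ler_wpM2l// addr_ge0// invr_ge0 ltW.
have -> : (1 + e^-1) * e ^+ 2 = e ^+ 2 + e by field; rewrite gt_eqF.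
by have := sqn_ge0 z; nra.
Qed.

End tent_lipschitz.

Lemma continuous_sum_at (R : realType) (n : nat) (V : normedModType R)
    (F : 'I_n -> V -> R) (x : V) : (forall i, {for x, continuous (F i)}) ->
  {for x, continuous (fun z => \sum_(i < n) F i z)}.
Proof.
move=> cF; elim: (index_enum _) => [|i r IH].
  rewrite (_ : (fun z => _) = fun=> 0); first exact: cst_continuous.
  by apply/funext => z; rewrite big_nil.
rewrite (_ : (fun z => _) = fun z => F i z + \sum_(j <- r) F j z).
  exact: (continuousD (cF i) IH).
by apply/funext => z; rewrite big_cons.
Qed.

(** * Increments along rays in the outer shell *)

Section ray_estimate.
Context {R : realType} {n : nat}.
Notation mu := (lebesgue_rV n).
Notation leb := (@lebesgue_measure R).
Variable u : 'rV[R]_n -> R.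
Hypothesis Hu : smooth_on_closure (eball 1) u.

Lemma eball1E : eball 1 = @sball R n 1.
Proof. by rewrite eballE ?expr1n. Qed.

Lemma smooth_C2on : C2on (@sball R n 1) u (fun i => partial i u) (fun i => partial i (partial i u)).
Proof.
have [Hs _ _] := Hu; rewrite eball1E in Hs.
split=> x x1; last first.
  move=> i; split; first by have [] := Hs [:: i; i] x x1.
  by apply: derivableP; have [_ /(_ i)] := Hs [:: i] x x1.
split; first by have [] := Hs [::] x x1.
move=> i; split; first by have [] := Hs [:: i] x x1.
by apply: derivableP; have [_ /(_ i)] := Hs [::] x x1.
Qed.

Let compact_closure : compact (closure (@eball R n 1)).
Proof.
apply: (subclosed_compact _ (@compact_le_sqn R n 1)); first exact: closed_closure.
rewrite eball1E [X in _ `<=` X](closure_id _).1; last exact: closed_le_sqn.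
by apply: closure_subset => x; exact: ltW.
Qed.

(** Regularity up to the boundary enters here and in the next lemma: compactness of the closed ball
    bounds u and its gradient, whence integrability over the open ball. *)
Lemma smooth_bounded : exists K : R, forall x, sqn x < 1 -> `|u x| <= K.
Proof.
have [_ cu _] := Hu; have [K HK] := compact_fun_bounded compact_closure cu.
by exists K => x x1; apply: HK; apply: subset_closure; rewrite eball1E.
Qed.

Lemma smooth_bounded_partial i : exists K : R, forall x, sqn x < 1 -> `|partial i u x| <= K.
Proof.
have [_ _ /(_ [:: i])[k ck kE]] := Hu.
have [K HK] := compact_fun_bounded compact_closure ck.
exists K => x x1; have xB : @eball R n 1 x by rewrite eball1E.
by rewrite -[partial i u x](kE x xB); apply: HK; exact: subset_closure.
Qed.

Let gd := smooth_C2on.1.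

Lemma radial_deriveE x : sqn x != 0 ->
  enorm x * radial_derive u x = \sum_(i < n) x ord0 i * partial i u x.
Proof.
move=> x0; rewrite /radial_derive mulr_sumr; apply: eq_bigr => i _.
have e0 : enorm x != 0.
  by rewrite /enorm sqrtr_eq0 -ltNge lt_neqAle eq_sym x0 sqn_ge0.
by field.
Qed.

(** Continuous on the open set 0 < |x|^2 < 1, and identically 0 on the rest of the ball because the
    inverse of 0 is 0. *)
Lemma measurable_radial_derive : measurable_fun (@sball R n 1) (radial_derive u).
Proof.
pose O : set 'rV[R]_n := @sball R n 1 `&` [set x | 0 < sqn x].
have oO : open O.
  apply: openI; first exact: open_sball.
  apply: (@open_comp _ _ (@sqn R n) [set y | 0 < y]) => [x _|]; last exact: open_gt.
  exact: continuous_sqn.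
have mO : measurable O by exact: open_measurable_rV.
have mB := @measurable_sball R n 1.
have -> : @sball R n 1 = O `|` (@sball R n 1 `\` O).
  by rewrite setDUK// => x [].
apply/measurable_funU => //; first exact: measurableD.
split.
  apply: open_continuous_measurable_rV => // x [x1 x0].
  apply: continuous_sum_at => i; have [_ /(_ i)[cg _]] := gd x1.
  apply: continuousM; last exact: cg.
  apply: continuousM; first exact: continuous_coord.
  apply: continuousV; first by rewrite sqrtr_eq0 -ltNge.
  apply: (@continuous_comp _ _ _ (@sqn R n) Num.sqrt); first exact: continuous_sqn.
  exact: sqrt_continuous.
have rd0 : {in @sball R n 1 `\` O, cst 0 =1 radial_derive u}.
  move=> x /set_mem[x1 xO]; rewrite /radial_derive big1// => i _.
  rewrite (_ : enorm x = 0) ?invr0 ?mulr0 ?mul0r//.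
  by apply/eqP; rewrite sqrtr_eq0 leNgt; apply/negP => x0; apply: xO.
have mrd := @eq_measurable_fun _ _ _ _ _ _ _ rd0.
by apply: mrd; exact: measurable_cst.
Qed.

Lemma bfs_radial : bfs mu (fun x => \1_(@sball R n 1 `\` @sball R n 4^-1) x * radial_derive u x).
Proof.
have /choice[K HK] := smooth_bounded_partial.
apply: (@bfs_patch R n _ _ 1 (\sum_i `|K i|)).
- exact: measurable_shell.
- by move=> x [].
- exact: (measurable_funS (measurable_sball 1) (@subDsetl _ _ _) measurable_radial_derive).
- move=> x [x1 _]; rewrite /radial_derive (le_trans (ler_norm_sum _ _ _))//.
  apply: ler_sum => i _; rewrite normrM -[leRHS]mul1r; apply: ler_pM => //; last first.
    by apply: le_trans (HK i x x1) _; exact: ler_norm.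
  have [x0|x0] := eqVneq (enorm x) 0; first by rewrite x0 invr0 mulr0 normr0.
  rewrite normrM normfV (ger0_norm (sqrtr_ge0 _)) ler_pdivrMr; last first.
    by rewrite lt_neqAle eq_sym x0 sqrtr_ge0.
  by rewrite mul1r -sqrtr_sqr ler_wsqrtr// coord_sqn.
Qed.

Notation l := (9 / 10 : R).
Notation Il := (`[l, 1]%classic : set (measurableTypeR R)).

Let sball_scale (t : R) (x : 'rV[R]_n) : 0 <= t <= 1 -> sqn x < 1 -> sqn (t *: x) < 1.
Proof.
move=> /andP[t0 t1] x1; rewrite sqnZ.
apply: le_lt_trans x1; rewrite ler_piMl ?sqn_ge0// exprn_ile1//.
Qed.

Let c_ray x : sqn x < 1 -> {within `[l, 1], continuous
  (fun t : R => \sum_(i < n) x ord0 i * partial i u (t *: x))}.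
Proof.
move=> x1; apply: continuous_in_subspaceT => t; rewrite inE/= in_itv/= => /andP[t0 t1].
have tx : sqn (t *: x) < 1 by apply: sball_scale => //; apply/andP; split; lra.
pose S z := \sum_(i < n) x ord0 i * partial i u z.
have cS : {for t *: x, continuous S}.
  apply: continuous_sum_at => i; have [_ /(_ i)[cg _]] := gd tx.
  by apply: continuousM; [exact: cst_continuous|exact: cg].
apply: (@continuous_comp _ _ _ (fun t : R => t *: x) S); last exact: cS.
by apply: continuousZl; exact: cvg_id.
Qed.

Lemma ray_bound x : sqn x < 1 -> `|u x - u (l *: x)| <=
  rint leb (fun t => \1_Il t * `|\sum_(i < n) x ord0 i * partial i u (t *: x)|).
Proof.
move=> x1; have cr := c_ray x1.
have d (t : R) : t \in `[l, 1] -> is_derive t 1 (fun t : R => u (t *: x))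
    (\sum_(i < n) x ord0 i * partial i u (t *: x)).
  rewrite in_itv/= => /andP[t0 t1].
  have tx : sqn (t *: x) < 1 by apply: sball_scale => //; apply/andP; split; lra.
  rewrite (_ : (fun t => u _) = fun t => u (0 + t *: x)); last first.
    by apply/funext => s; rewrite add0r.
  apply: ((is_derive_line u 0 x t _).1 _); rewrite add0r.
  apply: (@C1_directional R n u (fun i => partial i u) (@sball R n 1)) => //.
  - exact: open_sball.
  - by move=> z i z1; have [_ /(_ i)[]] := gd z1.
  - by move=> z i z1; have [_ /(_ i)[]] := gd z1.
have l1 : l < 1 by lra.
have := @rint_FTC R l 1 _ _ l1 d cr; rewrite scale1r => <-.
apply: le_trans (rint_norm _) _; first exact: bfs_itv.
apply: rint_le.
- by apply: bfs_norm; exact: bfs_itv.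
- apply: bfs_itv => t; apply: continuous_comp; first exact: cr.
  exact: norm_continuous.
- by move=> t; rewrite normrM ger0_norm.
Qed.

Definition radial_norm : R :=
  rint mu (fun x => \1_(@sball R n 1 `\` @sball R n 4^-1) x * `|radial_derive u x|).

Let G x := \1_(@sball R n 1 `\` @sball R n 4^-1) x * `|radial_derive u x|.

Lemma bfs_radial_norm : bfs mu G.
Proof.
have := bfs_norm bfs_radial; rewrite (_ : (fun x => `|_|) = G)//.
by apply/funext => x; rewrite normrM ger0_norm.
Qed.

Let G_ge0 x : 0 <= G x. Proof. by rewrite /G mulr_ge0. Qed.

Lemma radial_norm_ge0 : 0 <= radial_norm.
Proof. exact: rint_ge0. Qed.

(** x . grad u = |x| u_r, and |x| < 1. *)
Lemma partial_ray_le x : 4^-1 <= sqn x -> sqn x < 1 ->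
  `|\sum_(i < n) x ord0 i * partial i u x| <= G x.
Proof.
move=> x4 x1; have x0 : sqn x != 0 by rewrite gt_eqF//; lra.
rewrite -radial_deriveE// /G indic_shellE x4 x1 mul1r normrM ler_piMl//.
rewrite ger0_norm ?sqrtr_ge0// /enorm -/(sqn x) -sqrtr1 ler_wsqrtr//.
exact: ltW.
Qed.

Let mIl : measurable Il. Proof. exact: measurable_itv. Qed.

Let muIl : leb Il = (10^-1)%:E.
Proof.
have := @lebesgue_measure_itv R `[l, 1]; rewrite /= lte_fin => ->.
by rewrite (_ : l < 1); [rewrite -EFinB; congr EFin; field|lra].
Qed.

Lemma bfs_shell_increment r : bfs mu
  (fun x => \1_(@sball R n 1 `\` @sball R n r) x * `|u x - u (l *: x)|).
Proof.
have [K HK] := smooth_bounded.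
have sl (x : 'rV[R]_n) : sqn x < 1 -> sqn (l *: x) < 1.
  by move=> x1; apply: sball_scale => //; apply/andP; split; lra.
apply: (@bfs_patch R n _ _ 1 (K + K)).
- exact: measurable_shell.
- by move=> x [].
- apply: (@measurable_funS _ _ _ _ (@sball R n 1)); first exact: measurable_sball.
    by move=> x [].
  apply: open_continuous_measurable_rV; first exact: open_sball.
  move=> x x1; have [cu _] := gd x1; have [cul _] := gd (sl x x1).
  apply: (@continuous_comp _ _ _ (fun x => u x - u (l *: x)) Num.norm).
    apply: continuousB; first exact: cu.
    apply: (@continuous_comp _ _ _ (fun x : 'rV[R]_n => l *: x) u); last exact: cul.
    by apply: continuousZr; exact: cvg_id.
  exact: norm_continuous.
- move=> x [x1 _]; rewrite normr_id (le_trans (ler_normB _ _))// lerD// HK//.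
  exact: sl.
Qed.

(** Fubini is applied to the ray bound. The factor 10/9 bounds 1/t in x . grad u (t x) = (1/t) (t x)
    . grad u (t x), and (10/9)^n comes from the substitution of t x for x; the length 1/10 of the
    interval is bounded by 1. *)
Lemma shell_increment_le : rint mu (fun x =>
    \1_(@sball R n 1 `\` @sball R n (31 / 100)) x * `|u x - u (l *: x)|) <=
  10 / 9 * (10 / 9) ^+ n * radial_norm.
Proof.
have bG := bfs_radial_norm.
pose F (p : 'rV[R]_n * measurableTypeR R) :=
  \1_(@sball R n 1) p.1 * (\1_Il p.2 * G (p.2 *: p.1)).
have mF : measurable_fun setT F.
  apply: measurable_funM.
    by apply: measurableT_comp measurable_fst; apply: measurable_indic; exact: measurable_sball.
  apply: measurable_funM; first by apply: measurableT_comp measurable_snd; exact: measurable_indic.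
  apply: (measurableT_comp (bfs_measurable bG)).
  have := @measurable_scale_add R n _ ('rV[R]_n * measurableTypeR R)%type snd fst (fun=> 0)
    measurable_snd measurable_fst (measurable_cst _).
  by rewrite (_ : (fun t => _ + 0) = fun t => t.2 *: t.1)//; apply/funext => t; rewrite addr0.
have b2 : bfs2 mu leb F.
  split => //; have [K K0 HK] : exists2 K : R, 0 <= K & forall x, G x <= K.
    have [_ [A [K [_ _ HK]]]] := bG; exists `|K| => // x.
    apply: (le_trans (ler_norm _)); apply: (le_trans (HK x)).
    rewrite (le_trans (ler_norm _))// normrM ler_piMr//.
    by rewrite indicE; case: (x \in A); rewrite ?normr1 ?normr0.
  exists (@sball R n 1), Il, K; split => //.
  - by split; [exact: measurable_sball|exact: sball_finite].
  - by split => //; rewrite [X in (X < _)%E]muIl ltry.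
  move=> x t; rewrite ger0_norm /F [(x, t).1]/= [(x, t).2]/=; last by rewrite !mulr_ge0.
  rewrite [leRHS](_ : _ = \1_(@sball R n 1) x * (\1_Il t * K)); last by ring.
  by rewrite !ler_wpM2l.
apply: (@le_trans _ _ (10 / 9 * rint mu (fun x => rint leb (fun t => F (x, t))))).
  rewrite -rintZ; last exact: (bfs_rint_xsection b2).
  apply: rint_le; [exact: bfs_shell_increment|by apply: bfsZ; exact: (bfs_rint_xsection b2)|].
  move=> x; rewrite indic_shellE.
  have F0 t : 0 <= F (x, t) by rewrite /F !mulr_ge0.
  have [x3|x3] := leP (31 / 100) (sqn x); last by rewrite mul0r mulr_ge0// rint_ge0.
  have [x1|x1] := ltP (sqn x) 1; last by rewrite mul0r mulr_ge0// rint_ge0.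
  rewrite mul1r (le_trans (ray_bound x1))// -rintZ; last exact: (bfs2_xsection b2).
  apply: rint_le.
  - apply: bfs_itv => t; apply: continuous_comp; first exact: c_ray.
    exact: norm_continuous.
  - by apply: bfsZ; exact: (bfs2_xsection b2).
  move=> t; rewrite /F [(x, t).1]/= [(x, t).2]/= indic_sballE x1 mul1r mulrCA indicE.
  have [/set_mem/=|_] := boolP (t \in Il); last by rewrite !mul0r.
  rewrite in_itv/= => /andP[t9 t1]; rewrite mulr1n !mul1r.
  have t0 : 0 < t by lra.
  (* (81/100)(31/100) = 2511/10000 > 1/4: t x stays in the annulus of [radial_norm]. *)
  have tt : l ^+ 2 <= t ^+ 2 <= 1.
    by rewrite exprn_ile1 ?(ltW t0)// andbT ler_pXn2r// nnegrE; lra.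
  have := @partial_ray_le (t *: x); rewrite sqnZ.
  have -> : \sum_(i < n) (t *: x) ord0 i * partial i u (t *: x) =
      t * \sum_(i < n) x ord0 i * partial i u (t *: x).
    by rewrite mulr_sumr; apply: eq_bigr => i _; rewrite mxE mulrA.
  rewrite normrM (gtr0_norm t0) => H.
  have {}H : t * `|\sum_(i < n) x ord0 i * partial i u (t *: x)| <= G (t *: x).
    by move: tt => /andP[tt1 tt2]; apply: H; nra.
  by move: H; have := normr_ge0 (\sum_(i < n) x ord0 i * partial i u (t *: x)); nra.
rewrite (rint_fubini b2) -[leRHS]mulrA ler_wpM2l//.
have c0 : 0 <= (10 / 9) ^+ n * radial_norm by rewrite mulr_ge0 ?radial_norm_ge0.
set c := _ * radial_norm in c0 *.
have bI : bfs leb (\1_Il : measurableTypeR R -> R).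
  by apply: bfs_indic => //; rewrite [X in (X < _)%E]muIl ltry.
apply: (@le_trans _ _ (rint leb (fun t => c * \1_Il t))); last first.
  by rewrite rintZ// rint_indic// [X in fine X]muIl/= ler_piMr// invf_le1// ler1n.
apply: rint_le; [exact: (bfs_rint_ysection b2)|exact: bfsZ|move=> t].
rewrite indicE; have [/set_mem/=|tI] := boolP (t \in Il); last first.
  rewrite (_ : (fun x => F (x, t)) = fun=> 0) ?rint0 ?mulr0//.
  by apply/funext => x; rewrite /F [(x, t).2]/= [\1_Il t]indicE (negbTE tI) mul0r mulr0.
rewrite in_itv/= => /andP[t9 t1]; rewrite mulr1.
have t0 : 0 < t by lra.
apply: (@le_trans _ _ (rint mu (fun x => G (t *: x)))).
  apply: rint_le; [exact: (bfs2_ysection b2)|exact: bfs_scale|move=> x].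
  have i1 (A : set R) : \1_A t <= 1 :> R by rewrite indicE; case: (_ \in _).
  have i2 (A : set 'rV[R]_n) : \1_A x <= 1 :> R by rewrite indicE; case: (_ \in _).
  rewrite /F [(x, t).1]/= [(x, t).2]/=; apply: (@le_trans _ _ (\1_Il t * G (t *: x))).
    by apply: ler_piMl; [exact: mulr_ge0|exact: i2].
  by apply: ler_piMl; [exact: G_ge0|exact: i1].
rewrite rint_scale// ler_wpM2r ?radial_norm_ge0// lerXn2r// ?nnegrE ?invr_ge0 ?(ltW t0)//.
rewrite -[leRHS]invrK lef_pV2 ?posrE// invf_div; lra.
Qed.

End ray_estimate.

(** * Extension from the unit ball to the whole space *)

Section cutoff.
Context {R : realType}.

(** The profile is (c - (t - 19/20)_+^3)_+^3 / c^3 with c = (1/50)^3: it equals 1 up to 19/20 and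
    vanishes from 19/20 + 1/50 = 97/100 on. *)
Lemma radial_cutoff : exists t0 t1 t2 : R -> R,
  [/\ C2R t0 t1 t2,
    (forall t, t < 19 / 20 -> [/\ t0 t = 1, t1 t = 0 & t2 t = 0]) &
    (forall t, 97 / 100 <= t -> [/\ t0 t = 0, t1 t = 0 & t2 t = 0])].
Proof.
pose c : R := (1 / 50) ^+ 3.
have c0 : 0 < c by rewrite exprn_gt0.
have H := C2R_comp (C2R_affine (c ^+ 3)^-1 0 C2R_id)
  (C2R_comp (C2R_affine (-1) c C2R_pos3) (C2R_affine 1 (- (19 / 20)) C2R_pos3)).
eexists _, _, _; split; first exact: H.
- move=> t t9 /=.
  have z1 : pos1 (1 * t + - (19 / 20)) = 0 by rewrite pos1_eq0//; lra.
  rewrite !pos3E !pos2E !z1 !expr0n/= !mulr0 !add0r pos1E ?(ltW c0)//.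
  by rewrite !addr0 mulVf ?expf_neq0 ?gt_eqF//; split; ring.
- move=> t t9 /=.
  have k0 : -1 * pos3 (1 * t + - (19 / 20)) + c <= 0.
    have : c <= pos3 (1 * t + - (19 / 20)).
      by rewrite pos3E /c ler_pXn2r// ?nnegrE ?pos1_ge0// pos1E; lra.
    lra.
  have z1 := pos1_eq0 k0.
  by rewrite (pos3E (-1 * _ + c)) (pos2E (-1 * _ + c)) !z1 !expr0n/=; split; ring.
Qed.

(** The extension is u times the cutoff, which vanishes before the unit sphere is reached. The sign
    of the Laplacian is inherited only where w = u, hence the restriction to |x|^2 < 19/20 in the
    estimates for w. *)
Lemma cutoff_extension (n : nat) (u : 'rV[R]_n -> R) (g h : 'I_n -> 'rV[R]_n -> R) :
  C2on (@sball R n 1) u g h ->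
  exists w : 'rV[R]_n -> R, exists g' h' : 'I_n -> 'rV[R]_n -> R,
    C2on setT w g' h' /\
    forall x, sqn x < 19 / 20 -> w x = u x /\ forall i, g' i x = g i x /\ h' i x = h i x.
Proof.
move=> Hu; have [t0 [t1 [t2 [Ht t_in t_out]]]] := radial_cutoff.
have H := C2onM (C2on_comp Ht (@C2on_sqn R n (@sball R n 1))) Hu.
eexists _, _, _; split.
  apply: (C2on_glue (b := 97 / 100) _ H).
  - lra.
  - by move=> x x9; have [-> _ _] := t_out _ x9; rewrite mul0r.
  - by move=> i x x9; have [-> -> _] := t_out _ x9; rewrite !mul0r mulr0 addr0.
  - by move=> i x x9; have [-> -> ->] := t_out _ x9; ring.
move=> x x9 /=; have [-> -> ->] := t_in _ x9.
by split; [ring|move=> i; split; ring].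
Qed.

End cutoff.

(** Here q = e^-n, qi = e^n, om is the volume of the unit ball, H the deviation on |x| < e and m the
    mass. Inserting the bound on H into that on N leaves 3 e om N on the right of kap N, and 6 e om
    <= kap makes this at most half of the left side. *)
Lemma absorb_deviation (R : realFieldType) (kap W q qi e om N H D m X : R) :
  0 < kap -> 0 <= W -> 0 <= q -> q * qi = 1 -> 0 <= N -> N <= D * X + q * H ->
  kap * H <= W * m + 3 * e * N * (qi * om) -> m <= 1024 * X -> 6 * e * om <= kap ->
  N <= (2 * D + 2 * (q * (W * 1024) / kap)) * X.
Proof.
move=> kap0 W0 q0 qq N0 NX HE mX ek; rewrite -(ler_pM2l kap0).
have -> : kap * ((2 * D + 2 * (q * (W * 1024) / kap)) * X) =
    2 * (kap * (D * X)) + 2 * (q * (W * (1024 * X))).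
  by field; rewrite gt_eqF.
have h1 : kap * N <= kap * (D * X) + q * (kap * H).
  by apply: le_trans (ler_wpM2l (ltW kap0) NX) _; lra.
have h2 : q * (kap * H) <= q * (W * m) + (q * qi) * (3 * e * N * om).
  by apply: le_trans (ler_wpM2l q0 HE) _; lra.
have h3 : q * (W * m) <= q * (W * (1024 * X)) by do 2!apply: ler_wpM2l => //.
have h4 : 0 <= N * (kap - 6 * e * om) by apply: mulr_ge0 => //; rewrite subr_ge0.
by rewrite qq mul1r in h2; lra.
Qed.

(** * The L^1 bound for the deviation *)

Section assembly.
Context {R : realType} {n : nat}.
Notation mu := (lebesgue_rV n).
Notation B1 := (@sball R n 1).
Notation l := (9 / 10 : R).

Lemma bfs_sball_on (r K : R) (F : 'rV[R]_n -> R) :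
  (forall x, sqn x < r -> {for x, continuous F} /\ `|F x| <= K) ->
  bfs mu (fun x => \1_(@sball R n r) x * F x).
Proof.
move=> HF; apply: (@bfs_patch R n _ _ r K) => //.
- exact: measurable_sball.
- apply: open_continuous_measurable_rV; first exact: open_sball.
  by move=> x /HF[].
- by move=> x /HF[].
Qed.

Variable u : 'rV[R]_n -> R.
Hypothesis Hu : smooth_on_closure (eball 1) u.

Let cu x : sqn x < 1 -> {for x, continuous u}.
Proof. by move=> x1; have [] := (smooth_C2on Hu).1 x x1. Qed.

Let sqnZ_lt a (x : 'rV[R]_n) : 0 <= a <= 1 -> sqn x < 1 -> sqn (a *: x) < 1.
Proof.
move=> /andP[a0 a1] x1; rewrite sqnZ; apply: le_lt_trans x1.
by rewrite ler_piMl ?sqn_ge0// exprn_ile1.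
Qed.

Let cuZ a (x : 'rV[R]_n) : 0 <= a <= 1 -> sqn x < 1 ->
  {for x, continuous (fun x : 'rV[R]_n => u (a *: x))}.
Proof.
move=> a01 x1; apply: (@continuous_comp _ _ _ (fun x : 'rV[R]_n => a *: x) u).
  by apply: continuousZr; exact: cvg_id.
exact/cu/sqnZ_lt.
Qed.

Lemma bfs_increment a b : 0 <= a <= 1 -> 0 <= b <= 1 ->
  bfs mu (fun x => \1_B1 x * `|u (a *: x) - u (b *: x)|).
Proof.
move=> a01 b01; have [K HK] := smooth_bounded Hu.
apply: (@bfs_sball_on 1 (K + K)) => x x1; split.
  apply: (@continuous_comp _ _ _ (fun x : 'rV[R]_n => u (a *: x) - u (b *: x)) Num.norm).
    exact: (continuousB (cuZ a01 x1) (cuZ b01 x1)).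
  exact: norm_continuous.
by rewrite normr_id (le_trans (ler_normB _ _))// lerD// HK// sqnZ_lt.
Qed.

Lemma bfs_deviation r c : r <= 1 -> bfs mu (fun x => \1_(@sball R n r) x * `|u x - c|).
Proof.
move=> r1; have [K HK] := smooth_bounded Hu.
apply: (@bfs_sball_on r (K + `|c|)) => x xr; have x1 := lt_le_trans xr r1; split.
  apply: (@continuous_comp _ _ _ (fun x : 'rV[R]_n => u x - c) Num.norm).
    exact: (continuousB (cu x1) (@cst_continuous _ _ c x)).
  exact: norm_continuous.
by rewrite normr_id (le_trans (ler_normB _ _))// lerD// HK.
Qed.

Definition increment k := rint mu (fun x => \1_B1 x * `|u x - u (l ^+ k *: x)|).

(** Telescoping: u (l^j .) - u (l^(j+1) .) is the first increment dilated by l^j, at the cost of a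
    factor (l^j)^-n, summed over j < k. *)
Fixpoint increment_const (C : R) k : R :=
  if k is k'.+1 then increment_const C k' + (l ^+ k')^-1 ^+ n * C else 0.

Let lk01 k : 0 < l ^+ k <= 1.
Proof. by rewrite exprn_gt0 ?exprn_ile1//; lra. Qed.

Let lk01' k : 0 <= l ^+ k <= 1.
Proof. by have /andP[/ltW-> ->] := lk01 k. Qed.

Lemma increment_le (C : R) k : increment 1 <= C * radial_norm u ->
  increment k <= increment_const C k * radial_norm u.
Proof.
move=> H1.
have b0 k' : bfs mu (fun x => \1_B1 x * `|u x - u (l ^+ k' *: x)|).
  have := @bfs_increment 1 (l ^+ k') _ (lk01' k').
  under eq_fun do rewrite scale1r.
  by apply; rewrite ler01 lexx.
elim: k => [|k IH].
  rewrite /increment /= mul0r (_ : (fun _ => _) = fun=> 0) ?rint0//.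
  by apply/funext => x; rewrite expr0 scale1r subrr normr0 mulr0.
have bs : bfs mu (fun x => \1_B1 x * `|u (l ^+ k *: x) - u (l ^+ k.+1 *: x)|).
  exact: bfs_increment.
apply: (@le_trans _ _ (increment k +
    rint mu (fun x => \1_B1 x * `|u (l ^+ k *: x) - u (l ^+ k.+1 *: x)|))).
  rewrite -rintD//; apply: rint_le => // [|x]; first exact: bfsD.
  rewrite -mulrDr ler_wpM2l//.
  rewrite [X in `|X|](_ : _ = (u x - u (l ^+ k *: x)) +
    (u (l ^+ k *: x) - u (l ^+ k.+1 *: x))); last by ring.
  exact: ler_normD.
have -> : increment_const C k.+1 * radial_norm u = increment_const C k * radial_norm u +
    (l ^+ k)^-1 ^+ n * C * radial_norm u by rewrite /= mulrDl.
apply: lerD => //.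
have /andP[lk0 lk1] := lk01 k.
apply: (@le_trans _ _ ((l ^+ k)^-1 ^+ n * increment 1)); last first.
  by rewrite -mulrA ler_wpM2l// exprn_ge0// invr_ge0 ltW.
rewrite /increment -rint_scale//.
apply: rint_le => // [|x]; first exact: (bfs_scale lk0 (b0 1%N)).
rewrite expr1 scalerA -exprS ler_wpM2r// !indic_sballE ler_nat.
by case: (ltP (sqn x) 1) => // x1; rewrite sqnZ_lt.
Qed.

Hypothesis Hsup : superharmonic_on (eball 1) u.

(** 601 is 600 from the Kato estimate plus 1 for the outer shell itself; 1024 is the constant of the
    mass bound. *)
Definition one_step_const : R :=
  601 * (10 / 9 * (10 / 9) ^+ n) + 22 * (1 + l^-1 ^+ n) * 1024.

Definition deviation_const k : R :=
  2 * increment_const one_step_const k +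
  2 * ((l ^+ k)^-1 ^+ n * (rint mu (@tent_primitive R n) * 1024) / rint mu (@tent R n)).

(* The hypotheses on [k] make l^k small enough for the term 3 l^k N of [tent_mean_close] to be
   absorbed into the left-hand side N. *)
Lemma deviation_le k : (0 < n)%N -> l ^+ k <= 4^-1 ->
  6 * l ^+ k * rint mu \1_B1 <= rint mu (@tent R n) ->
  exists c, rint mu (fun x => \1_B1 x * `|u x - c|) <= deviation_const k * radial_norm u.
Proof.
move=> n0 k4 kk.
have [w [g [h [HC wE]]]] := cutoff_extension (smooth_C2on Hu).
pose f x := - \sum_(i < n) h i x.
have f_ge0 x : sqn x < 19 / 20 -> 0 <= f x.
  move=> x9; have [_ gh] := wE x x9.
  have := @Hsup x; rewrite eball1E /laplacian /f => /(_ _).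
  rewrite (eq_bigr (fun i => h i x)); last by move=> i _; have [_ ->] := gh i.
  by apply; rewrite /sball/=; lra.
set X := radial_norm u; have X0 : 0 <= X := radial_norm_ge0 u.
set m := rint mu (fun x => \1_(@sball R n (9 / 10)) x * f x).
have m_le : m <= 1024 * X.
  apply: (le_trans (mass_le HC f_ge0)); rewrite (ler_wpM2l (ler0n R 1024))//.
  apply: rint_le.
  - apply: bfs_shell_continuous; apply: continuous_norm.
    apply: continuous_sum_rV => i x; apply: continuousM; first exact: continuous_coord.
    by have [_ /(_ i)[]] := HC.1 x I.
  - exact: bfs_radial_norm.
  move=> x; rewrite {1}indic_shellE.
  have [x4|x4] := leP 4^-1 (sqn x); last by rewrite mul0r mulr_ge0.
  have [x9|x9] := ltP (sqn x) (19 / 20); last by rewrite mul0r mulr_ge0.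
  rewrite mul1r; apply: le_trans (partial_ray_le _ x4 _); last by lra.
  have [_ gh] := wE x x9.
  by rewrite (eq_bigr (fun i => x ord0 i * partial i u x))// => i _; have [-> _] := gh i.
set Dout := rint mu (fun x =>
  \1_(B1 `\` @sball R n (31 / 100)) x * `|u x - u (l *: x)|).
have Dout_le : Dout <= 10 / 9 * (10 / 9) ^+ n * X by exact: shell_increment_le.
have l01 : 0 <= l <= 1 by apply/andP; split; lra.
have w_inc x : sqn x < 9 / 10 -> w x - w (l *: x) = u x - u (l *: x).
  move=> x9; have lx9 : sqn (l *: x) < 19 / 20.
    by rewrite sqnZ; have := sqn_ge0 x; lra.
  by rewrite (wE x _).1 ?(wE _ lx9).1//; lra.
have bsh r : bfs mu (fun x => \1_(B1 `\` @sball R n r) x * `|u x - u (l *: x)|).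
  exact: bfs_shell_increment.
have step1 : increment 1 <= one_step_const * X.
  have cv : continuous (fun x => `|w x - w (l *: x)|).
    have := C1on_continuous (C2onB HC (C2on_affine l 0 HC)).1.
    rewrite (_ : (fun x => w x - w (l *: x + 0)) = fun x => w x - w (l *: x)).
      exact: continuous_norm.
    by apply/funext => x; rewrite addr0.
  (* The ball is split at |x|^2 = 31/100; inside, u may be replaced by w. *)
  have inE : increment 1 = rint mu (fun x => \1_(@sball R n (31 / 100)) x * `|w x - w (l *: x)|) + Dout.
    rewrite /increment /Dout -rintD//; last exact: bfs_sball_continuous.
    apply: eq_rint => x; rewrite expr1 !indic_sballE indic_shellE.
    have [x3|x3] := ltP (sqn x) (31 / 100).
      rewrite w_inc; last by lra.
      by rewrite (_ : sqn x < 1) /= ?mul0r ?addr0//; lra.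
    by rewrite /= mul0r add0r.
  have mid : rint mu (fun x => \1_(@sball R n (9 / 10) `\` @sball R n (31 / 100)) x *
      `|w x - w (l *: x)|) <= Dout.
    apply: rint_le => // [|x]; first exact: bfs_shell_continuous.
    rewrite !indic_shellE; have [x3|x3] := leP (31 / 100) (sqn x); last by rewrite /= !mul0r.
    have [x9|x9] := ltP (sqn x) (9 / 10); last by rewrite /= mul0r mulr_ge0.
    by rewrite w_inc// (_ : sqn x < 1)//; lra.
  have l0 : 0 < l <= 1 by apply/andP; split; lra.
  have K := kato_scaling HC f_ge0 n0 l0; rewrite -/m in K.
  have c0 : 0 <= 22 * (1 + l^-1 ^+ n) :> R.
    by rewrite mulr_ge0// addr_ge0// exprn_ge0// invr_ge0; lra.
  rewrite inE; apply: (le_trans (lerD K (lexx Dout))).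
  have arith (a b D D' m' : R) : D' <= D -> D <= b * X -> a * m' <= a * (1024 * X) ->
      600 * D' + a * m' + D <= (601 * b + a * 1024) * X by lra.
  exact: arith mid Dout_le (ler_wpM2l c0 m_le).
have inc := increment_le k step1; rewrite -/X in inc.
have /andP[e0 e1] := lk01 k; move: k4 kk inc; rewrite /deviation_const.
set e := l ^+ k in e0 e1 * => e4 ek inc.
set kap := rint mu tent in ek *; have kap0 : 0 < kap by exact: rint_tent_gt0.
(* The normalised tent average at the origin, as [tent_mean_close] requires. *)
pose c := tent_mean w 0 / kap; exists c.
have cE : tent_mean w 0 = kap * c by rewrite /c mulrCA divff ?gt_eqF ?mulr1.
set N := rint mu _.
set H := rint mu (fun x => \1_(@sball R n (e ^+ 2)) x * `|u x - c|).
have e2 : e ^+ 2 <= 16^-1 by nra.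
have bH : bfs mu (fun x => \1_(@sball R n (e ^+ 2)) x * `|u x - c|).
  by apply: bfs_deviation; lra.
have bN : bfs mu (fun x => \1_B1 x * `|u x - c|) by exact: bfs_deviation.
(* Triangle inequality through u (e x); dilation turns the deviation of u (e .) on the unit ball
   into e^-n times that of u on |x| < e. *)
have NH : N <= increment k + e^-1 ^+ n * H.
  have bHe := bfs_scale e0 bH.
  rewrite /N /increment /H -rint_scale// -rintD//; last first.
    have := @bfs_increment 1 e _ (lk01' k); under eq_fun do rewrite scale1r.
    by apply; rewrite ler01 lexx.
  apply: rint_le => // [|x].
    apply: bfsD => //; have := @bfs_increment 1 e _ (lk01' k).
    under eq_fun do rewrite scale1r.
    by apply; rewrite ler01 lexx.
  rewrite indic_sball_scale// -exprMn mulVf ?gt_eqF// expr1n -mulrDr ler_wpM2l//.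
  rewrite [X in `|X|](_ : _ = (u x - u (e *: x)) + (u (e *: x) - c)); last by ring.
  exact: ler_normD.
have [bM M_le] := tent_mean_L1 HC f_ge0 e2; rewrite -/m -/kap in bM M_le.
have N'N : rint mu (fun z => \1_(@sball R n (19 / 20)) z * `|w z - c|) <= N.
  apply: rint_le => // [|x].
    apply: bfs_sball_continuous; apply: continuous_norm => x.
    exact: (continuousB (C1on_continuous HC.1 (x := x)) (@cst_continuous _ _ c x)).
  rewrite !indic_sballE; have [x9|x9] := ltP (sqn x) (19 / 20); last by rewrite mul0r mulr_ge0.
  by rewrite (wE x x9).1 (_ : sqn x < 1)//; lra.
(* kap (w - c) = (kap w - M) + (M - M (0)): the first part is bounded through the mass, the second
   pointwise by 3 e N on a ball of volume e^n |B_1|. *)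
have HE : kap * H <= rint mu (@tent_primitive R n) * m + 3 * e * N * (e ^+ n * rint mu \1_B1).
  have -> : e ^+ n * rint mu \1_B1 = rint mu \1_(@sball R n (e ^+ 2)).
    by rewrite -rint_sball_scale// mulr1.
  apply: (@le_trans _ _ (rint mu (fun x => \1_(@sball R n (e ^+ 2)) x * `|kap * w x - tent_mean w x|) +
      rint mu (fun x => 3 * e * N * \1_(@sball R n (e ^+ 2)) x))); last first.
    by rewrite rintZ ?lerD//; exact: bfs_sball.
  have bi : bfs mu (fun x => 3 * e * N * \1_(@sball R n (e ^+ 2)) x).
    by apply: bfsZ; exact: bfs_sball.
  rewrite -rintZ// -rintD//; apply: rint_le; [exact: bfsZ|exact: bfsD|move=> x].
  rewrite !indic_sballE; have [xe|xe] := ltP (sqn x) (e ^+ 2); last by rewrite !mul0r !mulr0 addr0.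
  rewrite !mul1r mulr1; have x9 : sqn x < 19 / 20 by lra.
  rewrite -(wE x x9).1 -[X in X * _](ger0_norm (ltW kap0)) -normrM.
  have -> : kap * (w x - c) = (kap * w x - tent_mean w x) + (tent_mean w x - tent_mean w 0).
    by rewrite cE; ring.
  apply: le_trans (ler_normD _ _) _; rewrite lerD2l.
  have e04 : 0 < e <= 4^-1 by rewrite e0 e4.
  apply: le_trans (tent_mean_close (C1on_continuous HC.1) e04 (ltW xe) cE) _.
  by rewrite ler_wpM2l// mulr_ge0// ltW.
have N0 : 0 <= N by apply: rint_ge0 => x; rewrite mulr_ge0.
have W0 : 0 <= rint mu (@tent_primitive R n).
  by apply: rint_ge0 => x; exact: tent_primitive_ge0.
have q0 : 0 <= e^-1 ^+ n by rewrite exprn_ge0// invr_ge0 ltW.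
have qe : e^-1 ^+ n * e ^+ n = 1 by rewrite -exprMn mulVf ?gt_eqF// expr1n.
have NX := le_trans NH (lerD inc (lexx _)).
exact: absorb_deviation kap0 W0 q0 qe N0 NX HE m_le ek.
Qed.

End assembly.

(** * From an arbitrary constant to the mean value *)

Section L1_deviation.
Context {R : realType} {n : nat}.
Notation mu := (lebesgue_rV n).
Implicit Types (u : 'rV[R]_n -> R) (D : set 'rV[R]_n).

Lemma L1norm_rint D u : measurable D -> bfs mu (fun x => \1_D x * u x) ->
  L1norm D u = (rint mu (fun x => \1_D x * `|u x|))%:E.
Proof.
move=> mD bu; rewrite rintE; last first.
  rewrite (_ : (fun x => _) = fun x => `|\1_D x * u x|); first exact: bfs_norm.
  by apply/funext => x; rewrite normrM ger0_norm.
rewrite /L1norm [LHS]integral_mkcond; congr (integral _ _ _); apply/funext => x.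
by rewrite patchE indicE; case: ifPn => _; rewrite (mul1r, mul0r).
Qed.

Lemma mean_rint D u : measurable D ->
  mean D u = rint mu (fun x => \1_D x * u x) / rint mu \1_D.
Proof.
move=> mD; rewrite rint_indic// /mean; congr (_ / _).
rewrite /rint /Rintegral; congr fine; rewrite [LHS]integral_mkcond; congr (integral _ _ _).
by apply/funext => x; rewrite patchE indicE; case: ifPn => _; rewrite (mul1r, mul0r).
Qed.

Lemma bfs_indic_sub D u k : bfs mu (\1_D : 'rV[R]_n -> R) ->
  bfs mu (fun x => \1_D x * u x) -> bfs mu (fun x => \1_D x * (u x - k)).
Proof.
move=> b1 bu; rewrite (_ : (fun x => _) = fun x => \1_D x * u x - k * \1_D x).
  exact: (bfsB bu (bfsZ k b1)).
by apply/funext => x; rewrite mulrBr (mulrC k).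
Qed.

(** The mean differs from c by at most the average of |u - c| over D, so replacing one by the other
    costs the deviation from c once more. *)
Lemma mean_deviation_le D u c : measurable D -> bfs mu (\1_D : 'rV[R]_n -> R) ->
  bfs mu (fun x => \1_D x * u x) ->
  rint mu (fun x => \1_D x * `|u x - mean D u|) <=
  2 * rint mu (fun x => \1_D x * `|u x - c|).
Proof.
move=> mD b1 bu; rewrite mean_rint//; set s := rint mu \1_D; set t := rint mu (fun x => \1_D x * u x).
have normE k : (fun x => \1_D x * `|u x - k|) = fun x => `|\1_D x * (u x - k)|.
  by apply/funext => x; rewrite normrM ger0_norm.
have bc k := bfs_indic_sub k b1 bu.
have ba k : bfs mu (fun x => \1_D x * `|u x - k|).
  by rewrite normE; apply: bfs_norm.
have s0 : 0 <= s by apply: rint_ge0.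
have mean_close : `|c - t / s| * s <= rint mu (fun x => \1_D x * `|u x - c|).
  have [s_eq0|s_neq0] := eqVneq s 0.
    by rewrite s_eq0 mulr0; apply: rint_ge0 => x; rewrite mulr_ge0.
  rewrite normE -{2}(ger0_norm s0) -normrM mulrBl divfK//.
  rewrite distrC (_ : t - c * s = rint mu (fun x => \1_D x * (u x - c))).
    exact: rint_norm.
  rewrite -(rintZ c b1) -(rintB bu (bfsZ c b1)).
  by apply: eq_rint => x; rewrite mulrBr (mulrC c).
rewrite mulrDl mul1r; apply: le_trans (lerD (lexx _) mean_close).
rewrite -(rintZ _ b1) -rintD//; last exact: bfsZ.
apply: rint_le => // [|x]; first by apply: bfsD => //; exact: bfsZ.
rewrite (mulrC `|_| (\1_D x)) -mulrDr ler_wpM2l//.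
by rewrite -[u x - t / s](subrKA c) ler_normD.
Qed.

End L1_deviation.

(** Powers of 9/10 tend to 0. The exponent is fixed by n before u enters, which makes the final
    constant uniform in u. *)
Lemma scale_exponent (R : realType) (n : nat) : exists k : nat,
  (9 / 10) ^+ k <= 4^-1 :> R /\
  6 * (9 / 10) ^+ k * rint (lebesgue_rV n) \1_(@sball R n 1) <= rint (lebesgue_rV n) (@tent R n).
Proof.
set om := rint _ _; set kap := rint _ _.
have om0 : 0 < om by exact: rint_sball_gt0.
have kap0 : 0 < kap by exact: rint_tent_gt0.
have d0 : 0 < Num.min 4^-1 (kap / (6 * om)) by rewrite lt_min invr_gt0 ltr0n divr_gt0// mulr_gt0.
have l1 : `|9 / 10 : R| < 1 by rewrite ltr_norml; apply/andP; split; lra.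
have /cvgrPdist_lt/(_ _ d0)[k _ /(_ k (leqnn k))] := cvg_expr l1.
have l0 : 0 <= 9 / 10 :> R by lra.
rewrite sub0r normrN ger0_norm ?exprn_ge0//.
rewrite lt_min => /andP[/ltW k4]; rewrite ltr_pdivlMr ?mulr_gt0// => /ltW kk.
by exists k; split => //; rewrite (mulrC 6) -mulrA.
Qed.

Section conclusion.
Context {R : realType} {n : nat}.
Notation mu := (lebesgue_rV n).
Variable u : 'rV[R]_n -> R.
Hypothesis Hu : smooth_on_closure (eball 1) u.

Lemma bfs_smooth D : measurable D -> D `<=` @sball R n 1 ->
  bfs mu (fun x => \1_D x * u x).
Proof.
move=> mD D1; have [K HK] := smooth_bounded Hu.
apply: (@bfs_patch R n D u 1 K) => // [|x /D1]; last exact: HK.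
apply: (measurable_funS (measurable_sball 1) D1).
apply: open_continuous_measurable_rV; first exact: open_sball.
by move=> x x1; have [] := (smooth_C2on Hu).1 x x1.
Qed.

End conclusion.

Lemma annulusE (R : realType) (n : nat) :
  eball 1 `\` eball 2^-1 = @sball R n 1 `\` @sball R n 4^-1.
Proof. by rewrite !eballE// ?invr_ge0// expr1n exprVn -natrX. Qed.

Theorem theorem1p4 (R : realType) (n : nat) (n_ge1 : (1 <= n)%N) :
  exists C : R, forall u : 'rV[R]_n -> R,
    smooth_on_closure (eball 1) u ->
    superharmonic_on (eball 1) u ->
    let annulus := eball 1 `\` eball 2^-1 in
    (L1norm annulus (fun x => (u x - mean annulus u)%R)
       <= C%:E * L1norm annulus (radial_derive u))%E /\
    (L1norm (eball 1) (fun x => (u x - mean (eball 1) u)%R)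
       <= C%:E * L1norm (eball 1) (radial_derive u))%E.
Proof.
have [k [k4 kk]] := scale_exponent R n.
(* The absolute value supplies C >= 0, used when the annulus norm is enlarged to the ball norm. *)
pose C : R := 2 * `|@deviation_const R n k|.
have C0 : 0 <= C by rewrite mulr_ge0.
exists C => u Hu Hsup annulus.
have [c Hc] := deviation_le Hu Hsup n_ge1 k4 kk.
have mA := @measurable_shell R n 4^-1 1.
(* One bound serves every D in the ball: the deviation on D is at most that on the ball, and the
   right-hand side is the annulus norm in both cases. *)
have L1_le D : measurable D -> D `<=` @sball R n 1 ->
    (L1norm D (fun x => (u x - mean D u)%R) <= C%:E * (radial_norm u)%:E)%E.
  move=> mD D1.
  have b1 : bfs (lebesgue_rV n) (\1_D : 'rV[R]_n -> R).
    apply: bfs_indic => //; apply: le_lt_trans (sball_finite 1).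
    by apply: le_measure; rewrite ?inE//; exact: measurable_sball.
  have bu := bfs_smooth Hu mD D1.
  have bc k' := bfs_indic_sub k' b1 bu.
  rewrite L1norm_rint// lee_fin; apply: le_trans (mean_deviation_le c mD b1 bu) _.
  rewrite /C -mulrA ler_wpM2l//.
  apply: (@le_trans _ _ (@deviation_const R n k * radial_norm u)); last first.
    by rewrite ler_wpM2r ?radial_norm_ge0// ler_norm.
  apply: le_trans Hc; apply: rint_le => [||x].
  - have := bfs_norm (bc c); rewrite (_ : (fun x => `|_|) = fun x => \1_D x * `|u x - c|)//.
    by apply/funext => x; rewrite normrM ger0_norm.
  - by apply: bfs_deviation.
  rewrite ler_wpM2r// !indicE ler_nat.
  by case: (boolP (x \in D)) => //= /set_mem/D1 x1; rewrite mem_set.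
have XE : L1norm annulus (radial_derive u) = (radial_norm u)%:E.
  by rewrite /annulus annulusE L1norm_rint//; exact: bfs_radial.
split.
  by rewrite XE /annulus annulusE; apply: L1_le; [exact: mA|exact: subDsetl].
rewrite eball1E; apply: le_trans (L1_le _ (measurable_sball 1) _) _ => //.
rewrite lee_wpmul2l ?lee_fin// -XE /annulus annulusE.
apply: ge0_subset_integral => //.
- exact: measurable_sball.
- apply/measurable_EFinP; apply: measurableT_comp => //.
  exact: measurable_radial_derive.
Qed.
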